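(* Let $n\ge 2$, $s\in(0,1/2)$, and let $W:[-1,1]\to[0,\infty)$ satisfy $W\in C^2([-1,1])$, $W(\pm1)=0$, $W>0$ in $(-1,1)$, $W'(\pm1)=0$ and $W''(\pm1)>0$. Then there exists a constant $\overline{c}>0$, depending only on $n$, $s$ and $W$, and for every $\theta_1,\theta_2\in(-1,1)$ there exists a constant $\overline{R}(\theta_1,\theta_2)>0$, depending only on $n$, $s$, $W$, $\theta_1$ and $\theta_2$, such that the following holds. If $R\ge\overline{R}(\theta_1,\theta_2)$ and $u:\mathbb{R}^n\to[-1,1]$ is a minimizer of $\mathcal{E}$ in $B_R$ with $$u(0)>\theta_1,$$ then $$\big|\{u>\theta_2\}\cap B_R\big|\ \ge\ \overline{c}\,R^n .$$
   Context: $B_R$ is the ball of radius $R$ centered at the origin in $\mathbb{R}^n$, $|E|$ denotes the Lebesgue measure of $E$, and $\mathscr{C}\Omega=\mathbb{R}^n\setminus\Omega$. For $\Omega\subseteq\mathbb{R}^n$ and measurable $u:\mathbb{R}^n\to[-1,1]$ define $$\mathcal{K}(u;\Omega):=\frac12\int_\Omega\int_\Omega\frac{|u(x)-u(y)|^2}{|x-y|^{n+2s}}\,dx\,dy+\int_\Omega\int_{\mathscr{C}\Omega}\frac{|u(x)-u(y)|^2}{|x-y|^{n+2s}}\,dx\,dy,$$ $$\mathcal{E}(u;\Omega):=\mathcal{K}(u;\Omega)+\int_\Omega W(u(x))\,dx .$$ A function $u$ is a minimizer of $\mathcal{E}$ in $\Omega$ if $\mathcal{E}(u;\Omega)<\infty$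 and $\mathcal{E}(u;\Omega)\le\mathcal{E}(v;\Omega)$ for every measurable $v:\mathbb{R}^n\to[-1,1]$ which coincides with $u$ in $\mathscr{C}\Omega$. The value $u(0)$ is that of the representative of $u$ which is continuous in $B_R$. *)

(* Defs.v *)
From HB Require Import structures.
From mathcomp Require Import all_boot all_order all_algebra.
From mathcomp Require Import all_classical all_reals all_analysis.

Set Implicit Arguments.
Unset Strict Implicit.
Unset Printing Implicit Defensive.
Import Order.TTheory GRing.Theory Num.Theory.
Import numFieldNormedType.Exports.

Local Open Scope classical_set_scope.
Local Open Scope ring_scope.

Section lebesgue.
Context {R : realType} {n : nat}.
Implicit Types (A : set 'rV[R]_n) (o : option ('rV[R]_n * 'rV[R]_n)).

(* [None] stands for the empty box: when n = 0 no pair of corners denotes the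
   empty set, and without it the empty set would have infinite outer measure. *)
Definition box o : set 'rV[R]_n :=
  if o is Some (a, b) then [set x | forall i, a 0 i < x 0 i <= b 0 i] else set0.

Definition box_volume o : \bar R :=
  (if o is Some (a, b) then \prod_(i < n) Num.max 0 (b 0 i - a 0 i) else 0)%:E.

Definition box_cover A : set (nat -> option ('rV[R]_n * 'rV[R]_n)) :=
  [set c | A `<=` \bigcup_k box (c k)].

Definition lebesgue_outer A : \bar R :=
  ereal_inf [set (\sum_(k <oo) box_volume (c k))%E | c in box_cover A].

Local Open Scope ereal_scope.

Lemma box_volume_ge0 o : 0 <= box_volume o.
Proof.
rewrite lee_fin; case: o => [[a b]|//].
by apply: prodr_ge0 => i _; rewrite le_max lexx.
Qed.

Lemma lebesgue_outer_ge0 A : 0 <= lebesgue_outer A.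
Proof.
apply: le_ereal_inf_tmp => _ [c _ <-].
by apply: nneseries_ge0 => k _ _; exact: box_volume_ge0.
Qed.

Lemma lebesgue_outer0 : lebesgue_outer set0 = 0.
Proof.
apply/eqP; rewrite eq_le lebesgue_outer_ge0 andbT.
apply: ereal_inf_lbound; exists (fun=> None); first exact: sub0set.
by rewrite eseries0.
Qed.

Lemma le_lebesgue_outer : {homo lebesgue_outer : A B / A `<=` B >-> A <= B}.
Proof.
move=> A B AB; apply/ereal_inf_le_tmp => x [c Bc <-].
by exists c => //; exact: subset_trans AB Bc.
Qed.

Lemma lebesgue_outer_sigma_subadditive : sigma_subadditive lebesgue_outer.
Proof.
move=> A; have [[i ioo]|] := pselect (exists i, lebesgue_outer (A i) = +oo).
  rewrite (eseries_pinfty _ _ ioo) ?leey// => k _.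
  by rewrite -ltNye (lt_le_trans _ (lebesgue_outer_ge0 _)).
rewrite -forallNE => Aoo.
suff add2e (e : {posnum R}) : lebesgue_outer (\bigcup_k A k) <=
    \sum_(i <oo) lebesgue_outer (A i) + e%:num%:E.
  by apply/lee_addgt0Pr => _/posnumP[].
rewrite (le_trans _ (epsilon_trick _ _ _))//; last first.
  by move=> k; exact: lebesgue_outer_ge0.
pose P k c := box_cover (A k) c /\ \sum_(j <oo) box_volume (c j) <=
  lebesgue_outer (A k) + (e%:num / (2 ^ k.+1)%:R)%:E.
have [G PG] : {G & forall k, P k (G k)}.
  apply: (@choice _ _ P) => k; rewrite /P.
  have Afin : lebesgue_outer (A k) \is a fin_num.
    by rewrite ge0_fin_numE ?lebesgue_outer_ge0// ltey; exact/eqP/Aoo.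
  have ek : (0 < e%:num / (2 ^ k.+1)%:R)%R by [].
  have [_ [c Ac <-] cA] := lb_ereal_inf_adherent ek Afin.
  by exists c; split => //; exact/ltW.
pose vG := box_volume \o uncurry G.
have vG_ge0 x : 0 <= vG x by exact: box_volume_ge0.
apply: (@le_trans _ _ (\esum_(i in setT) vG i)).
  apply: ereal_inf_lbound => /=.
  have /card_esym/ppcard_eqP[f] := card_nat2.
  exists (uncurry G \o f).
    move=> t [i _] /(PG i).1 [j _ Gt]; exists (f^-1%FUN (i, j)) => //=.
    by rewrite invK ?inE.
  rewrite -(esum_pred_image vG _ xpredT) ?[fun=> _]set_true//.
  by rewrite image_eq.
rewrite (_ : esum _ _ = \sum_(i <oo) \sum_(j <oo) box_volume (G i j)).
  apply: lee_nneseries => [k _ _|k _].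
    by apply: nneseries_ge0 => j _ _; exact: box_volume_ge0.
  exact: (PG k).2.
rewrite nneseries_esumT; last first.
  by move=> k; apply: nneseries_ge0 => j _ _; exact: box_volume_ge0.
rewrite (eq_esum (b := fun i => \esum_(j in setT) vG (i, j))); last first.
  by move=> i _; rewrite nneseries_esumT// => j; exact: box_volume_ge0.
rewrite esum_esum//; congr esum; first by rewrite predeqE => -[i j].
by apply/funext => -[i j].
Qed.

HB.instance Definition _ := isOuterMeasure.Build R 'rV[R]_n lebesgue_outer
  lebesgue_outer0 lebesgue_outer_ge0 le_lebesgue_outer
  lebesgue_outer_sigma_subadditive.

End lebesgue.
Arguments lebesgue_outer R n : clear implicits.

(* R^n with the sigma-algebra of Lebesgue measurable sets *)
Notation euclidean R n := (caratheodory_type (lebesgue_outer R n)).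

Definition lebesgue (R : realType) (n : nat) : set (euclidean R n) -> \bar R :=
  lebesgue_outer R n.
HB.instance Definition _ (R : realType) (n : nat) :=
  isMeasure.Build _ (euclidean R n) R (@lebesgue R n)
    (@caratheodory_measure0 _ _ (lebesgue_outer R n))
    (@caratheodory_measure_ge0 _ _ (lebesgue_outer R n))
    (@caratheodory_measure_sigma_additive _ _ (lebesgue_outer R n)).
Arguments lebesgue R n : clear implicits.

(* The library's norm on row vectors is the sup norm. *)
Definition enorm {R : realType} {n : nat} (x : 'rV[R]_n) : R :=
  Num.sqrt (\sum_(i < n) x 0 i ^+ 2).

Definition eball (R : realType) (n : nat) (r : R) : set 'rV[R]_n :=
  [set x | enorm x < r].
Arguments eball R n r : clear implicits.

Section energy.
Context {R : realType} {n : nat}.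
Variables (s : R) (W : R -> R).
Implicit Types (u v : 'rV[R]_n -> R) (A B Omega : set 'rV[R]_n).

(* On the diagonal x = y the integrand is 0 / 0 = 0; when n > 0 the diagonal is
   a null set of R^n x R^n. *)
Definition interaction u A B : \bar R :=
  (\int[lebesgue R n]_(x in A) \int[lebesgue R n]_(y in B)
    (`|u x - u y| ^+ 2 / enorm (x - y) `^ (n%:R + 2 * s))%:E)%E.

Definition kinetic u Omega : \bar R :=
  ((2^-1)%:E * interaction u Omega Omega + interaction u Omega (~` Omega))%E.

Definition energy u Omega : \bar R :=
  (kinetic u Omega + \int[lebesgue R n]_(x in Omega) (W (u x))%:E)%E.

Definition admissible u : Prop :=
  measurable_fun [set: euclidean R n] u /\ forall x, -1 <= u x <= 1.

Definition minimizer u Omega : Prop :=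
  [/\ admissible u, (energy u Omega < +oo)%E &
    forall v, admissible v -> (forall x, (~` Omega) x -> v x = u x) ->
      (energy u Omega <= energy v Omega)%E].

End energy.

(* The difference quotient is taken within A, so that the derivative is
   one-sided at the endpoints when A is a closed interval. *)
Definition has_derivative_on {R : realType} (A : set R) (f f' : R -> R) :=
  forall x, A x -> (f y - f x) / (y - x) @[y --> within A x^'] --> f' x.

Definition C2_on {R : realType} (A : set R) (f f' f'' : R -> R) :=
  [/\ has_derivative_on A f f', has_derivative_on A f' f'' &
      {within A, continuous f''}].

(* Main.v *)
(* Only the fact that R^n is an Ahlfors regular metric measure space of dimension
   q = n matters.  Since 2 s < 1, integrating min(1, |x - y| / e) against the
   kernel |x - y|^(-q-2s) gives a quantity of order e^(-2s); hence the barrier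
   psi(x) = min(2, M (rho - |x|)^(-2s)), extended by 2 outside the ball of radius
   rho, satisfies int (psi(y) - psi(x))^+ |x - y|^(-q-2s) dy <= (C / M) psi(x)
   where psi < 2.  Comparing the energy of u with that of min(u, psi - 1) and
   using that W grows at least quadratically near -1, one bounds the kinetic
   energy of the excess g = max(0, u + 1 - psi), together with the measure of the
   part of {g > del} where u is at most a threshold th, by a multiple of the
   integral of psi over {u > th}.  An isoperimetric inequality for the kernel
   turns this into a relation between the measures of the superlevel sets of g.
   A De Giorgi iteration over the levels of g shows that {u > th} has measure
   bounded below in a fixed ball as soon as u > th1 on a set of positive measure
   near the center.  Summing the relation over unit steps of rho, where the
   sum of psi is of order rho^(1-2s), gives for V(rho) = |{u > th} in B_rho| the
   inequality rho^(2s) min(V(rho), V(rho)^(1-2s/q)) <= C V(4 rho), whose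
   iteration yields V(rho) >= b rho^q.  Comparison with the barrier also bounds
   the measure of {th < u <= th2} in B_rho by C rho^(q-2s), so that th2 may
   replace th. *)
From HB Require Import structures.
Require Import Defs.
From mathcomp Require Import all_boot all_order all_algebra.
From mathcomp Require Import all_classical all_reals all_analysis.
From mathcomp Require Import measurable_realfun ring lra.
Import Order.TTheory GRing.Theory Num.Theory.
Import numFieldNormedType.Exports.
Local Open Scope classical_set_scope.
Local Open Scope ring_scope.


(** * Lebesgue measure of boxes and balls *)

(** One cancellation fixes the constants. Lowering [u] to [psi - 1] where the excess [g] is positive
    costs at most [2 * tau * g * psi] in kinetic energy. As long as [u <= th], the potential
    decreases by at least [lam * (2 * psi * g + g ^+ 2)], because [1 + (psi - 1) = psi]. Taking
    [M = C / lam] makes [tau = lam], so the linear terms cancel and [lam * g ^+ 2] survives. Where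
    [u > th] the potential may increase, but by at most [W (psi - 1) <= L * psi], since
    [W (-1) = 0]. The error is thus an integral of [psi], not merely a measure, and this smallness
    of [psi] away from the boundary produces the factor [rho ^ (2s)] after summation over radii. The
    final constant does not see the two thresholds: when the radius is multiplied by 4, either the
    density [b] is already attained or the ratio [V(rho) / rho^q] grows by a fixed factor [k > 1].
    The initial mass, which depends on the first threshold, only affects the number of scales
    needed; the second enters through the minimum of [W] between [th] and [th2], which only affects
    how large the radius must be. *)

Section euclidean_measure.
Context {R : realType} {n : nat}.
Local Notation T := (euclidean R n).
Local Notation mu := (lebesgue R n).
Implicit Types (x y z : 'rV[R]_n) (r c : R).

(** Only the [i]-th factor changes. The truncation [Num.max 0] keeps the identity valid when [c]
    lies outside the side, where one of the two pieces degenerates. *)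
Lemma box_volume_halfspace (a b : 'rV[R]_n) (i : 'I_n) c :
  let bl := \row_j (if j == i then Num.min (b 0 i) c else b 0 j) in
  let ar := \row_j (if j == i then Num.max (a 0 i) c else a 0 j) in
  (box_volume (Some (a, bl)) + box_volume (Some (ar, b)) =
   box_volume (Some (a, b)))%E.
Proof.
move=> bl ar; rewrite /box_volume -EFinD; congr (_%:E).
rewrite (bigD1 i) //= [in X in _ + X](bigD1 i) //= [in RHS](bigD1 i) //= !mxE eqxx.
rewrite (eq_bigr (fun j => Num.max 0 (b 0 j - a 0 j))); last first.
  by move=> j ji; rewrite !mxE (negbTE ji).
rewrite [X in _ * _ + _ * X](eq_bigr (fun j => Num.max 0 (b 0 j - a 0 j))); last first.
  by move=> j ji; rewrite !mxE (negbTE ji).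
rewrite -mulrDl; congr (_ * _).
by rewrite /Num.max /Num.min; do !case: ifPn; rewrite -?leNgt; lra.
Qed.

(** Carathéodory's criterion: cutting every box of a cover of [X] along the hyperplane yields covers
    of both parts of [X] with the same total volume. *)
Lemma halfspace_measurable (i : 'I_n) c : measurable ([set x : T | x 0 i <= c]).
Proof.
apply: (@le_caratheodory_measurable _ _ (lebesgue_outer R n)) => X.
apply/le_ereal_inf_tmp => _ [C XC <-].
pose lft (o : option ('rV[R]_n * 'rV[R]_n)) :
    option ('rV[R]_n * 'rV[R]_n) := if o is Some (a, b) then
  Some (a, \row_j (if j == i then Num.min (b 0 i) c else b 0 j)) else None.
pose rgt (o : option ('rV[R]_n * 'rV[R]_n)) :
    option ('rV[R]_n * 'rV[R]_n) := if o is Some (a, b) then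
  Some (\row_j (if j == i then Num.max (a 0 i) c else a 0 j), b) else None.
have volE o : box_volume o = (box_volume (lft o) + box_volume (rgt o))%E.
  case: o => [[a b]|] /=; last by rewrite adde0.
  by rewrite -(box_volume_halfspace a b i c).
under eq_eseriesr do rewrite volE.
rewrite nneseriesD; try by move=> *; exact: box_volume_ge0.
apply: leeD; apply: ereal_inf_lbound.
- exists (lft \o C) => // x [Xx /= xc].
  have [k _ Ck] := XC _ Xx; exists k => //=; move: Ck.
  case: (C k) => [[a b]|//] /= H j; rewrite !mxE.
  case: eqP => [->|_]; last exact: H.
  by have /andP[-> /= bx] := H i; rewrite le_min bx.
- exists (rgt \o C) => // x [Xx /= /negP]; rewrite -ltNge => xc.
  have [k _ Ck] := XC _ Xx; exists k => //=; move: Ck.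
  case: (C k) => [[a b]|//] /= H j; rewrite !mxE.
  case: eqP => [->|_]; last exact: H.
  by have /andP[ax ->] := H i; rewrite gt_max ax xc.
Qed.

Lemma measurable_coord (i : 'I_n) : measurable_fun [set: T] (fun x : T => x 0 i).
Proof.
apply: (measurability _ (RGenOInfty.measurableE R)) => //.
move=> /= _ [_ [c ->] <-]; rewrite setTI.
rewrite (_ : _ @^-1` _ = ~` [set x : T | x 0 i <= c]).
  exact: measurableC (halfspace_measurable i c).
apply/seteqP; split => x /=; rewrite in_itv/= andbT => h.
  by apply/negP; rewrite -ltNge.
by rewrite ltNge; apply/negP.
Qed.

Lemma measurable_box o : measurable (box o : set T).
Proof.
case: o => [[a b]|]; last exact: measurable0.
rewrite [X in measurable X](_ : _ = \big[setI/setT]_(i < n)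
   ((fun x : T => x 0 i) @^-1` `]a 0 i, b 0 i]%classic)).
  apply: bigsetI_measurable => i _; rewrite -[X in measurable X]setTI.
  exact: measurable_coord.
apply/seteqP; split => x /=.
  by move=> H; elim/big_ind : _ => [//|A B ? ?|i _]; [split|rewrite /= in_itv; exact: H].
rewrite -bigcap_seq /= => H i.
by have := H i (mem_index_enum i); rewrite /= in_itv.
Qed.

Lemma lebesgue_box_le o : (mu (box o) <= box_volume o)%E.
Proof.
apply: ereal_inf_lbound => /=; exists (fun k => if k == 0%N then o else None).
  by move=> x ox; exists 0%N.
rewrite (nneseries_split _ 1) => [|k _]; last exact: box_volume_ge0.
rewrite big_nat1/= eseries0 ?adde0// => i i1 _ /=.
by rewrite gtn_eqF.
Qed.

End euclidean_measure.

(** * The measure of a box is its volume *)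

Lemma lebesgue_measure_ocitv {R : realType} (a b : R) :
  lebesgue_measure `]a, b]%classic = (Num.max 0 (b - a))%:E.
Proof.
rewrite lebesgue_measure_itv /= lte_fin; case: ltP => ab.
  by rewrite -EFinB max_r// subr_ge0 ltW.
by rewrite max_l// subr_le0.
Qed.

(* Countable subadditivity of the volume, by integrating the covering
   inequality between indicator functions one coordinate at a time. *)
Lemma box_volume_cover_le {R : realType} m (a b : nat -> R)
    (p q : nat -> nat -> R) (t : R) (c : nat -> \bar R) :
  0 <= t -> (forall k, (0 <= c k)%E) ->
  (forall x : nat -> R, (forall i, (i < m)%N -> a i < x i <= b i) ->
    (t%:E <= \sum_(k <oo) c k *
        (\prod_(i < m) \1_(`]p k i, q k i]%classic) (x i))%:E)%E) ->
  (t%:E * (\prod_(i < m) Num.max 0 (b i - a i))%:E <=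
   \sum_(k <oo) c k * (\prod_(i < m) Num.max 0 (q k i - p k i))%:E)%E.
Proof.
elim: m t c => [|m IH] t c t0 c0 cover.
  have H i : (i < 0)%N -> a i < (0 : R) <= b i by rewrite ltn0.
  have := cover (fun=> 0) H.
  by rewrite big_ord0 mule1; under eq_eseriesr do rewrite big_ord0;
     under [in X in _ -> (_ <= X)%E]eq_eseriesr do rewrite big_ord0.
pose l (u v : R) := Num.max 0 (v - u).
have l0 u v : 0 <= l u v by rewrite /l le_max lexx.
(* Integrating out the last coordinate multiplies [t] and each [c k] by the length of a last side.
   The induction therefore needs arbitrary weights [t] and [c]. *)
rewrite big_ord_recr /= mulrC EFinM muleA -EFinM.
have -> : (\sum_(k <oo) c k * (\prod_(i < m.+1) Num.max 0 (q k i - p k i))%:E =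
  \sum_(k <oo) (c k * (l (p k m) (q k m))%:E) *
     (\prod_(i < m) Num.max 0 (q k i - p k i))%:E)%E.
  by apply: eq_eseriesr => k _; rewrite big_ord_recr /= mulrC EFinM muleA.
apply: IH => [|k|x xab]; first by rewrite mulr_ge0 ?l0.
  by apply: mule_ge0; rewrite ?lee_fin.
pose e k := \prod_(i < m) \1_(`]p k i, q k i]%classic) (x i) : R.
have e0 k : 0 <= e k by apply: prodr_ge0 => i _; rewrite indicE.
pose F k (y : R) : \bar R := (c k * (e k)%:E * (\1_(`]p k m, q k m]%classic) y)%:E)%E.
have F0 k y : (0 <= F k y)%E by rewrite /F !mule_ge0// lee_fin// indicE.
have mF k : measurable_fun setT (F k).
  apply: measurable_funeM; apply: measurableT_comp => //.
have := @integral_cst _ _ _ (@lebesgue_measure R) `]a m, b m]%classic (measurable_itv _) t%:E.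
move=> /= intt.
rewrite EFinM -lebesgue_measure_ocitv -intt.
apply: (@le_trans _ _ (\int[lebesgue_measure]_(y in `]a m, b m]) \sum_(k <oo) F k y)%E).
  apply: ge0_le_integral => //.
  - by apply: ge0_emeasurable_sum => // k _; apply: measurable_funTS; exact: mF.
  - move=> y /=; rewrite in_itv /= => yab.
    have := cover (fun i => if i == m then y else x i).
    move/(_ _)/le_trans; apply.
      move=> i; rewrite ltnS leq_eqVlt; case: eqP => [->//|_ /= im].
      exact: xab.
    apply: lee_nneseries => [k _ _|k _].
      by rewrite mule_ge0// lee_fin prodr_ge0// => i _; rewrite indicE.
    rewrite big_ord_recr /= eqxx /F EFinM muleA /e.
    under eq_bigr => i _ do rewrite (ltn_eqF (ltn_ord i)).
    exact: lexx.
apply: (@le_trans _ _ (\int[lebesgue_measure]_y \sum_(k <oo) F k y)%E).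
  apply: ge0_subset_integral => //.
  - by apply: ge0_emeasurable_sum => // k _; exact: mF.
  - by move=> y ?; apply: nneseries_ge0 => k ? ?; exact: F0.
rewrite integral_nneseries//.
apply: lee_nneseries => [k _ _|k _]; first by apply: integral_ge0.
have ce0 : (0 <= c k * (e k)%:E)%E by rewrite mule_ge0// lee_fin.
have mI : measurable_fun setT (fun y : R => (\1_(`]p k m, q k m]%classic) y)%:E : \bar R).
  exact: measurableT_comp.
rewrite /F ge0_integralZl//.
rewrite integral_indic// setIT [X in (_ * X)%E]lebesgue_measure_ocitv.
by rewrite -!muleA [X in (_ * X)%E]muleC.
Qed.

Section euclidean_box.
Context {R : realType} {n : nat}.
Local Notation mu := (lebesgue R n).

Lemma lebesgue_box (a b : 'rV[R]_n) : mu (box (Some (a, b))) = box_volume (Some (a, b)).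
Proof.
apply/eqP; rewrite eq_le lebesgue_box_le /=.
apply/le_ereal_inf_tmp => _ [C abC <-].
(* Row vectors become sequences, extended by 0 beyond [n], to fit the induction on the dimension.
   The weight [c k] is 0 exactly for the empty box [None]. *)
pose nc (v : 'rV[R]_n) (i : nat) : R := oapp (fun j => v 0 j) 0 (insub i).
have ncE v (i : 'I_n) : nc v i = v 0 i by rewrite /nc valK.
pose p k := if C k is Some (u, _) then nc u else fun=> 0.
pose q k := if C k is Some (_, v) then nc v else fun=> 0.
pose c k : \bar R := if C k is Some _ then 1%E else 0%E.
have := @box_volume_cover_le R n (nc a) (nc b) p q 1 c ler01.
rewrite mul1e.
have -> : (\prod_(i < n) Num.max 0 (nc b i - nc a i))%:E = box_volume (Some (a, b)).
  by rewrite /=; congr (_%:E); apply: eq_bigr => i _; rewrite !ncE.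
have -> : (\sum_(k <oo) c k * (\prod_(i < n) Num.max 0 (q k i - p k i))%:E =
           \sum_(k <oo) box_volume (C k))%E.
  apply: eq_eseriesr => k _; rewrite /c /p /q; case: (C k) => [[u v]|] /=.
    by rewrite mul1e; congr (_%:E); apply: eq_bigr => i _; rewrite !ncE.
  by rewrite mul0e.
apply=> [k|x xab]; first by rewrite /c; case: (C k).
have [|k _ Ck] := abC (\row_i x i).
  by move=> i; rewrite mxE; have := xab i (ltn_ord i); rewrite !ncE.
have F0 j : (0 <= c j *
    (\prod_(i < n) \1_(`]p j i, q j i]%classic) (x i))%:E)%E.
  rewrite mule_ge0//; first by rewrite /c; case: (C j).
  by rewrite lee_fin prodr_ge0// => i _; rewrite indicE.
(* The term of the box containing the point already equals 1. *)
apply: (@le_trans _ _ (\sum_(0 <= j < k.+1) c j *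
    (\prod_(i < n) \1_(`]p j i, q j i]%classic) (x i))%:E)%E); last first.
  exact: nneseries_lim_ge.
rewrite big_nat_recr//= -[leLHS]add0e leeD//; first exact: sume_ge0.
rewrite /c /p /q; case: (C k) Ck => [[u v]|//] /= Ck.
rewrite mul1e lee_fin big1// => i _; rewrite indicE mem_set// /= in_itv /= !ncE.
by have := Ck i; rewrite mxE.
Qed.

End euclidean_box.

(** * The Euclidean norm, cubes and balls *)

Section enorm_theory.
Context {R : realType} {n : nat}.
Implicit Types (x y z : 'rV[R]_n) (r : R).

Lemma enorm_ge0 x : 0 <= enorm x. Proof. exact: sqrtr_ge0. Qed.

Lemma enorm_sqr x : enorm x ^+ 2 = \sum_(i < n) x 0 i ^+ 2.
Proof. by rewrite sqr_sqrtr// sumr_ge0// => i _; rewrite sqr_ge0. Qed.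

Lemma enormN x : enorm (- x) = enorm x.
Proof. by congr Num.sqrt; apply: eq_bigr => i _; rewrite mxE sqrrN. Qed.

Lemma enormC x y : enorm (x - y) = enorm (y - x).
Proof. by rewrite -enormN opprB. Qed.

Lemma enorm0 : enorm (0 : 'rV[R]_n) = 0.
Proof.
by rewrite /enorm big1 ?sqrtr0// => i _; rewrite mxE expr0n.
Qed.

Lemma coord_le_enorm x i : `|x 0 i| <= enorm x.
Proof.
rewrite -sqrtr_sqr ler_sqrt; last by apply: sumr_ge0 => j _; rewrite sqr_ge0.
by rewrite (bigD1 i)//= lerDl sumr_ge0// => j _; rewrite sqr_ge0.
Qed.

Lemma enorm_eq0 x : enorm x = 0 -> x = 0.
Proof.
move=> x0; apply/rowP => i; rewrite mxE; apply/eqP.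
by rewrite -normr_le0 -x0 coord_le_enorm.
Qed.

Lemma enorm_le_coord x r : (0 < n)%N -> 0 <= r -> (forall i, `|x 0 i| <= r) ->
  enorm x <= n%:R * r.
Proof.
move=> n0 r0 xr; rewrite -(@ler_pXn2r _ 2)// ?nnegrE ?enorm_ge0 ?mulr_ge0//.
rewrite enorm_sqr; apply: (@le_trans _ _ (\sum_(i < n) r ^+ 2)).
  by apply: ler_sum => i _; rewrite -(real_normK (num_real _)) lerXn2r// nnegrE.
rewrite sumr_const card_ord -[leLHS]mulr_natl exprMn ler_wpM2r ?sqr_ge0//.
by rewrite -natrX ler_nat -{1}(expn1 n) leq_pexp2l.
Qed.

(** Cauchy-Schwarz, by expanding the nonnegative sum of the squares of [|y| x_i - |x| y_i]. *)
Lemma enorm_dot x y : \sum_(i < n) x 0 i * y 0 i <= enorm x * enorm y.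
Proof.
have [x0|x0] := eqVneq (enorm x) 0.
  rewrite x0 mul0r big1// => i _; rewrite (enorm_eq0 _ x0) mxE mul0r//.
have [y0|y0] := eqVneq (enorm y) 0.
  rewrite y0 mulr0 big1// => i _; rewrite (enorm_eq0 _ y0) mxE mulr0//.
have xp : 0 < enorm x by rewrite lt_neqAle eq_sym x0 enorm_ge0.
have yp : 0 < enorm y by rewrite lt_neqAle eq_sym y0 enorm_ge0.
set p := enorm x; set q := enorm y.
have : 0 <= \sum_(i < n) (q * x 0 i - p * y 0 i) ^+ 2.
  by apply: sumr_ge0 => i _; rewrite sqr_ge0.
have -> : \sum_(i < n) (q * x 0 i - p * y 0 i) ^+ 2 =
    q ^+ 2 * \sum_(i < n) x 0 i ^+ 2 - 2 * p * q * (\sum_(i < n) x 0 i * y 0 i) +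
    p ^+ 2 * \sum_(i < n) y 0 i ^+ 2.
  rewrite !mulr_sumr -sumrB -big_split /=.
  by apply: eq_bigr => i _; ring.
rewrite -!enorm_sqr -/p -/q => H.
have pq0 : 0 < p * q by rewrite mulr_gt0.
rewrite -(ler_pM2l pq0); nra.
Qed.

Lemma enormD x y : enorm (x + y) <= enorm x + enorm y.
Proof.
rewrite -(@ler_pXn2r _ 2)// ?nnegrE ?addr_ge0 ?enorm_ge0//.
have -> : enorm (x + y) ^+ 2 =
    enorm x ^+ 2 + 2 * (\sum_(i < n) x 0 i * y 0 i) + enorm y ^+ 2.
  rewrite !enorm_sqr mulr_sumr -!big_split /=.
  by apply: eq_bigr => i _; rewrite mxE; ring.
have := enorm_dot x y; nra.
Qed.

Definition cube x r : set 'rV[R]_n :=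
  box (Some (x - const_mx r, x + const_mx r)).

Lemma lebesgue_cube x r : 0 <= r -> lebesgue R n (cube x r) = ((2 * r) ^+ n)%:E.
Proof.
move=> r0; rewrite lebesgue_box /=; congr (_%:E).
rewrite (eq_bigr (fun=> 2 * r)) ?prodr_const ?card_ord// => i _.
by rewrite !mxE max_r; lra.
Qed.

Lemma measurable_cube x r : measurable (cube x r : set (euclidean R n)).
Proof. exact: measurable_box. Qed.

Lemma ball_sub_cube x r : [set y | enorm (x - y) < r] `<=` cube x r.
Proof.
move=> y /= xyr i; rewrite !mxE.
have := le_lt_trans (coord_le_enorm (x - y) i) xyr.
by rewrite !mxE ltr_norml => /andP[? ?]; apply/andP; split; lra.
Qed.

Lemma cube_enorm x r y : (0 < n)%N -> 0 <= r -> cube x r y ->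
  enorm (x - y) <= n%:R * r.
Proof.
move=> n0 r0 xy; apply: enorm_le_coord => // i.
have := xy i; rewrite !mxE => /andP[? ?].
by rewrite ler_norml; apply/andP; split; lra.
Qed.

End enorm_theory.

Lemma sigma_finite_lebesgue (R : realType) n : sigma_finite [set: euclidean R n] (lebesgue R n).
Proof.
exists (fun k => cube (0 : 'rV[R]_n) k%:R).
  apply/seteqP; split => x // _.
  exists (Num.truncn (enorm x)).+1 => //; apply: ball_sub_cube => /=.
  by rewrite sub0r enormN truncnS_gt.
move=> k; split; first exact: measurable_cube.
by have := @lebesgue_cube R n 0 _ (ler0n R k) => /= ->; rewrite ltry.
Qed.

HB.instance Definition _ (R : realType) n :=
  @Measure_isSigmaFinite.Build _ (euclidean R n) R (lebesgue R n) (sigma_finite_lebesgue R n).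

Section enorm_measurable.
Context {R : realType} {n : nat}.
Local Notation T := (euclidean R n).
Local Notation mu := (lebesgue R n).
Implicit Types (r : R).

Lemma measurable_enorm_fun d (U : measurableType d) (f : U -> 'rV[R]_n) :
  (forall i, measurable_fun setT (fun z => f z 0 i)) ->
  measurable_fun setT (fun z => enorm (f z)).
Proof.
move=> mf; apply: measurableT_comp.
  by apply: continuous_measurable_fun; exact: sqrt_continuous.
by apply: measurable_sum => i; apply: measurable_funX.
Qed.

Lemma measurable_enormB (x : T) : measurable_fun setT (fun y : T => enorm (x - y)).
Proof.
apply: measurable_enorm_fun => i.
have -> : (fun y : T => (x - y) 0 i) = ((fun=> x 0 i) \- (fun y : T => y 0 i)).
  by apply/funext => y; rewrite !mxE.
by apply: measurable_funB; [exact: measurable_cst|exact: measurable_coord].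
Qed.

Lemma measurable_enormB2 : measurable_fun setT (fun z : T * T => enorm (z.1 - z.2)).
Proof.
apply: measurable_enorm_fun => i.
have -> : (fun z : T * T => (z.1 - z.2) 0 i) =
    ((fun y : T => y 0 i) \o fst) \- ((fun y : T => y 0 i) \o snd).
  by apply/funext => z; rewrite /= !mxE.
apply: measurable_funB.
  exact: (measurableT_comp (measurable_coord i) measurable_fst).
exact: (measurableT_comp (measurable_coord i) measurable_snd).
Qed.

Lemma measurable_enorm_ball (x : T) r : measurable ([set y : T | enorm (x - y) < r]).
Proof.
rewrite [X in measurable X](_ : _ = (fun y : T => enorm (x - y)) @^-1` `]-oo, r[%classic).
  by rewrite -[X in measurable X]setTI; exact: measurable_enormB.
by apply/seteqP; split => y /=; rewrite in_itv.
Qed.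

Lemma lebesgue_ball_le (x : T) r : 0 <= r ->
  (mu [set y : T | (enorm (x - y) < r)%R] <= ((2 * r) ^+ n)%:E)%E.
Proof.
move=> r0; rewrite -(lebesgue_cube x _ r0); apply: le_measure; rewrite ?inE.
- exact: measurable_enorm_ball.
- exact: measurable_cube.
- exact: ball_sub_cube.
Qed.

End enorm_measurable.

Set Implicit Arguments.
Unset Strict Implicit.
Unset Printing Implicit Defensive.

(** * Kernels on Ahlfors regular spaces *)

Lemma nneseries_le_bound {R : realType} (f : nat -> \bar R) (b : \bar R) :
  (forall k, (0 <= f k)%E) -> (forall K, (\sum_(0 <= k < K) f k <= b)%E) ->
  (\sum_(k <oo) f k <= b)%E.
Proof.
move=> f0 fb; apply: lime_le; first by apply: is_cvg_nneseries => k _ _.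
by near=> K; exact: fb.
Unshelve. all: by end_near. Qed.

Lemma geometric_sum_le {R : realType} (a : R) K : 0 <= a < 1 ->
  \sum_(0 <= k < K) a ^+ k <= (1 - a)^-1.
Proof.
move=> /andP[a0 a1]; rewrite -[leRHS]mul1r ler_pdivlMr ?subr_gt0//.
suff -> : (\sum_(0 <= k < K) a ^+ k) * (1 - a) = 1 - a ^+ K.
  by rewrite gerBl exprn_ge0.
elim: K => [|K IH]; first by rewrite big_geq// expr0 subrr mul0r.
by rewrite big_nat_recr//= mulrDl IH exprS; ring.
Qed.

Lemma powRN_le {R : realType} (z w p : R) : 0 <= p -> 0 < z -> z <= w ->
  w `^ (- p) <= z `^ (- p).
Proof.
move=> p0 z0 zw; rewrite !powRN lef_pV2 ?posrE ?powR_gt0//; last exact: lt_le_trans zw.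
by apply: ge0_ler_powR; rewrite // nnegrE ltW// (lt_le_trans z0).
Qed.

Lemma powRX {R : realType} (x y : R) j : 0 <= x -> (x ^+ j) `^ y = (x `^ y) ^+ j.
Proof. by move=> x0; rewrite -(powR_mulrn j x0) -(powR_mulrn j (powR_ge0 x y)) powRAC. Qed.

Lemma dyadic_shell {R : realType} (z : R) : 1 <= z -> exists j, 2 ^+ j <= z < 2 ^+ j.+1.
Proof.
move=> z1; have H : exists m, z < 2 ^+ m.
  exists (Num.truncn z).+1; apply: (lt_le_trans (truncnS_gt z)).
  by rewrite -natrX ler_nat ltnW// ltn_expl.
case: (ex_minnP H) => -[|m] zm Hm.
  by move: zm; rewrite expr0 ltNge z1.
exists m; rewrite zm andbT leNgt; apply/negP => /Hm.
by rewrite ltnn.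
Qed.

Lemma integral_scale_indic {R : realType} d (T : measurableType d)
    (mu : {measure set T -> \bar R}) (c : R) (A : set T) :
  0 <= c -> measurable A -> (\int[mu]_y (c * \1_A y)%:E = c%:E * mu A)%E.
Proof.
move=> c0 mA; under eq_integral do rewrite EFinM.
rewrite ge0_integralZl//; last by apply: measurableT_comp => //; exact: measurable_indic.
by rewrite integral_indic// setIT.
Qed.

Definition mball {R : realType} {T : Type} (dist : T -> T -> R) x r : set T :=
  [set y | dist x y < r].

Record ahlfors_regular {R : realType} {d} {T : measurableType d}
    (mu : set T -> \bar R) (dist : T -> T -> R) (q a A : R) : Prop := {
  measurable_dist2 : measurable_fun setT (fun z : T * T => dist z.1 z.2);
  dist_ge0 : forall x y, 0 <= dist x y;
  dist_sym : forall x y, dist x y = dist y x;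
  dist_triangle : forall x y z, dist x z <= dist x y + dist y z;
  ahlfors_gt0 : [/\ 0 < q, 0 < a & 0 < A];
  ahlfors_le : forall x r, 0 < r -> (mu (mball dist x r) <= (A * r `^ q)%:E)%E;
  ahlfors_ge : forall x r, 0 < r -> ((a * r `^ q)%:E <= mu (mball dist x r))%E }.

Section fkernel.
Context {R : realType} {d : measure_display} {T : measurableType d}.
Variables (mu : {sigma_finite_measure set T -> \bar R}) (dist : T -> T -> R).
Variables (q a A s : R).
Hypothesis H : ahlfors_regular mu dist q a A.
Hypothesis s01 : 0 < s < 2^-1.

(** At distance 0 and positive exponent the value is 0, the inverse of 0, and not infinity. Lower
    bounds on integrals of the kernel have to avoid such points. *)
Definition fkernel (x y : T) : R := (dist x y `^ (q + 2 * s))^-1.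

Lemma fkernel_ge0 x y : 0 <= fkernel x y.
Proof. by rewrite invr_ge0 powR_ge0. Qed.

Lemma fkernelC x y : fkernel x y = fkernel y x.
Proof. by rewrite /fkernel (dist_sym H). Qed.

Lemma fkernelE x y : fkernel x y = dist x y `^ (- (q + 2 * s)).
Proof. by rewrite powRN. Qed.

Lemma measurable_fkernel2 : measurable_fun setT (fun z : T * T => fkernel z.1 z.2).
Proof.
under eq_fun do rewrite fkernelE.
apply: (measurableT_comp (measurable_powR _)); exact: measurable_dist2 H.
Qed.

Lemma measurable_dist x : measurable_fun setT (fun y => dist x y).
Proof. exact: (measurableT_comp (measurable_dist2 H) (pair1_measurable x)). Qed.

Lemma measurable_fkernel x : measurable_fun setT (fun y => fkernel x y).
Proof.
under eq_fun do rewrite fkernelE.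
apply: (measurableT_comp (measurable_powR _)); exact: measurable_dist.
Qed.

Lemma measurable_mball x r : measurable (mball dist x r).
Proof.
rewrite [X in measurable X](_ : _ = (fun y => dist x y) @^-1` `]-oo, r[%classic).
  by rewrite -[X in measurable X]setTI; exact: measurable_dist.
by apply/seteqP; split => y /=; rewrite in_itv.
Qed.

Lemma integral_ball_kernel_le x E : 0 < E ->
  (\int[mu]_y (E `^ (- (q + 2 * s)) * \1_(mball dist x (4 * E)) y)%:E
   <= (A * 4 `^ q * E `^ (- (2 * s)))%:E)%E.
Proof.
move=> E0; have pE := powR_ge0 E (- (q + 2 * s)).
rewrite integral_scale_indic//; last exact: measurable_mball.
apply: (@le_trans _ _ ((E `^ (- (q + 2 * s)))%:E * (A * (4 * E) `^ q)%:E)%E).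
  by apply: lee_wpmul2l => //; apply: (ahlfors_le H); rewrite mulr_gt0.
rewrite -EFinM lee_fin opprD powRD; last by rewrite (gt_eqF E0) implybT.
rewrite powRM ?(ltW E0)// (powRN E q).
have En : E `^ q != 0 by rewrite gt_eqF// powR_gt0.
by rewrite le_eqVlt; apply/orP; left; apply/eqP; field.
Qed.

(** Decomposition into dyadic shells around [x]. Shells outside the ball of radius [r] form a
    geometric series of ratio [b = 2^(-2s)]. Inside, the truncation contributes an extra [2^(-j)],
    and the ratio becomes [al = 2^(-(1 - 2s))], which is less than 1 because [2 s < 1]. *)
Lemma integral_kernel_truncated : exists2 C, 0 < C &
  forall x r, 0 < r ->
  (\int[mu]_y (Num.min 1 (dist x y / r) * fkernel x y)%:E
    <= (C * r `^ (- (2 * s)))%:E)%E.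
Proof.
have [q0 a0 A0] := ahlfors_gt0 H; have /andP[s0 s1] := s01.
pose p := q + 2 * s.
have p0 : 0 < p by rewrite addr_gt0// mulr_gt0.
pose al := (2^-1 : R) `^ (1 - 2 * s); pose b := (2 : R) `^ (- (2 * s)).
have a01 : 0 <= al < 1.
  rewrite powR_ge0/= /al -[ltRHS](powRr0 2^-1) /powR gt_eqF ?invr_gt0// ltr_expR.
  rewrite mul0r pmulr_rlt0; last lra.
  by rewrite ln_lt0// invr_gt0 invf_lt1 ?ltr0n//= ltr1n.
have b01 : 0 <= b < 1.
  rewrite powR_ge0/= /b -[ltRHS](powRr0 2) /powR gt_eqF// ltr_expR.
  rewrite mul0r nmulr_rlt0; last lra.
  by rewrite ln_gt0// ltr1n.
pose h := (2^-1 : R) `^ (- (2 * s)).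
have h0 : 0 < h by rewrite powR_gt0// invr_gt0.
pose B := A * 4 `^ q.
have B0 : 0 < B by rewrite mulr_gt0// powR_gt0.
pose C := B * h * (1 - al)^-1 + B * (1 - b)^-1.
have C0 : 0 < C.
  move: a01 b01 => /andP[_ a1] /andP[_ b1].
  by rewrite addr_gt0// !mulr_gt0// invr_gt0 subr_gt0.
exists C => // x r r0.
pose t j : R := 2^-1 ^+ j.
have t0 j : 0 < t j by rewrite exprn_gt0// invr_gt0.
(* Inner radii of the shells: [e j] for those inside the ball of radius [r], [f j] for those
   outside. In a shell of inner radius [E] distances are at most [2 * E], so the shell lies in the
   ball of radius [4 * E]. *)
pose e j := t j * (2^-1 * r); pose f j : R := 2 ^+ j * r.
have e0 j : 0 < e j by rewrite !mulr_gt0// invr_gt0.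
have f0 j : 0 < f j by rewrite mulr_gt0// exprn_gt0.
pose G E (y : T) := E `^ (- p) * \1_(mball dist x (4 * E)) y.
have G0 E y : 0 <= G E y by rewrite mulr_ge0 ?powR_ge0// indicE.
have mG E : measurable_fun setT (fun y => (G E y)%:E).
  apply: measurableT_comp => //; apply: measurable_funM => //.
  apply: measurable_indic; exact: measurable_mball.
pose F j (y : T) := ((t j)%:E * (G (e j) y)%:E + (G (f j) y)%:E)%E.
have F0 j y : (0 <= F j y)%E.
  by rewrite adde_ge0 ?mule_ge0 ?lee_fin// ltW.
have mF j : measurable_fun setT (F j).
  by apply: emeasurable_funD => //; apply: measurable_funeM.
have mK : measurable_fun setT (fun y : T =>
    (Num.min 1 (dist x y / r) * fkernel x y)%:E).
  apply: measurableT_comp => //; apply: measurable_funM; last exact: measurable_fkernel.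
  apply: measurable_minr => //; apply: measurable_funM => //.
  exact: measurable_dist.
have K0 y : 0 <= Num.min 1 (dist x y / r) * fkernel x y.
  by rewrite mulr_ge0 ?fkernel_ge0// le_min ler01 divr_ge0 ?(dist_ge0 H) ?ltW.
apply: (@le_trans _ _ (\int[mu]_y \sum_(j <oo) F j y)%E).
  apply: ge0_le_integral => //.
    by move=> y _; rewrite lee_fin; exact: K0.
    by apply: ge0_emeasurable_sum => // k ? ? ?; exact: F0.
  move=> y _.
  (* The term of the shell containing [y] alone dominates the integrand. *)
  suff [j Fj] : exists j, ((Num.min 1 (dist x y / r) * fkernel x y)%:E <= F j y)%E.
    apply: (le_trans Fj); apply: (@le_trans _ _ (\sum_(0 <= k < j.+1) F k y)%E).
      by rewrite big_nat_recr//= leeDr// sume_ge0.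
    exact: nneseries_lim_ge.
  have [z0|z0] := eqVneq (dist x y) 0.
    by exists 0%N; rewrite z0 mul0r min_r// mul0r.
  have {}z0 : 0 < dist x y by rewrite lt_neqAle eq_sym z0 (dist_ge0 H).
  have kE E : E <= dist x y -> dist x y <= 2 * E -> 0 < E -> fkernel x y <= G E y.
    move=> Ez zE E0; rewrite /G indicE mem_set ?mulr1 ?fkernelE.
      by apply: powRN_le => //; exact: ltW.
    by rewrite /mball/=; lra.
  have kp := fkernel_ge0 x y.
  move: (dist x y) z0 kE => z z0 kE.
  have [dz|zd] := leP r z.
    have [|j /andP[jz zj]] := @dyadic_shell _ (z / r); first by rewrite ler_pdivlMr ?mul1r.
    exists j; rewrite /F -[leLHS]add0e leeD ?mule_ge0 ?lee_fin// ?(ltW (t0 j))//.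
    apply: (@le_trans _ _ (1 * fkernel x y)).
      by rewrite ler_wpM2r// ge_min lexx.
    rewrite mul1r kE//; first by rewrite -ler_pdivlMr.
    by rewrite mulrA -exprS -ler_pdivrMr// ltW.
  have [|j /andP[jz zj]] := @dyadic_shell _ (r / z); first by rewrite ler_pdivlMr ?mul1r ?ltW.
  move: jz zj; rewrite ler_pdivlMr// ltr_pdivrMr// => jz zj.
  have P2 : 0 < (2 : R) ^+ j by rewrite exprn_gt0.
  have tE : t j = (2 ^+ j)^-1 by rewrite /t exprVn.
  have zt : z <= t j * r by rewrite tE mulrC ler_pdivlMr// mulrC.
  have tz : t j * r < 2 * z.
    by rewrite tE mulrC ltr_pdivrMr// -mulrA (mulrC z) mulrA -exprS.
  have eE : e j = t j * r / 2 by rewrite /e; ring.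
  exists j; rewrite /F -[leLHS]adde0 leeD ?lee_fin//.
  apply: ler_pM => //; first by rewrite le_min ler01 divr_ge0 ?ltW.
    by rewrite ge_min ler_pdivrMr// zt orbT.
  by apply: kE => //; rewrite eE; lra.
rewrite integral_nneseries//.
have HF j : (\int[mu]_y F j y <=
    ((B * h * al ^+ j + B * b ^+ j) * r `^ (- (2 * s)))%:E)%E.
  have M1 : measurable_fun setT (fun y => (t j)%:E * (G (e j) y)%:E)%E.
    exact: measurable_funeM.
  have P1 y : [set: T] y -> (0 <= (t j)%:E * (G (e j) y)%:E)%E.
    by move=> _; rewrite -EFinM lee_fin mulr_ge0// ltW.
  have P2 E y : [set: T] y -> (0 <= (G E y)%:E)%E by move=> _; rewrite lee_fin.
  rewrite (ge0_integralD mu measurableT P1 M1 (P2 _) (mG _)).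
  rewrite (ge0_integralZl_EFin mu measurableT (P2 _) (mG _)) ?(ltW (t0 j))//.
  have := integral_ball_kernel_le x (e0 j).
  have := integral_ball_kernel_le x (f0 j).
  rewrite -/p -/B => If Ie.
  apply: (le_trans (leeD (lee_wpmul2l _ Ie) If)); first by rewrite lee_fin ltW.
  have tal : t j * t j `^ (- (2 * s)) = al ^+ j.
    rewrite /al -powRX ?invr_ge0// -/(t j) powRD ?powRr1 ?(ltW (t0 j))//.
    by rewrite (gt_eqF (t0 j)) implybT.
  have fE : f j `^ (- (2 * s)) = b ^+ j * r `^ (- (2 * s)).
    by rewrite /f powRM ?exprn_ge0 ?(ltW r0)// powRX.
  have eE : t j * e j `^ (- (2 * s)) = al ^+ j * h * r `^ (- (2 * s)).
    rewrite /e powRM ?(ltW (t0 j)) ?mulr_ge0 ?invr_ge0 ?(ltW r0)//.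
    by rewrite powRM ?invr_ge0 ?(ltW r0)// mulrA tal mulrA.
  rewrite -EFinM -EFinD lee_fin fE mulrCA eE.
  rewrite le_eqVlt; apply/orP; left; apply/eqP; ring.
apply: nneseries_le_bound => [k|K]; first exact: integral_ge0.
apply: (@le_trans _ _ (\sum_(0 <= k < K) ((B * h * al ^+ k + B * b ^+ k) * r `^ (- (2 * s)))%:E)%E).
  by apply: lee_sum.
rewrite sumEFin lee_fin -mulr_suml ler_wpM2r ?powR_ge0// big_split/= -!mulr_sumr /C.
by rewrite lerD// ler_wpM2l ?geometric_sum_le// ltW// mulr_gt0.
Qed.

End fkernel.
Arguments fkernel {R d T}.

(** * The barrier *)

Section barrier.
Context {R : realType} {d : measure_display} {T : measurableType d}.
Variables (mu : {sigma_finite_measure set T -> \bar R}) (dist : T -> T -> R).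
Variables (q a A s : R).
Hypothesis H : ahlfors_regular mu dist q a A.
Hypothesis s01 : 0 < s < 2^-1.
Local Notation fkernel := (fkernel dist q s).

(** A ball of radius [r] with measure at least [2 m] keeps measure at least [m / 2] after removal of
    [E] and of a concentric ball of measure at most [m / 2]. On the rest the kernel is at least
    [r^(-(q + 2s))]. The small ball is removed because the kernel vanishes at distance 0. *)
Lemma integral_kernel_setC_ge : exists2 c, 0 < c &
  forall x (E : set T) m, measurable E -> 0 < m -> (mu E <= m%:E)%E ->
  ((c * m `^ (- (2 * s / q)))%:E <= \int[mu]_(y in ~` E) (fkernel x y)%:E)%E.
Proof.
have [q0 a0 A0] := ahlfors_gt0 H; have /andP[s0 s1] := s01.
(* The value of [r^(-(q + 2s)) * m / 2] for [r^q = 2 m / a], with the power of [m] taken out. *)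
exists (a / 4 * (2 / a) `^ (- (2 * s / q))).
  by rewrite mulr_gt0 ?divr_gt0// powR_gt0// divr_gt0.
move=> x E m mE m0 Em.
have rootK b : 0 < b -> (b `^ q^-1) `^ q = b.
  by move=> b0; rewrite -powRrM mulVf ?gt_eqF// powRr1// ltW.
pose r := (2 * m / a) `^ q^-1; pose r' := (m / (2 * A)) `^ q^-1.
have r0 : 0 < r by rewrite powR_gt0// divr_gt0// mulr_gt0.
have r'0 : 0 < r' by rewrite powR_gt0// divr_gt0// mulr_gt0.
have Br : ((2 * m)%:E <= mu (mball dist x r))%E.
  apply: le_trans (ahlfors_ge H x r0).
  by rewrite lee_fin rootK ?divr_gt0 ?mulr_gt0// (mulrC a) divfK// gt_eqF.
have Br' : (mu (mball dist x r') <= (m / 2)%:E)%E.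
  apply: (le_trans (ahlfors_le H x r'0)).
  rewrite lee_fin rootK ?divr_gt0 ?mulr_gt0//.
  by rewrite le_eqVlt; apply/orP; left; apply/eqP; field; rewrite gt_eqF.
have mB := measurable_mball H x.
pose S := mball dist x r `\` (E `|` mball dist x r').
have mS : measurable S by apply: measurableD => //; exact: measurableU.
have muS : ((m / 2)%:E <= mu S)%E.
  have : ((2 * m)%:E <= mu S + (m%:E + (m / 2)%:E))%E.
    apply: (le_trans Br); apply: (@le_trans _ _ (mu (S `|` (E `|` mball dist x r')))).
      apply: le_measure; rewrite ?inE//; first by apply: measurableU => //; exact: measurableU.
      by move=> y xy; have [h|h] := pselect ((E `|` mball dist x r') y); [right|left].
    apply: (le_trans (measureU2 mu mS (measurableU _ _ mE (mB r')))).
    by rewrite leeD2l//; apply: (le_trans (measureU2 mu mE (mB r'))); exact: leeD.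
  case: (mu S) (measure_ge0 mu S) => [z||]; rewrite ?leey//.
  by move=> _; rewrite -!EFinD !lee_fin; lra.
have SE : S `<=` ~` E by move=> y [_ h] /= Ey; apply: h; left.
have mk D : measurable_fun D (fun y => (fkernel x y)%:E).
  apply: measurable_funTS; apply: measurableT_comp => //. exact: (measurable_fkernel s H x).
apply: (@le_trans _ _ (\int[mu]_(y in S) (fkernel x y)%:E)%E); last first.
  apply: ge0_subset_integral => //; first exact: measurableC.
  by move=> y _; rewrite lee_fin fkernel_ge0.
apply: (@le_trans _ _ (\int[mu]_(y in S) (r `^ (- (q + 2 * s)))%:E)%E); last first.
  apply: ge0_le_integral => //.
    by move=> y _; rewrite lee_fin powR_ge0.
  move=> y [/= yr /not_orP[_ /negP yr']]; rewrite lee_fin fkernelE.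
  rewrite /mball/= -leNgt in yr'.
  apply: powRN_le; first by rewrite addr_ge0 ?mulr_ge0 ?(ltW q0) ?(ltW s0).
    exact: lt_le_trans yr'.
  exact: ltW.
rewrite integral_cst//.
apply: (@le_trans _ _ ((r `^ (- (q + 2 * s)))%:E * (m / 2)%:E)%E); last first.
  by rewrite lee_wpmul2l// lee_fin powR_ge0.
rewrite -EFinM lee_fin /r -powRrM (_ : q^-1 * _ = -1 + - (2 * s / q)); last first.
  by field; rewrite gt_eqF.
have b0 : 0 < 2 * m / a by rewrite divr_gt0// mulr_gt0.
rewrite powRD; last by rewrite (gt_eqF b0) implybT.
rewrite powR_inv1 ?(ltW b0)// (_ : 2 * m / a = 2 / a * m); last by field; rewrite gt_eqF.
rewrite (powRM (x:=2 / a)) ?divr_ge0 ?(ltW a0) ?(ltW m0)//.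
rewrite le_eqVlt; apply/orP; left; apply/eqP; field.
by rewrite !gt_eqF.
Qed.

Variable M : R.
Hypothesis M0 : 0 < M.
Implicit Types (o x y : T) (r : R).

Definition psi o r x : R := if dist o x < r then
  Num.min 2 (M * (r - dist o x) `^ (- (2 * s))) else 2.

Lemma psi_ge0 o r x : 0 <= psi o r x.
Proof.
by rewrite /psi; case: ifP => // _; rewrite le_min ler0n mulr_ge0 ?powR_ge0// ltW.
Qed.

Lemma psi_le2 o r x : psi o r x <= 2.
Proof. by rewrite /psi; case: ifP => // _; rewrite ge_min lexx. Qed.

Lemma measurable_psi o r : measurable_fun setT (psi o r).
Proof.
have mo := measurable_dist H o.
apply: measurable_fun_ifT => //; first exact: measurable_fun_ltr.
apply: measurable_minr => //; apply: measurable_funM => //.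
apply: (measurableT_comp (measurable_powR _)).
exact: measurable_funB.
Qed.

Lemma psi_out o r x : r <= dist o x -> psi o r x = 2.
Proof. by rewrite /psi ltNge => ->. Qed.

Lemma psi_in_le o r x t : 0 < t -> dist o x <= r - t -> psi o r x <= M * t `^ (- (2 * s)).
Proof.
move=> t0 xr; rewrite /psi ifT; last by lra.
rewrite ge_min; apply/orP; right; rewrite ler_pM2l//.
by have /andP[s0 _] := s01; apply: powRN_le => //; [rewrite mulr_ge0// ltW|lra].
Qed.

Lemma psi_lt2 o r x : psi o r x < 2 ->
  dist o x < r /\ psi o r x = M * (r - dist o x) `^ (- (2 * s)).
Proof.
rewrite /psi; case: ifP => [xr|_]; last by rewrite ltxx.
by rewrite gt_min ltxx /= => h; rewrite min_r// ltW.
Qed.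

(** Let [t] be the distance relative to [r - |x|]. For [t >= 1/2] the bound [psi <= 2] suffices. For
    smaller [t], [r - |y| >= (1 - t) (r - |x|)] and [(1 - t)^(-2s) <= (1 - t)^(-1) <= 1 + 2 t], so
    the increment is at most [2 t psi(x) <= 4 t]. *)
Lemma psi_increment o r x y : psi o r x < 2 ->
  Num.max 0 (psi o r y - psi o r x) <= 4 * Num.min 1 (dist x y / (r - dist o x)).
Proof.
move=> x2; have [xr xE] := psi_lt2 x2; have /andP[s0 s1] := s01.
have x0 := psi_ge0 o r x; have y0 := psi_ge0 o r y; have y2 := psi_le2 o r y.
set e := r - dist o x in xE *; have e0 : 0 < e by rewrite /e subr_gt0.
have D0 := dist_ge0 H x y.
set t := dist x y / e; have t0 : 0 <= t by rewrite divr_ge0// ltW.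
rewrite ge_max mulr_ge0 ?le_min ?ler01//=.
have [t2|t2] := leP 2^-1 t.
  have : 2^-1 <= Num.min 1 t by rewrite le_min t2 andbT invf_le1// ler1n.
  by move=> h; lra.
rewrite min_r; last by lra.
have yo : e * (1 - t) <= r - dist o y.
  have -> : e * (1 - t) = e - dist x y by rewrite /t; field; rewrite gt_eqF.
  by have := dist_triangle H o x y; rewrite /e; lra.
have et0 : 0 < e * (1 - t) by rewrite mulr_gt0// subr_gt0; lra.
have psy : psi o r y <= M * (e * (1 - t)) `^ (- (2 * s)).
  by apply: psi_in_le => //; lra.
have pt : (1 - t) `^ (- (2 * s)) <= 1 + 2 * t.
  apply: (@le_trans _ _ ((1 - t) `^ (-1))).
    by apply: ger_powR; [apply/andP; split|]; lra.
  rewrite powR_inv1; last lra.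
  rewrite -div1r ler_pdivrMr; last lra.
  by nra.
move: psy; rewrite powRM ?(ltW e0)//; last lra.
rewrite mulrA -xE => psy.
have := ler_wpM2l x0 pt; nra.
Qed.

End barrier.
Arguments psi {R d T}.

Section supersolution.
Context {R : realType} {d : measure_display} {T : measurableType d}.
Variables (mu : {sigma_finite_measure set T -> \bar R}) (dist : T -> T -> R).
Variables (q a A s : R).
Hypothesis H : ahlfors_regular mu dist q a A.
Hypothesis s01 : 0 < s < 2^-1.
Local Notation fkernel := (fkernel dist q s).
Local Notation psi := (psi dist s).

(** Where [psi < 2] it equals [M (r - |x|)^(-2s)], the same power of the distance to the sphere that
    the truncated kernel integral yields. As [C] does not depend on [M], a large [M] makes the
    factor [C / M] as small as desired. *)
Lemma psi_supersolution : exists2 C, 0 < C &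
  forall M, 0 < M -> forall o r x, psi M o r x < 2 ->
  (\int[mu]_y (Num.max 0 (psi M o r y - psi M o r x) * fkernel x y)%:E <=
   (C / M * psi M o r x)%:E)%E.
Proof.
have [C C0 HC] := integral_kernel_truncated H s01.
exists (4 * C); first by rewrite mulr_gt0.
move=> M M0 o r x x2; have [xr xE] := psi_lt2 x2.
have e0 : 0 < r - dist o x by rewrite subr_gt0.
pose g y := Num.min 1 (dist x y / (r - dist o x)) * fkernel x y.
have g0 y : 0 <= g y.
  by rewrite mulr_ge0 ?fkernel_ge0// le_min ler01 divr_ge0 ?(dist_ge0 H) ?ltW.
have mk := measurable_fkernel s H x.
have mg : measurable_fun setT (fun y => (g y)%:E).
  apply: measurableT_comp => //; apply: measurable_funM => //.
  apply: measurable_minr => //; apply: measurable_funM => //.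
  exact: measurable_dist H _.
apply: (@le_trans _ _ (\int[mu]_y (4%:E * (g y)%:E))%E).
  apply: ge0_le_integral => //.
  - by move=> y _; rewrite lee_fin mulr_ge0 ?fkernel_ge0// le_max lexx.
  - apply: measurableT_comp => //; apply: measurable_funM => //.
    by apply: measurable_maxr => //; apply: measurable_funB => //; exact: measurable_psi H _ _ _.
  - exact: measurable_funeM.
  - move=> y _; rewrite -EFinM lee_fin mulrA ler_wpM2r ?fkernel_ge0//.
    exact: (psi_increment H s01 M0).
rewrite ge0_integralZl//; last by move=> y _; rewrite lee_fin.
apply: (le_trans (lee_wpmul2l _ (HC x _ e0))); first by rewrite lee_fin.
rewrite -EFinM lee_fin xE le_eqVlt; apply/orP; left; apply/eqP; field.
by rewrite gt_eqF.
Qed.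

End supersolution.

(** * Truncation and the energy *)

(** The three inequalities are added and the common terms cancelled. For finite [Dm], finiteness of
    [Ku + Wu] forces every other term to be finite: first [P], [Wv] and [Dp], then [Kv] and [Kg]. *)
Lemma ereal_energy_cancel {R : realType} (Ku Kv Kg Wu Wv P Dp Dm : \bar R) :
  (0 <= Ku)%E -> (0 <= Kv)%E -> (0 <= Kg)%E -> (0 <= Wu)%E -> (0 <= Wv)%E ->
  (0 <= P)%E -> (0 <= Dp)%E -> (0 <= Dm)%E -> (Ku + Wu < +oo)%E ->
  (P + Wv + Dp <= Wu + Dm)%E -> (Kv + Kg <= Ku + P)%E -> (Ku + Wu <= Kv + Wv)%E ->
  (Kg + Dp <= Dm)%E.
Proof.
case: Dm => [dm||]; rewrite ?leey//.
case: Ku => [ku||]//; case: Wu => [wu||]//; rewrite ?addye//?addey//.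
case: P => [p||]//; case: Wv => [wv||]//; case: Dp => [dp||]//.
case: Kv => [kv||]//; case: Kg => [kg||]//; rewrite -?EFinD ?lee_fin => *; try by [].
all: lra.
Qed.

Section energy.
Context {R : realType} {d : measure_display} {T : measurableType d}.
Variables (mu : {sigma_finite_measure set T -> \bar R}) (dist : T -> T -> R).
Variables (q a A s : R).
Hypothesis H : ahlfors_regular mu dist q a A.
Variable Om : set T.
Hypothesis mOm : measurable Om.
Local Notation fkernel := (fkernel dist q s).
Implicit Types (u v g phi P : T -> R).

Definition kinetic_energy u : \bar R :=
  ((2^-1)%:E * (\int[mu]_(x in Om) \int[mu]_(y in Om)
     (`|u x - u y| ^+ 2 / dist x y `^ (q + 2 * s))%:E) +
   \int[mu]_(x in Om) \int[mu]_(y in ~` Om)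
     (`|u x - u y| ^+ 2 / dist x y `^ (q + 2 * s))%:E)%E.

(* The double integral over Om x Om counts each pair twice. *)
Definition pair_weight (z : T * T) : R := \1_Om z.1 * (1 - \1_Om z.2 / 2).

Definition pair_integral (F : T * T -> R) : \bar R :=
  (\int[mu \x mu]_z (pair_weight z * F z * fkernel z.1 z.2)%:E)%E.

Lemma pair_weight_ge0 z : 0 <= pair_weight z.
Proof.
by rewrite mulr_ge0 ?indicE// subr_ge0; case: (_ \in _); rewrite /= ?mul0r//; lra.
Qed.

Lemma measurable_pair_weight : measurable_fun setT pair_weight.
Proof.
have mi : measurable_fun setT (\1_Om : T -> R) by exact: measurable_indic.
apply: measurable_funM; first exact: (measurableT_comp mi measurable_fst).
apply: measurable_funB => //; apply: measurable_funM => //.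
exact: (measurableT_comp mi measurable_snd).
Qed.

Section pair_integral_theory.
Variables (F G : T * T -> R).
Hypotheses (mF : measurable_fun setT F) (F0 : forall z, 0 <= F z).
Hypotheses (mG : measurable_fun setT G) (G0 : forall z, 0 <= G z).

Let mw (K : T * T -> R) : measurable_fun setT K ->
  measurable_fun setT (fun z => (pair_weight z * K z * fkernel z.1 z.2)%:E).
Proof.
move=> mK; apply: measurableT_comp => //; apply: measurable_funM.
  by apply: measurable_funM => //; exact: measurable_pair_weight.
exact: measurable_fkernel2 s H.
Qed.

Let w0 (K : T * T -> R) z : (forall z, 0 <= K z) ->
  (0 <= (pair_weight z * K z * fkernel z.1 z.2)%:E)%E.
Proof. by move=> K0; rewrite lee_fin mulr_ge0 ?fkernel_ge0// mulr_ge0 ?pair_weight_ge0. Qed.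

Lemma pair_integral_ge0 : (0 <= pair_integral F)%E.
Proof. by apply: integral_ge0 => z _; exact: w0. Qed.

Lemma pair_integralD :
  pair_integral (fun z => F z + G z) = (pair_integral F + pair_integral G)%E.
Proof.
transitivity (\int[mu \x mu]_z ((pair_weight z * F z * fkernel z.1 z.2)%:E +
    (pair_weight z * G z * fkernel z.1 z.2)%:E))%E.
  by apply: eq_integral => z _; rewrite -EFinD; congr (_%:E); ring.
apply: ge0_integralD => //.
- by move=> z _; exact: w0.
- exact: mw.
- by move=> z _; exact: w0.
- exact: mw.
Qed.

Lemma le_pair_integral : (forall z, F z <= G z) -> (pair_integral F <= pair_integral G)%E.
Proof.
move=> FG; apply: ge0_le_integral => //.
- by move=> z _; exact: w0.
- exact: mw.
- exact: mw.
- move=> z _; rewrite lee_fin ler_wpM2r ?fkernel_ge0//.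
  by rewrite ler_wpM2l ?pair_weight_ge0.
Qed.

Lemma pair_integralE : pair_integral F =
  (\int[mu]_x \int[mu]_y (pair_weight (x, y) * F (x, y) * fkernel x y)%:E)%E.
Proof.
rewrite /pair_integral fubini_tonelli1//; first exact: mw.
by move=> z; exact: w0.
Qed.

(** Tonelli and the symmetry of the kernel move the exchange of variables from [F] to the weight,
    and [pair_weight (x, y) + pair_weight (y, x) = 1] whenever [x] lies in [Om]. *)
Lemma pair_integral_symm : (forall x y, ~ Om x -> F (x, y) = 0) ->
  (pair_integral F + pair_integral (fun z => F (z.2, z.1)) =
   \int[mu]_x \int[mu]_y (F (x, y) * fkernel x y)%:E)%E.
Proof.
move=> FOm.
have mS : measurable_fun setT (fun z : T * T => F (z.2, z.1)).
  apply: (measurableT_comp mF); apply: measurable_fun_pair => //.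
have S0 (z : T * T) : 0 <= F (z.2, z.1) by [].
have mws : measurable_fun setT (fun z : T * T => pair_weight (z.2, z.1)).
  apply: (measurableT_comp measurable_pair_weight); apply: measurable_fun_pair => //.
have mw2 : measurable_fun setT (fun z : T * T =>
    (pair_weight (z.2, z.1) * F z * fkernel z.1 z.2)%:E).
  apply: measurableT_comp => //; apply: measurable_funM; first exact: measurable_funM.
  exact: measurable_fkernel2 s H.
have -> : pair_integral (fun z => F (z.2, z.1)) =
    (\int[mu \x mu]_z (pair_weight (z.2, z.1) * F z * fkernel z.1 z.2)%:E)%E.
  rewrite [RHS]fubini_tonelli1; [|exact: mw2|]; last first.
    by move=> z; rewrite lee_fin mulr_ge0 ?fkernel_ge0// mulr_ge0 ?pair_weight_ge0.
  rewrite /pair_integral fubini_tonelli2; [|exact: mw|]; last first.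
    by move=> z; exact: (@w0 (fun z => F (z.2, z.1))).
  by apply: eq_integral => x _; apply: eq_integral => y _ /=; rewrite (fkernelC s H).
have mFk : measurable_fun setT (fun z : T * T => (F z * fkernel z.1 z.2)%:E).
  apply: measurableT_comp => //; apply: measurable_funM => //.
  exact: measurable_fkernel2 s H.
have Fk0 z : (0 <= (F z * fkernel z.1 z.2)%:E)%E by rewrite lee_fin mulr_ge0 ?fkernel_ge0.
transitivity (\int[mu \x mu]_z (F z * fkernel z.1 z.2)%:E)%E; last first.
  by rewrite fubini_tonelli1; [|exact: mFk|exact: Fk0].
transitivity (\int[mu \x mu]_z ((pair_weight z * F z * fkernel z.1 z.2)%:E +
    (pair_weight (z.2, z.1) * F z * fkernel z.1 z.2)%:E))%E.
  apply: esym; apply: ge0_integralD => //; [|exact: mw|]; move=> z _; first exact: w0.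
  by rewrite lee_fin mulr_ge0 ?fkernel_ge0// mulr_ge0 ?pair_weight_ge0.
apply: eq_integral => -[x y] _ /=; rewrite -EFinD -mulrDl -mulrDl; congr (_ * _)%:E.
have [xO|xO] := pselect (Om x); last by rewrite FOm// mulr0.
by rewrite /pair_weight/= !indicE (mem_set xO); case: (y \in Om) => /=; field.
Qed.

End pair_integral_theory.
End energy.

Lemma measurable_integral_section {R : realType} {d} {T : measurableType d}
    (mu : {sigma_finite_measure set T -> \bar R}) (D : set T) (G : T * T -> R) :
  measurable D -> measurable_fun setT G -> (forall z, 0 <= G z) ->
  measurable_fun setT (fun x => (\int[mu]_(y in D) (G (x, y))%:E)%E).
Proof.
move=> mD mG G0.
have mi : measurable_fun setT (\1_D : T -> R) by exact: measurable_indic.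
pose F (z : T * T) := (\1_D z.2 * G z)%:E.
have mF : measurable_fun setT F.
  apply: measurableT_comp => //; apply: measurable_funM => //.
  exact: (measurableT_comp mi measurable_snd).
have F0 z : (0 <= F z)%E by rewrite lee_fin mulr_ge0.
rewrite (_ : (fun x => _) = (fun x => \int[mu]_y F (x, y))%E).
  exact: measurable_fun_fubini_tonelli_F mF F0.
apply/funext => x; rewrite integral_mkcond; apply: eq_integral => y _.
by rewrite /F patchE indicE/=; case: (y \in D); rewrite ?mul1r ?mul0r.
Qed.

(** Here [a], [b] are the values of [u] and [p], [c] those of the barrier at two points. Write [v]
    for the minimum and [g] for the excess. As [v + g = u], the left side differs from
    [(a - b) ^+ 2] by [-2 (v_x - v_y) (g_x - g_y)]. Where [g_x > 0] one has [v_x = p] while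
    [v_y <= c], so [(v_y - v_x) g_x] is at most [g_x] times the positive part of [c - p]; likewise
    for [g_y]. *)
Lemma truncation_pair_inequality {R : realDomainType} (a b p c : R) :
  (Num.min a p - Num.min b c) ^+ 2 + (Num.max 0 (a - p) - Num.max 0 (b - c)) ^+ 2 <=
  (a - b) ^+ 2 + 2 * (Num.max 0 (a - p) * Num.max 0 (c - p) +
                      Num.max 0 (b - c) * Num.max 0 (p - c)).
Proof.
have [ap|ap] := leP a p; have [bc|bc] := leP b c.
- rewrite (max_l (_ : a - p <= 0)) ?subr_le0// (max_l (_ : b - c <= 0)) ?subr_le0//.
  by nra.
- rewrite (max_l (_ : a - p <= 0)) ?subr_le0// (max_r (_ : 0 <= b - c)) ?subr_ge0 ?(ltW bc)//.
  have m : p - c <= Num.max 0 (p - c) /\ 0 <= Num.max 0 (p - c) by rewrite !le_max !lexx orbT.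
  move: (Num.max 0 (p - c)) m => m [m1 m2].
  have h : 0 <= (b - c) * (m - (a - c)) by rewrite mulr_ge0 ?subr_ge0 ?(ltW bc)//; lra.
  by nra.
- rewrite (max_r (_ : 0 <= a - p)) ?subr_ge0 ?(ltW ap)// (max_l (_ : b - c <= 0)) ?subr_le0//.
  have m : c - p <= Num.max 0 (c - p) /\ 0 <= Num.max 0 (c - p) by rewrite !le_max !lexx orbT.
  move: (Num.max 0 (c - p)) m => m [m1 m2].
  have h : 0 <= (a - p) * (m + p - b) by rewrite mulr_ge0 ?subr_ge0 ?(ltW ap)//; lra.
  by nra.
- rewrite (max_r (_ : 0 <= a - p)) ?subr_ge0 ?(ltW ap)//.
  rewrite (max_r (_ : 0 <= b - c)) ?subr_ge0 ?(ltW bc)//.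
  have m : c - p <= Num.max 0 (c - p) by rewrite le_max lexx orbT.
  have m' : p - c <= Num.max 0 (p - c) by rewrite le_max lexx orbT.
  have h := ler_wpM2l (_ : 0 <= a - p) m; have h' := ler_wpM2l (_ : 0 <= b - c) m'.
  by move: (h (ltac:(lra))) (h' (ltac:(lra))); nra.
Qed.

(** * The kinetic energy as a single double integral *)

Section energy_comparison.
Context {R : realType} {d : measure_display} {T : measurableType d}.
Variables (mu : {sigma_finite_measure set T -> \bar R}) (dist : T -> T -> R).
Variables (q a A s : R).
Hypothesis H : ahlfors_regular mu dist q a A.
Variable Om : set T.
Hypothesis mOm : measurable Om.
Local Notation fkernel := (fkernel dist q s).
Local Notation kinetic_energy := (kinetic_energy mu dist q s Om).
Local Notation pair_integral := (pair_integral mu dist q s Om).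
Implicit Types (u v g phi P : T -> R).

Lemma kinetic_energyE u : measurable_fun setT u ->
  kinetic_energy u = pair_integral (fun z => (u z.1 - u z.2) ^+ 2).
Proof.
move=> meas_u; have mOmC := measurableC mOm.
pose F (z : T * T) := (u z.1 - u z.2) ^+ 2.
have mF : measurable_fun setT F.
  apply: measurable_funX; apply: measurable_funB.
    exact: (measurableT_comp meas_u measurable_fst).
  exact: (measurableT_comp meas_u measurable_snd).
have F0 z : 0 <= F z by rewrite sqr_ge0.
rewrite (pair_integralE s H mOm mF F0).
pose G (z : T * T) := F z * fkernel z.1 z.2.
have mG : measurable_fun setT G by apply: measurable_funM => //; exact: measurable_fkernel2 s H.
have G0 z : 0 <= G z by rewrite mulr_ge0 ?fkernel_ge0.
have mGx x : measurable_fun setT (fun y => (G (x, y))%:E).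
  by apply: measurableT_comp => //; exact: (measurableT_comp mG (pair1_measurable x)).
have GE x y : `|u x - u y| ^+ 2 / dist x y `^ (q + 2 * s) = G (x, y).
  by rewrite /G /F /= real_normK ?num_real.
rewrite /kinetic_energy.
under eq_integral do under eq_integral do rewrite GE.
under [in X in (_ + X)%E]eq_integral do under eq_integral do rewrite GE.
pose I1 x := (\int[mu]_(y in Om) (G (x, y))%:E)%E.
pose I2 x := (\int[mu]_(y in ~` Om) (G (x, y))%:E)%E.
have mI1 : measurable_fun setT I1 by exact: measurable_integral_section.
have mI2 : measurable_fun setT I2 by exact: measurable_integral_section.
have I10 x : (0 <= I1 x)%E by apply: integral_ge0 => y _; rewrite lee_fin.
have I20 x : (0 <= I2 x)%E by apply: integral_ge0 => y _; rewrite lee_fin.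
transitivity (\int[mu]_(x in Om) ((2^-1)%:E * I1 x + I2 x))%E.
  have P1 x : Om x -> (0 <= (2^-1)%:E * I1 x)%E by move=> _; rewrite mule_ge0// lee_fin.
  have M1 : measurable_fun Om (fun x => (2^-1)%:E * I1 x)%E.
    by apply: measurable_funeM; exact: measurable_funTS.
  rewrite (ge0_integralD mu mOm P1 M1 (fun x _ => I20 x) (measurable_funTS mI2)).
  by rewrite (ge0_integralZl_EFin mu mOm (fun x _ => I10 x) (measurable_funTS mI1)).
rewrite integral_mkcond; apply: eq_integral => x _; rewrite patchE.
case: ifPn => [|] xO; last first.
  rewrite integral0_eq// => y _.
  by rewrite /pair_weight/= indicE (negbTE xO) !mul0r.
pose K y := (pair_weight Om (x, y) * F (x, y) * fkernel x y)%:E.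
have K0 y : (0 <= K y)%E.
  by rewrite lee_fin mulr_ge0 ?fkernel_ge0// mulr_ge0// pair_weight_ge0.
have mK : measurable_fun setT K.
  apply: measurableT_comp => //; apply: measurable_funM; last exact: measurable_fkernel s H x.
  apply: measurable_funM; last exact: (measurableT_comp mF (pair1_measurable x)).
  exact: (measurableT_comp (measurable_pair_weight mOm) (pair1_measurable x)).
have -> : (\int[mu]_y K y = \int[mu]_(y in Om) K y + \int[mu]_(y in ~` Om) K y)%E.
  rewrite -(setUv Om) ge0_integral_setU//; first exact: measurable_funTS.
  exact/disj_setPCl.
congr (_ + _)%E.
  have GP y : Om y -> (0 <= (G (x, y))%:E)%E by move=> _; rewrite lee_fin.
  rewrite -(ge0_integralZl_EFin mu mOm GP (measurable_funTS (mGx x)))//.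
  apply: eq_integral => y yO; rewrite -EFinM; congr (_%:E).
  by rewrite /pair_weight/= !indicE xO yO /G /=; field.
apply: eq_integral => y yO; congr (_%:E).
have yO' : (y \in Om) = false by apply/negP => /set_mem; move: yO => /set_mem.
by rewrite /pair_weight/= !indicE xO yO' /G /=; field.
Qed.

End energy_comparison.

(** * Truncating a minimizer at a supersolution *)

Section truncation.
Context {R : realType} {d : measure_display} {T : measurableType d}.
Variables (mu : {sigma_finite_measure set T -> \bar R}) (dist : T -> T -> R).
Variables (q a A s : R).
Hypothesis H : ahlfors_regular mu dist q a A.
Variables (Om : set T).
Hypothesis mOm : measurable Om.
Local Notation fkernel := (fkernel dist q s).
Local Notation kinetic_energy := (kinetic_energy mu dist q s Om).
Local Notation pair_integral := (pair_integral mu dist q s Om).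

Lemma kinetic_energy_ge0 u : measurable_fun setT u -> (0 <= kinetic_energy u)%E.
Proof.
move=> meas_u; rewrite (kinetic_energyE s H mOm meas_u).
by apply: pair_integral_ge0 => z; rewrite sqr_ge0.
Qed.

(** The integral is restricted to [E] times the complement of [E']. The factor [2^-1] is the least
    value of the pair weight with first point in [Om]. *)
Lemma kinetic_energy_ge (g : T -> R) (E E' : set T) (eps c : R) :
  measurable_fun setT g -> measurable E -> measurable E' -> E `<=` Om ->
  0 <= eps -> 0 <= c -> (forall x y, E x -> ~ E' y -> eps <= `|g x - g y|) ->
  (forall x, (c%:E <= \int[mu]_(y in ~` E') (fkernel x y)%:E)%E) ->
  ((2^-1 * eps ^+ 2 * c)%:E * mu E <= kinetic_energy g)%E.
Proof.
move=> mg mE mE' EOm eps0 c0 gap kc.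
pose F (z : T * T) := (g z.1 - g z.2) ^+ 2.
have mF : measurable_fun setT F.
  apply: measurable_funX; apply: measurable_funB.
    exact: (measurableT_comp mg measurable_fst).
  exact: (measurableT_comp mg measurable_snd).
have F0 z : 0 <= F z by rewrite sqr_ge0.
rewrite (kinetic_energyE s H mOm mg) (pair_integralE s H mOm mF F0).
pose K (z : T * T) := pair_weight Om z * F z * fkernel z.1 z.2.
have K0 z : 0 <= K z by rewrite mulr_ge0 ?fkernel_ge0// mulr_ge0// pair_weight_ge0.
have mK : measurable_fun setT K.
  apply: measurable_funM; last exact: measurable_fkernel2 s H.
  by apply: measurable_funM => //; exact: measurable_pair_weight.
have mKx x : measurable_fun setT (fun y => (K (x, y))%:E).
  by apply: measurableT_comp => //; exact: (measurableT_comp mK (pair1_measurable x)).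
have mI : measurable_fun setT (fun x => \int[mu]_y (K (x, y))%:E)%E.
  exact: measurable_integral_section.
have mk x : measurable_fun setT (fun y => (fkernel x y)%:E).
  by apply: measurableT_comp => //; exact: measurable_fkernel s H x.
rewrite -integral_cst//.
apply: (@le_trans _ _ (\int[mu]_(x in E) \int[mu]_y (K (x, y))%:E)%E); last first.
  apply: ge0_subset_integral => // x _; apply: integral_ge0 => y _.
  by rewrite lee_fin K0.
apply: ge0_le_integral => //.
- by move=> x _; rewrite lee_fin !mulr_ge0.
- exact: measurable_funTS.
move=> x xE.
apply: (@le_trans _ _ (\int[mu]_(y in ~` E') (K (x, y))%:E)%E); last first.
  apply: ge0_subset_integral => //; first exact: measurableC.
  by move=> y _; rewrite lee_fin K0.
have k0 y : (~` E') y -> (0 <= (fkernel x y)%:E)%E by move=> _; rewrite lee_fin fkernel_ge0.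
have c0' : 0 <= 2^-1 * eps ^+ 2 by rewrite mulr_ge0 ?sqr_ge0.
apply: (@le_trans _ _ (\int[mu]_(y in ~` E') ((2^-1 * eps ^+ 2)%:E * (fkernel x y)%:E))%E).
  rewrite (ge0_integralZl_EFin mu (measurableC mE') k0 (measurable_funTS (mk x)))//.
  by rewrite EFinM lee_wpmul2l.
apply: ge0_le_integral; first exact: measurableC.
- by move=> y yE'; rewrite mule_ge0 ?k0// lee_fin.
- by apply: measurable_funeM; exact: measurable_funTS.
- exact: measurable_funTS.
move=> y yE'; rewrite -EFinM lee_fin ler_wpM2r ?fkernel_ge0//.
apply: ler_pM; rewrite ?sqr_ge0 ?invr_ge0//.
  rewrite /pair_weight /= !indicE (mem_set (EOm _ xE)) mul1r.
  by case: (y \in Om) => /=; lra.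
rewrite /F /= -[leRHS](real_normK (num_real _)).
by rewrite lerXn2r ?nnegrE//; exact: gap.
Qed.

Section comparison.
Variables (u phi P : T -> R) (tau : R).
Hypotheses (meas_u : measurable_fun setT u) (mphi : measurable_fun setT phi).
Hypotheses (mP : measurable_fun setT P) (P0 : forall x, 0 <= P x) (tau0 : 0 <= tau).
Hypothesis phi_out : forall x, ~ Om x -> u x <= phi x.
Hypothesis supersolution : forall x, phi x < u x ->
  (\int[mu]_y (Num.max 0 (phi y - phi x) * fkernel x y)%:E <= (tau * P x)%:E)%E.

Let g x := Num.max 0 (u x - phi x).
Let v x := Num.min (u x) (phi x).

Let mg : measurable_fun setT g.
Proof. by apply: measurable_maxr => //; exact: measurable_funB. Qed.

Let mv : measurable_fun setT v.
Proof. exact: measurable_minr. Qed.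

Let g0 x : 0 <= g x. Proof. by rewrite le_max lexx. Qed.

(** The pointwise inequality is integrated over pairs. Its error terms [h (x, y)] and [h (y, x)]
    combine into an unweighted double integral, whose inner integral is [2 g(x)] times the quantity
    controlled by [supersolution]. *)
Lemma truncation_comparison : (kinetic_energy v + kinetic_energy g <=
  kinetic_energy u + \int[mu]_(x in Om) (2 * tau * g x * P x)%:E)%E.
Proof.
have mdiff (f : T -> R) : measurable_fun setT f ->
    measurable_fun setT (fun z : T * T => (f z.1 - f z.2) ^+ 2).
  move=> mf; apply: measurable_funX; apply: measurable_funB.
    exact: (measurableT_comp mf measurable_fst).
  exact: (measurableT_comp mf measurable_snd).
pose h (z : T * T) := 2 * (g z.1 * Num.max 0 (phi z.2 - phi z.1)).
have h0 z : 0 <= h z by rewrite !mulr_ge0// le_max lexx.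
have mh : measurable_fun setT h.
  apply: measurable_funM => //; apply: measurable_funM.
    exact: (measurableT_comp mg measurable_fst).
  apply: measurable_maxr => //; apply: measurable_funB.
    exact: (measurableT_comp mphi measurable_snd).
  exact: (measurableT_comp mphi measurable_fst).
have mhs : measurable_fun setT (fun z : T * T => h (z.2, z.1)).
  by apply: (measurableT_comp mh); apply: measurable_fun_pair.
rewrite !(kinetic_energyE s H mOm)//.
rewrite -(pair_integralD s H mOm)//; try by [exact: mdiff|move=> z; rewrite sqr_ge0].
apply: (@le_trans _ _ (pair_integral (fun z => (u z.1 - u z.2) ^+ 2 + (h z + h (z.2, z.1))))).
  apply: (le_pair_integral s H mOm).
  - by apply: measurable_funD; exact: mdiff.
  - by move=> z; rewrite addr_ge0 ?sqr_ge0.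
  - by apply: measurable_funD; [exact: mdiff|exact: measurable_funD].
  - by move=> z; rewrite /h /= -mulrDr; exact: truncation_pair_inequality.
rewrite (pair_integralD s H mOm); last 4 first.
- exact: mdiff.
- by move=> z; rewrite sqr_ge0.
- exact: measurable_funD.
- by move=> z; rewrite addr_ge0.
rewrite (pair_integralD s H mOm)// leeD2l//.
rewrite (pair_integral_symm s H mOm)//; last first.
  move=> x y xO; rewrite /h /= /g max_l ?mul0r ?mulr0// subr_le0.
  exact: phi_out.
rewrite [leRHS]integral_mkcond; apply: ge0_le_integral => //.
- by move=> x _; apply: integral_ge0 => y _; rewrite lee_fin mulr_ge0 ?fkernel_ge0.
- apply: (@measurable_integral_section _ _ _ mu setT
    (fun z => h z * fkernel z.1 z.2)) => //.
    by apply: measurable_funM => //; exact: measurable_fkernel2 s H.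
  by move=> z; rewrite mulr_ge0 ?fkernel_ge0.
- apply/(measurable_restrictT _ mOm); apply: measurableT_comp => //.
  apply: measurable_funM; last exact: measurable_funTS.
  by apply: measurable_funM => //; exact: measurable_funTS.
move=> x _; rewrite patchE.
have [gx|gx] := leP (u x) (phi x).
  have gx0 : g x = 0 by rewrite /g max_l// subr_le0.
  rewrite integral0_eq; last by move=> y _; rewrite /h /= gx0 !mul0r mulr0 mul0r.
  by case: ifP => // _; rewrite gx0 mulr0 mul0r.
(* Positive excess is possible only inside [Om], so the right-hand integral over [Om] sees this
   point. *)
rewrite ifT; last by rewrite inE; apply: contrapT => /phi_out; rewrite leNgt gx.
rewrite (_ : (fun y => _) = (fun y => (2 * g x)%:E *
    (Num.max 0 (phi y - phi x) * fkernel x y)%:E)%E); last first.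
  by apply/funext => y; rewrite -EFinM /h /= !mulrA.
rewrite ge0_integralZl//; last 3 first.
- apply: measurableT_comp => //; apply: measurable_funM; last exact: measurable_fkernel s H x.
  by apply: measurable_maxr => //; exact: measurable_funB.
- by move=> y _; rewrite lee_fin mulr_ge0 ?fkernel_ge0// le_max lexx.
- by rewrite lee_fin mulr_ge0.
apply: (le_trans (lee_wpmul2l _ (supersolution gx))); first by rewrite lee_fin mulr_ge0.
by rewrite -EFinM lee_fin le_eqVlt; apply/orP; left; apply/eqP; ring.
Qed.

Variables (W : R -> R) (Dp Dm : T -> R).
Hypotheses (mWu : measurable_fun Om (W \o u)) (mWv : measurable_fun Om (W \o v)).
Hypotheses (Wu0 : forall x, Om x -> 0 <= W (u x)) (Wv0 : forall x, Om x -> 0 <= W (v x)).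
Hypotheses (mDp : measurable_fun Om Dp) (mDm : measurable_fun Om Dm).
Hypotheses (Dp0 : forall x, 0 <= Dp x) (Dm0 : forall x, 0 <= Dm x).
Hypothesis finite_energy :
  (kinetic_energy u + \int[mu]_(x in Om) (W (u x))%:E < +oo)%E.
Hypothesis minimal : (kinetic_energy u + \int[mu]_(x in Om) (W (u x))%:E <=
  kinetic_energy v + \int[mu]_(x in Om) (W (v x))%:E)%E.
Hypothesis pointwise : forall x, Om x ->
  2 * tau * g x * P x + W (v x) + Dp x <= W (u x) + Dm x.

(** Minimality is tested with [v]. [Dp] is the part of the decrease of the potential that is kept as
    a gain, [Dm] pays wherever the decrease does not cover the kinetic cost. *)
Lemma truncation_energy_le :
  (kinetic_energy g + \int[mu]_(x in Om) (Dp x)%:E <= \int[mu]_(x in Om) (Dm x)%:E)%E.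
Proof.
have gP0 x : 0 <= 2 * tau * g x * P x by rewrite !mulr_ge0.
have mgP : measurable_fun Om (fun x => (2 * tau * g x * P x)%:E).
  apply: measurableT_comp => //; apply: measurable_funM; last exact: measurable_funTS.
  by apply: measurable_funM => //; exact: measurable_funTS.
have I0 (f : T -> R) : (forall x, Om x -> 0 <= f x) -> (0 <= \int[mu]_(x in Om) (f x)%:E)%E.
  by move=> f0; apply: integral_ge0 => x xO; rewrite lee_fin f0.
apply: (ereal_energy_cancel _ _ _ _ _ _ _ _ finite_energy _ truncation_comparison minimal);
  try exact: kinetic_energy_ge0; try (by apply: I0).
have mE (f : T -> R) : measurable_fun Om f -> measurable_fun Om (fun x => (f x)%:E).
  by move=> mf; apply: measurableT_comp.
have f0 (f : T -> R) : (forall x, Om x -> 0 <= f x) -> forall x, Om x -> (0 <= (f x)%:E)%E.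
  by move=> h x xO; rewrite lee_fin h.
have ID (f f' : T -> R) : measurable_fun Om f -> measurable_fun Om f' ->
    (forall x, Om x -> 0 <= f x) -> (forall x, Om x -> 0 <= f' x) ->
    (\int[mu]_(x in Om) (f x)%:E + \int[mu]_(x in Om) (f' x)%:E =
     \int[mu]_(x in Om) (f x + f' x)%:E)%E.
  move=> mf mf' h h'.
  by rewrite -(ge0_integralD mu mOm (f0 _ h) (mE _ mf) (f0 _ h') (mE _ mf')).
have mgP' : measurable_fun Om (fun x => 2 * tau * g x * P x).
  apply: measurable_funM; last exact: measurable_funTS.
  by apply: measurable_funM => //; exact: measurable_funTS.
rewrite (ID _ (W \o v))// ID//; last 2 first.
- exact: measurable_funD.
- by move=> x xO; rewrite addr_ge0// Wv0.
rewrite (ID (W \o u))//.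
apply: ge0_le_integral => //.
- by move=> x xO; rewrite lee_fin !addr_ge0// Wv0.
- by apply: mE; apply: measurable_funD => //; exact: measurable_funD.
- by apply: mE; exact: measurable_funD.
Qed.

End comparison.
End truncation.

(** * Minimizers and the barrier *)

Lemma measurable_superlevel {R : realType} {d} {T : measurableType d} (f : T -> R) c :
  measurable_fun setT f -> measurable [set x | c < f x].
Proof.
move=> mf; rewrite [X in measurable X](_ : _ = f @^-1` `]c, +oo[%classic).
  by rewrite -[X in measurable X]setTI; exact: mf.
by apply/seteqP; split => y /=; rewrite in_itv /= andbT.
Qed.

Lemma measurable_sublevel {R : realType} {d} {T : measurableType d} (f : T -> R) c :
  measurable_fun setT f -> measurable [set x | f x <= c].
Proof.
move=> mf; rewrite [X in measurable X](_ : _ = ~` [set x | c < f x]).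
  exact: measurableC (measurable_superlevel c mf).
by apply/seteqP; split => y /=; rewrite leNgt => /negP.
Qed.

Lemma integral_scale_indic_in {R : realType} {d} {T : measurableType d}
    (mu : {measure set T -> \bar R}) (c : R) (f : T -> R) (D S : set T) :
  0 <= c -> (forall x, 0 <= f x) -> measurable_fun setT f ->
  measurable D -> measurable S -> S `<=` D ->
  (\int[mu]_(x in D) (c * f x * \1_S x)%:E = c%:E * \int[mu]_(x in S) (f x)%:E)%E.
Proof.
move=> c0 f0 mf mD mS SD.
have mfS : measurable_fun S (fun x => (f x)%:E).
  by apply: measurable_funTS; apply: measurableT_comp.
have f0' x : S x -> (0 <= (f x)%:E)%E by rewrite lee_fin.
rewrite -(ge0_integralZl_EFin mu mS f0' mfS)// integral_mkcond [RHS]integral_mkcond.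
apply: eq_integral => x _; rewrite !patchE.
have [xS|xS] := boolP (x \in S).
  by rewrite mem_set ?indicE ?xS ?mulr1//; apply: SD; exact: set_mem.
by case: ifP => // _; rewrite indicE (negbTE xS) mulr0.
Qed.

(* [well_growth] says that W - lam (1 + t)^2 is nondecreasing on [-1, th]. *)
Record well_bounds {R : realType} (W : R -> R) (L lam th : R) : Prop := {
  well_measurable : measurable_fun (`[-1, 1]%classic : set R) W;
  well_ge0 : forall t, -1 <= t <= 1 -> 0 <= W t;
  well_zero : W (-1) = 0;
  well_lip_gt0 : 0 < L;
  well_lip : forall x y, -1 <= x <= 1 -> -1 <= y <= 1 -> W y - W x <= L * `|y - x|;
  well_th : -1 < th < 1;
  well_lam_gt0 : 0 < lam;
  well_growth : forall x y, -1 <= x -> x <= y -> y <= th ->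
    lam * (2 * (1 + x) * (y - x) + (y - x) ^+ 2) <= W y - W x;
  well_pos : forall t, -1 < t < 1 -> exists2 w, 0 < w &
    forall z, th <= z <= t -> w <= W z }.

Definition energy_minimizer {R : realType} {d} {T : measurableType d}
    (mu : {sigma_finite_measure set T -> \bar R}) (dist : T -> T -> R) (q s : R) (W : R -> R)
    (u : T -> R) (Om : set T) : Prop :=
  let admissible (v : T -> R) := measurable_fun setT v /\ forall x, -1 <= v x <= 1 in
  let energy (v : T -> R) := (kinetic_energy mu dist q s Om v +
                   \int[mu]_(x in Om) (W (v x))%:E)%E in
  [/\ admissible u, (energy u < +oo)%E &
    forall v, admissible v -> (forall x, (~` Om) x -> v x = u x) ->
      (energy u <= energy v)%E].

Section barrier_comparison.
Context {R : realType} {d : measure_display} {T : measurableType d}.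
Variables (mu : {sigma_finite_measure set T -> \bar R}) (dist : T -> T -> R).
Variables (q a A s : R).
Hypothesis H : ahlfors_regular mu dist q a A.
Hypothesis s01 : 0 < s < 2^-1.
Variables (W : R -> R) (L lam th : R).
Hypothesis HW : well_bounds W L lam th.
Local Notation fkernel := (fkernel dist q s).
Local Notation psi := (psi dist s).

Variables (M tau : R).
Hypotheses (M0 : 0 < M) (tau0 : 0 <= tau) (taulam : tau <= lam).
Hypothesis psi_super : forall o rho x, psi M o rho x < 2 ->
  (\int[mu]_y (Num.max 0 (psi M o rho y - psi M o rho x) * fkernel x y)%:E <=
   (tau * psi M o rho x)%:E)%E.

Variables (o : T) (r rho : R) (u : T -> R).
Hypothesis rho_r : rho <= r.
Local Notation Om := (mball dist o r).
Local Notation kinetic_energy := (kinetic_energy mu dist q s Om).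
Hypothesis umin : energy_minimizer mu dist q s W u Om.

(** Adding a constant [l] leaves the increments of the barrier unchanged, so all levels share the
    same supersolution inequality. *)
Definition excess l x : R := Num.max 0 (u x - (psi M o rho x - 1 + l)).
Local Notation psir := (psi M o rho).

Let mOm : measurable Om. Proof. exact: measurable_mball H _ _. Qed.
Let mB : measurable (mball dist o rho). Proof. exact: measurable_mball H _ _. Qed.
Let meas_u : measurable_fun setT u. Proof. by case: umin => [[]]. Qed.
Let u1 x : -1 <= u x <= 1. Proof. by case: umin => [[_]]. Qed.
Let mpsi : measurable_fun setT psir. Proof. exact: (measurable_psi s H M o rho). Qed.
Let p0 x : 0 <= psir x. Proof. exact: psi_ge0. Qed.
Let p2 x : psir x <= 2. Proof. exact: psi_le2. Qed.
Let BOm : mball dist o rho `<=` Om.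
Proof. by move=> x /= h; exact: lt_le_trans h rho_r. Qed.

Lemma measurable_excess l : measurable_fun setT (excess l).
Proof.
apply: measurable_maxr => //; apply: measurable_funB => //.
by apply: measurable_funD => //; apply: measurable_funB.
Qed.

Lemma excess_ge0 l x : 0 <= excess l x.
Proof. by rewrite le_max lexx. Qed.

Lemma excess_gt0 l x : 0 < excess l x -> excess l x = u x - (psir x - 1 + l).
Proof. by rewrite /excess; case: (leP 0 (u x - _)) => // _; rewrite ltxx. Qed.

Lemma excess_ball l x : 0 <= l -> 0 < excess l x -> mball dist o rho x.
Proof.
move=> l0 g0; rewrite /mball /= ltNge; apply/negP => /psi_out E.
have := excess_gt0 g0; rewrite E; have := u1 x; lra.
Qed.

(** The competitor is the minimum of [u] and [psi - 1 + l]. It stays above [-1] because [psi] and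
    [l] are nonnegative, and equals [u] outside [Om] because the barrier is [1 + l] there. What
    remains to be checked is an inequality between values of [W]. *)
Lemma barrier_energy_le l (Dp Dm : T -> R) : 0 <= l ->
  measurable_fun setT Dp -> measurable_fun setT Dm ->
  (forall x, 0 <= Dp x) -> (forall x, 0 <= Dm x) ->
  (forall x, 0 < excess l x -> u x = psir x - 1 + l + excess l x ->
    -1 <= psir x - 1 + l <= 1 -> excess l x <= 2 ->
    2 * tau * excess l x * psir x + W (psir x - 1 + l) + Dp x <= W (u x) + Dm x) ->
  (forall x, excess l x = 0 -> Dp x <= Dm x) ->
  (kinetic_energy (excess l) + \int[mu]_(x in Om) (Dp x)%:E <=
   \int[mu]_(x in Om) (Dm x)%:E)%E.
Proof.
move=> l0 mDp mDm Dp0 Dm0 Dgt Deq.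
pose phi x := psir x - 1 + l.
have mphi : measurable_fun setT phi by apply: measurable_funD => //; apply: measurable_funB.
pose v x := Num.min (u x) (phi x).
have v1 x : -1 <= v x <= 1.
  have /andP[ua ub] := u1 x; rewrite /v le_min ua ge_min ub /= andbT /phi.
  by have := p0 x; lra.
have mv : measurable_fun setT v by exact: measurable_minr.
have out x : ~ Om x -> u x <= phi x.
  rewrite /mball /= => /negP; rewrite -leNgt => ox.
  rewrite /phi psi_out ?(le_trans rho_r)//; have := u1 x; lra.
have mW (f : T -> R) : measurable_fun setT f -> (forall x, -1 <= f x <= 1) ->
    measurable_fun Om (W \o f).
  move=> mf f1; apply: measurable_funTS.
  apply: (measurable_comp (F := `[-1, 1]%classic : set R) _ _ (well_measurable HW) mf) => //.
  by move=> _ [x _ <-] /=; rewrite in_itv; exact: f1.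
have [_ ufin uleast] := umin.
apply: (truncation_energy_le (P := psir) H mOm meas_u mphi mpsi p0 tau0 out _ (W := W)) => //.
- move=> x phiu; have x2 : psir x < 2 by move: phiu; rewrite /phi; have := u1 x; lra.
  have := psi_super x2; congr (_ <= _)%E; apply: eq_integral => y _.
  by rewrite /phi; congr (Num.max 0 _ * _)%:E; ring.
- exact: mW.
- exact: (mW v).
- by move=> x _; apply: (well_ge0 HW); exact: u1.
- by move=> x _; apply: (well_ge0 HW); exact: v1.
- exact: measurable_funTS.
- exact: measurable_funTS.
- apply: uleast => // x xO; rewrite /v min_l//; exact: out.
- move=> x _; rewrite -/(phi x) -/(v x).
  have g2 : u x <= 1 := proj2 (andP (u1 x)).
  have [h|h] := leP (u x) (phi x).
    have g0 : excess l x = 0 by rewrite /excess max_l// subr_le0.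
    rewrite -/(excess l x) g0 /v min_l// mulr0 mul0r add0r lerD2l; exact: Deq.
  have gE : excess l x = u x - phi x by rewrite /excess max_r// subr_ge0 ltW.
  rewrite -/(excess l x) /v (min_r (ltW h)).
  have := p0 x; rewrite /phi in gE h * => px.
  apply: Dgt; first by rewrite gE; lra.
  - by rewrite gE; ring.
  - by apply/andP; split; lra.
  - by rewrite gE; lra.
Qed.

(** A Caccioppoli-type bound for the De Giorgi iteration. With [g] and [psi] at most 2, the change
    of [W] costs at most [2 L] and the barrier at most [8 lam]. *)
Lemma excess_kinetic_le l : 0 <= l -> (kinetic_energy (excess l) <=
  (2 * (L + 4 * lam))%:E * mu [set x | (0 < excess l x)%R])%E.
Proof.
move=> l0; have L0 := well_lip_gt0 HW; have lam0 := well_lam_gt0 HW.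
have mg := measurable_excess l.
pose S := [set x | 0 < excess l x].
have mS : measurable S by exact: measurable_superlevel.
have SO : S `<=` Om by move=> x /(excess_ball l0) /BOm.
have C0 : 0 <= 2 * (L + 4 * lam) by rewrite mulr_ge0// addr_ge0 ?mulr_ge0// ltW.
have mD : measurable_fun setT (fun x => 2 * (L + 4 * lam) * 1 * \1_S x : R).
  by apply: measurable_funM => //; exact: measurable_indic.
have := @barrier_energy_le l (fun=> 0) (fun x => 2 * (L + 4 * lam) * 1 * \1_S x) l0.
rewrite integral0 adde0 (integral_scale_indic_in _ (f := fun=> 1))//.
rewrite integral_cst// mul1e; apply => //.
- by move=> x; rewrite mulr1 mulr_ge0.
- move=> x gx uE v1 g2; rewrite indicE mem_set// !mulr1 addr0.
  have := well_lip HW (u1 x) v1; rewrite distrC ger0_norm; last by rewrite uE; lra.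
  have t1 : tau * excess l x * psir x <= lam * excess l x * 2.
    apply: ler_pM => //; first by rewrite mulr_ge0// ltW.
    by rewrite ler_wpM2r// ltW.
  have t2 : lam * excess l x <= lam * 2 by rewrite ler_pM2l.
  have t3 : L * excess l x <= L * 2 by rewrite ler_pM2l.
  rewrite (_ : u x - (psir x - 1 + l) = excess l x); last by rewrite uE; ring.
  lra.
- by move=> x gx; rewrite mulr1 mulr_ge0.
Qed.

(** For [u <= th], [well_growth] absorbs [2 * tau * g * psi] and leaves [lam * g ^+ 2], which is at
    least [lam * del ^+ 2] on the set on the left. For [u > th], [W (psi - 1) <= L * psi] and
    [g <= 2] bound the loss by [(L + 4 * lam) * psi]. Level 0 matters: only there is the barrier at
    distance exactly [psi] from [-1]. *)
Lemma excess_level_le del : 0 < del ->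
  (kinetic_energy (excess 0) +
   (lam * del ^+ 2)%:E * mu [set x | (del < excess 0 x)%R /\ (u x <= th)%R] <=
   (L + 4 * lam)%:E *
     \int[mu]_(x in [set x | (th < u x)%R] `&` mball dist o rho) (psir x)%:E)%E.
Proof.
move=> del0; have L0 := well_lip_gt0 HW; have lam0 := well_lam_gt0 HW.
have mg := measurable_excess 0.
pose S := [set x | del < excess 0 x /\ u x <= th].
pose S' := [set x | th < u x] `&` mball dist o rho.
have mS : measurable S.
  rewrite (_ : S = [set x | del < excess 0 x] `&` [set x | u x <= th])//.
  by apply: measurableI; [exact: measurable_superlevel|exact: measurable_sublevel].
have mS' : measurable S' by apply: measurableI => //; exact: measurable_superlevel.
have SO : S `<=` Om.
  by move=> x [gx _]; apply/BOm/(@excess_ball 0) => //; exact: lt_trans gx.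
have S'O : S' `<=` Om by move=> x [_ /BOm].
have C0 : 0 <= L + 4 * lam by rewrite addr_ge0 ?mulr_ge0// ltW.
have ld0 : 0 <= lam * del ^+ 2 by rewrite mulr_ge0 ?sqr_ge0// ltW.
have := @barrier_energy_le 0 (fun x => lam * del ^+ 2 * 1 * \1_S x)
  (fun x => (L + 4 * lam) * psir x * \1_S' x) (lexx _).
rewrite (integral_scale_indic_in _ (f := fun=> 1))// integral_cst// mul1e.
rewrite integral_scale_indic_in//; apply => //.
- by apply: measurable_funM => //; exact: measurable_indic.
- apply: measurable_funM; first exact: measurable_funM.
  exact: measurable_indic.
- by move=> x; rewrite mulr1 mulr_ge0.
- by move=> x; rewrite !mulr_ge0.
- move=> x gx uE; rewrite addr0 => v1 g2; rewrite !indicE mulr1.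
  rewrite addr0 in uE.
  have lg0 : 0 <= lam * excess 0 x by apply: mulr_ge0; exact: ltW.
  have [ut|ut] := leP (u x) th.
    have -> : (x \in S') = false by apply/negP => /set_mem[/=]; rewrite ltNge ut.
    have := well_growth HW (proj1 (andP v1)) (_ : psir x - 1 <= u x) ut.
    have -> : u x - (psir x - 1) = excess 0 x by rewrite uE; ring.
    move=> /(_ ltac:(lra)) h.
    have t1 : tau * excess 0 x * psir x <= lam * excess 0 x * psir x.
      by rewrite ler_wpM2r// ler_wpM2r// ltW.
    have t2 : lam * del ^+ 2 * (x \in S)%:R <= lam * excess 0 x ^+ 2.
      have [/set_mem[/= gd _]|_] := boolP (x \in S); last by rewrite mulr0 mulr_ge0 ?sqr_ge0// ltW.
      rewrite mulr1 ler_pM2l//; apply: lerXn2r;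
        by rewrite ?nnegrE ?excess_ge0 ?(ltW gd) ?(ltW del0).
    rewrite mulr0 addr0; lra.
  have -> : (x \in S) = false by apply/negP => /set_mem[/= _]; rewrite leNgt ut.
  have -> : (x \in S') = true by apply: mem_set; split => //; exact: (@excess_ball 0).
  have m1 : -1 <= (-1 : R) <= 1 by rewrite lexx; lra.
  have := well_lip HW m1 v1; rewrite (well_zero HW) subr0.
  rewrite (_ : psir x - 1 - -1 = psir x); last by ring.
  rewrite ger0_norm// => h.
  have wu := well_ge0 HW (u1 x).
  have t1 : tau * excess 0 x * psir x <= lam * 2 * psir x.
    by rewrite ler_wpM2r// ler_pM// ltW.
  by rewrite mulr0 mulr1; lra.
- move=> x g0.
  have -> : \1_S x = 0 :> R.
    by rewrite indicE (_ : x \in S = false)//; apply/negP => /set_mem[/=]; rewrite g0 ltNge ltW.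
  by rewrite mulr0 !mulr_ge0.
Qed.

(** At depth [K] inside the ball the barrier [psi - 1] is at most [th], hence below [u] on the
    layer. There the gain is [W (u x) >= w], while the error [(L + 4 * lam) * psi] is paid on the
    whole ball. *)
Lemma transition_layer_le th2 w K : 0 <= w -> 0 < K -> M * K `^ (- (2 * s)) <= 1 + th ->
  (forall z, th <= z <= th2 -> w <= W z) ->
  (w%:E * mu [set x | [/\ (th < u x)%R, (u x <= th2)%R & (dist o x < rho - K)%R]] <=
   (L + 4 * lam)%:E * \int[mu]_(x in mball dist o rho) (psir x)%:E)%E.
Proof.
move=> w0 K0 KM wW; have L0 := well_lip_gt0 HW; have lam0 := well_lam_gt0 HW.
have mg := measurable_excess 0.
pose S := [set x | [/\ th < u x, u x <= th2 & dist o x < rho - K]].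
have SE : S = [set x | th < u x] `&` [set x | u x <= th2] `&` mball dist o (rho - K).
  by apply/seteqP; split => x /= => [[]|[[]]].
have mS : measurable S.
  rewrite SE; apply: measurableI; last exact: measurable_mball H _ _.
  by apply: measurableI; [exact: measurable_superlevel|exact: measurable_sublevel].
have SO : S `<=` Om by move=> x [_ _ xr]; apply: BOm; rewrite /mball/=; lra.
have Sg x : S x -> 0 < excess 0 x.
  move=> [tu _ xr]; have := psi_in_le s01 M0 K0 (ltW xr).
  rewrite /excess lt_max => h; apply/orP; right; lra.
have C0 : 0 <= L + 4 * lam by rewrite addr_ge0 ?mulr_ge0// ltW.
have := @barrier_energy_le 0 (fun x => w * 1 * \1_S x)
  (fun x => (L + 4 * lam) * psir x * \1_(mball dist o rho) x) (lexx _).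
rewrite (integral_scale_indic_in _ (f := fun=> 1))// integral_cst// mul1e.
rewrite integral_scale_indic_in// => h.
apply: le_trans (h _ _ _ _ _ _) => {h} //.
- by rewrite leeDr// (kinetic_energy_ge0 s H mOm).
- by apply: measurable_funM => //; exact: measurable_indic.
- apply: measurable_funM; first exact: measurable_funM.
  exact: measurable_indic.
- by move=> x; rewrite mulr1 mulr_ge0.
- by move=> x; rewrite !mulr_ge0.
- move=> x gx uE; rewrite addr0 => v1 g2; rewrite !indicE mulr1.
  have -> : (x \in mball dist o rho) = true by apply: mem_set; exact: (@excess_ball 0).
  have m1 : -1 <= (-1 : R) <= 1 by rewrite lexx; lra.
  have := well_lip HW m1 v1; rewrite (well_zero HW) subr0.
  rewrite (_ : psir x - 1 - -1 = psir x); last by ring.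
  rewrite ger0_norm// => h.
  have t1 : tau * excess 0 x * psir x <= lam * 2 * psir x.
    by rewrite ler_wpM2r// ler_pM// ltW.
  have t2 : w * (x \in S)%:R <= W (u x).
    have [/set_mem[/= tu ut _]|_] := boolP (x \in S).
      by rewrite mulr1; apply: wW; rewrite (ltW tu).
    by rewrite mulr0; exact: (well_ge0 HW (u1 x)).
  by rewrite mulr1; lra.
- move=> x g0.
  have -> : \1_S x = 0 :> R.
    by rewrite indicE (_ : x \in S = false)//; apply/negP => /set_mem/Sg; rewrite g0 ltxx.
  by rewrite mulr0 !mulr_ge0.
Qed.

End barrier_comparison.

(** * Initial density *)

Lemma le_geometric_eq0 {R : realType} (x : \bar R) (m t : R) :
  (0 <= x)%E -> 0 <= t < 1 -> (forall k, (x <= (m * t ^+ k)%:E)%E) -> x = 0.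
Proof.
move=> x0 /andP[t0 t1] h; apply/eqP; rewrite eq_le x0 andbT.
case: x x0 h => [y||]//; last by move=> _ /(_ 0%N).
rewrite !lee_fin => y0 h.
have tc : `|t| < 1 by rewrite ger0_norm.
have c := @cvg_geometric R m t tc.
rewrite -(cvg_lim (@norm_hausdorff _ _) c).
apply: limr_ge; first by apply/cvg_ex; exists 0.
by apply: nearW => k; have := h k; rewrite lee_fin.
Qed.

Section density.
Context {R : realType} {d : measure_display} {T : measurableType d}.
Variables (mu : {sigma_finite_measure set T -> \bar R}) (dist : T -> T -> R).
Variables (q a A s : R).
Hypothesis H : ahlfors_regular mu dist q a A.
Hypothesis s01 : 0 < s < 2^-1.
Variables (W : R -> R) (L lam th : R).
Hypothesis HW : well_bounds W L lam th.
Local Notation fkernel := (fkernel dist q s).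
Local Notation psi := (psi dist s).

Variables (M tau : R).
Hypotheses (M0 : 0 < M) (tau0 : 0 <= tau) (taulam : tau <= lam).
Hypothesis psi_super : forall o rho x, psi M o rho x < 2 ->
  (\int[mu]_y (Num.max 0 (psi M o rho y - psi M o rho x) * fkernel x y)%:E <=
   (tau * psi M o rho x)%:E)%E.
Local Notation excess := (excess dist s M).
Local Notation beta := (2 * s / q).
Local Notation minimizer_in u o r := (energy_minimizer mu dist q s W u (mball dist o r)).
Implicit Types (o : T) (u : T -> R) (r rho : R).

Lemma ball_measure_fin o r (S : set T) : measurable S -> S `<=` mball dist o r ->
  mu S = (fine (mu S))%:E.
Proof.
move=> mS SB; rewrite fineK// ge0_fin_numE ?measure_ge0//.
(* [r] may be nonpositive, but the regularity bound requires a positive radius. *)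
have r1 : 0 < Num.max 1 r by rewrite lt_max ltr01.
apply: (@le_lt_trans _ _ (mu (mball dist o (Num.max 1 r)))).
  apply: le_measure; rewrite ?inE//; first exact: measurable_mball H _ _.
  by move=> x /SB /= h; rewrite /mball /= (lt_le_trans h)// le_max lexx orbT.
by apply: (le_lt_trans (ahlfors_le H o r1)); rewrite ltry.
Qed.

Lemma beta_gt0 : 0 < beta.
Proof.
have [q0 _ _] := ahlfors_gt0 H; have /andP[s0 _] := s01.
by rewrite divr_gt0 ?mulr_gt0.
Qed.

Lemma isoperimetric_kinetic : exists2 c, 0 < c &
  forall o r (g : T -> R) (E E' : set T) eps m, measurable_fun setT g ->
    measurable E -> measurable E' -> E `<=` mball dist o r -> 0 <= eps ->
    (forall x y, E x -> ~ E' y -> eps <= `|g x - g y|) ->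
    0 < m -> (mu E' <= m%:E)%E ->
    ((c * eps ^+ 2 * m `^ (- beta))%:E * mu E <=
     kinetic_energy mu dist q s (mball dist o r) g)%E.
Proof.
have [c c0 Hc] := integral_kernel_setC_ge H s01.
exists (2^-1 * c); first by rewrite mulr_gt0 ?invr_gt0.
move=> o r g E E' eps m mg mE mE' EO eps0 gap m0 mE'm.
have -> : 2^-1 * c * eps ^+ 2 * m `^ (- beta) = 2^-1 * eps ^+ 2 * (c * m `^ (- beta)).
  by ring.
apply: (kinetic_energy_ge H (measurable_mball H o r) mg mE mE') => //.
  by rewrite mulr_ge0 ?powR_ge0// ltW.
by move=> x; exact: Hc.
Qed.

Lemma superlevel_excess o rho u l del : 0 <= del ->
  [set x | 0 < excess o rho u (l + del) x] = [set x | del < excess o rho u l x].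
Proof.
move=> del0; apply/seteqP; split => x /=; rewrite /excess !lt_max ltxx /=.
  by move=> h; apply/orP; right; lra.
by move=> /orP[]; lra.
Qed.

(** The levels [l k] rise from [del] towards [2 * del] with steps [eps = del * 2^(-k-1)]. The
    kinetic bound at level [l k] and the isoperimetric inequality across the step give [c eps^2
    m_k^(-beta) mu(S (k+1)) <= C2 m_k], which propagates [mu(S k) <= m_k = m0 t^k]. *)
Lemma de_giorgi del : 0 < del -> exists2 m0, 0 < m0 &
  forall o r rho u, rho <= r -> minimizer_in u o r ->
  (mu [set x | (0 < excess o rho u del x)%R] <= m0%:E)%E ->
  mu [set x | 0 < excess o rho u (2 * del) x] = 0.
Proof.
move=> del0; have [c c0 iso] := isoperimetric_kinetic; have b0 := beta_gt0.
have L0 := well_lip_gt0 HW; have lam0 := well_lam_gt0 HW.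
pose C2 := 2 * (L + 4 * lam).
have C20 : 0 < C2 by rewrite mulr_gt0// addr_gt0// mulr_gt0.
(* With [t^beta = 1/4], the decay of [m_k^beta] cancels the factor [4^(k+1)] in [eps^(-2)] up to a
   constant; [D = m0^beta] is then chosen so that one factor [t] remains. *)
pose t := (4 : R) `^ (- beta^-1).
have tb : t `^ beta = 4^-1.
  by rewrite /t -powRrM mulNr mulVf ?gt_eqF// powR_inv1.
have t0 : 0 < t by rewrite powR_gt0.
have t1 : t < 1.
  rewrite /t powRN invf_lt1 ?powR_gt0//.
  have := @gt0_ltr_powR R beta^-1 _ 1 4; rewrite powR1; apply; rewrite ?nnegrE ?invr_gt0//.
  by rewrite ltr1n.
pose D := c * del ^+ 2 * t / (4 * C2).
have D0 : 0 < D.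
  apply: divr_gt0; last exact: mulr_gt0.
  by apply: mulr_gt0 => //; apply: mulr_gt0 => //; exact: exprn_gt0.
pose m0 := D `^ beta^-1.
have m00 : 0 < m0 by rewrite powR_gt0.
have m0b : m0 `^ beta = D.
  by rewrite /m0 -powRrM mulVf ?gt_eqF// powRr1// ltW.
exists m0 => // o r rho u rr um small.
have [[meas_u u1] _ _] := um.
pose l k := del + del * (1 - 2^-1 ^+ k).
pose S k := [set x | 0 < excess o rho u (l k) x].
have h01 k : 0 < (2^-1 : R) ^+ k <= 1.
  by rewrite exprn_gt0 ?invr_gt0//= exprn_ile1 ?invr_ge0 ?invf_le1 ?ler1n.
have l0 k : 0 <= l k.
  by have /andP[h0 h1] := h01 k; rewrite addr_ge0 ?mulr_ge0 ?subr_ge0// ltW.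
have mex l' : measurable_fun setT (excess o rho u l') by exact: (measurable_excess H M rho um).
have mS k : measurable (S k) by exact: measurable_superlevel.
have step k : (mu (S k) <= (m0 * t ^+ k)%:E)%E.
  elim: k => [|k IH]; first by rewrite expr0 mulr1 /S /l expr0 subrr mulr0 addr0.
  have /andP[h0 h1] := h01 k.
  pose eps := del * 2^-1 ^+ k.+1.
  have eps0 : 0 < eps by rewrite mulr_gt0// exprn_gt0 ?invr_gt0.
  have lS : l k.+1 = l k + eps by rewrite /l /eps exprS; field.
  have SO : S k.+1 `<=` mball dist o r.
    move=> x xS; have := excess_ball um (l0 _) xS.
    by move=> /= h; exact: lt_le_trans h rr.
  pose m := m0 * t ^+ k.
  have m_gt0 : 0 < m by rewrite mulr_gt0// exprn_gt0.
  have gap x y : S k.+1 x -> ~ S k y ->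
      eps <= `|excess o rho u (l k) x - excess o rho u (l k) y|.
    rewrite /S /= lS -[X in X -> _]/([set x | 0 < excess o rho u (l k + eps) x] x).
    rewrite superlevel_excess ?(ltW eps0)//= => ex /negP; rewrite -leNgt => ey.
    have -> : excess o rho u (l k) y = 0.
      by apply/eqP; rewrite eq_le ey excess_ge0.
    by rewrite subr0 ger0_norm ?excess_ge0// ltW.
  have := iso o r _ _ _ _ _ (mex (l k)) (mS k.+1) (mS k) SO (ltW eps0) gap m_gt0 IH.
  have kin := excess_kinetic_le H HW M0 tau0 taulam psi_super rr um (l0 k).
  move=> /le_trans /(_ kin) Hk.
  have {}Hk := le_trans Hk (lee_wpmul2l _ IH : (C2%:E * _ <= _)%E).
  have {Hk} : ((c * eps ^+ 2 * m `^ (- beta))%:E * mu (S k.+1) <= C2%:E * m%:E)%E.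
    by apply: Hk; rewrite lee_fin ltW.
  have c'0 : 0 < c * eps ^+ 2 * m `^ (- beta).
    by rewrite !mulr_gt0// ?exprn_gt0// powR_gt0.
  rewrite -lee_pdivlMl// => /le_trans; apply.
  rewrite -!EFinM lee_fin le_eqVlt; apply/orP; left; apply/eqP.
  have mb : m `^ (- beta) = 4 ^+ k / D.
    rewrite powRN /m powRM ?exprn_ge0 ?(ltW m00) ?(ltW t0)// m0b powRX ?(ltW t0)// tb.
    by rewrite exprVn; field; rewrite !gt_eqF ?exprn_gt0.
  have p2 : (2 : R) ^+ k != 0 by rewrite expf_neq0.
  have E4 : (4 : R) ^+ k = (2 ^+ k) ^+ 2.
    by rewrite -exprM mulnC exprM; congr (_ ^+ _); ring.
  have E2 : (2^-1 : R) ^+ k.+1 = 2^-1 * (2 ^+ k)^-1 by rewrite exprS exprVn.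
  have tk : t ^+ k != 0 by rewrite expf_neq0// gt_eqF.
  rewrite mb /eps /D E2 E4 /m (exprS t k).
  move: (2 ^+ k) (t ^+ k) p2 tk => p w p2 tk; field.
  by rewrite p2 !gt_eqF.
apply: (@le_geometric_eq0 _ _ m0 t) => //; first by rewrite (ltW t0).
move=> k; apply: le_trans (step k); apply: le_measure; rewrite ?inE//.
  exact: measurable_superlevel.
move=> x; rewrite /S /= /excess !lt_max ltxx /= !subr_gt0; apply: le_lt_trans.
have /andP[h0 _] := h01 k.
have -> : l k = 2 * del - del * 2^-1 ^+ k by rewrite /l; ring.
by rewrite lerD2l gerBl mulr_ge0// ltW.
Qed.

End density.

Lemma powRN_small {R : realType} (M e p : R) : 0 < M -> 0 < e -> 0 < p ->
  exists2 K, 0 < K & M * K `^ (- p) <= e.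
Proof.
move=> M0 e0 p0; exists ((M / e) `^ p^-1); first by rewrite powR_gt0// divr_gt0.
rewrite -powRrM mulrN mulVf ?gt_eqF// powR_inv1; last by rewrite divr_ge0 ?ltW.
by rewrite invf_div mulrCA divff ?mulr1// gt_eqF.
Qed.

(** * Density at the initial scale and at a single scale *)

Section density.
Context {R : realType} {d : measure_display} {T : measurableType d}.
Variables (mu : {sigma_finite_measure set T -> \bar R}) (dist : T -> T -> R).
Variables (q a A s : R).
Hypothesis H : ahlfors_regular mu dist q a A.
Hypothesis s01 : 0 < s < 2^-1.
Variables (W : R -> R) (L lam th : R).
Hypothesis HW : well_bounds W L lam th.
Local Notation fkernel := (fkernel dist q s).
Local Notation psi := (psi dist s).

Variables (M tau : R).
Hypotheses (M0 : 0 < M) (tau0 : 0 <= tau) (taulam : tau <= lam).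
Hypothesis psi_super : forall o rho x, psi M o rho x < 2 ->
  (\int[mu]_y (Num.max 0 (psi M o rho y - psi M o rho x) * fkernel x y)%:E <=
   (tau * psi M o rho x)%:E)%E.
Local Notation excess := (excess dist s M).
Local Notation beta := (2 * s / q).
Local Notation minimizer_in u o r := (energy_minimizer mu dist q s W u (mball dist o r)).
Implicit Types (o : T) (u : T -> R) (r rho : R).

Lemma integral_psi_le o rho (S : set T) : measurable S ->
  (\int[mu]_(x in S) (psi M o rho x)%:E <= 2%:E * mu S)%E.
Proof.
move=> mS; rewrite -integral_cst//; apply: ge0_le_integral => //.
- by move=> x _; rewrite lee_fin psi_ge0.
- apply: measurable_funTS; apply: measurableT_comp => //.
  exact: (measurable_psi s H M o rho).
- by move=> x _; rewrite lee_fin psi_le2.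
Qed.

Lemma integral_psi_ge0 o rho (S : set T) : (0 <= \int[mu]_(x in S) (psi M o rho x)%:E)%E.
Proof. by apply: integral_ge0 => x _; rewrite lee_fin psi_ge0. Qed.

(** By contradiction: if [{th < u}] is small in the ball, [excess_level_le] makes the remaining part
    of [{g > del}] small as well, and De Giorgi gives [g <= 2 * del] almost everywhere. This
    excludes [u > th1] on a non-null part of the unit ball. *)
Lemma initial_density th1 : -1 < th1 -> exists2 p : R * R, 0 < p.1 /\ 0 < p.2 &
  forall o r u, p.1 <= r -> minimizer_in u o r ->
  (0 < mu (mball dist o 1%R `&` [set x | (th1 < u x)%R]))%E ->
  (p.2%:E <= mu ([set x | (th < u x)%R] `&` mball dist o p.1))%E.
Proof.
move=> th1m; have /andP[s0 s1] := s01.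
have L0 := well_lip_gt0 HW; have lam0 := well_lam_gt0 HW.
(* The unit ball has depth [K] in the ball of radius [1 + K], so [psi <= 2 * del] there, and
   [u > th1] gives an excess above [8 * del - 2 * del], more than [2 * del]. *)
pose del := (1 + th1) / 8; have del0 : 0 < del by rewrite /del; lra.
have [K K0 HK] := @powRN_small _ M (2 * del) (2 * s) M0
  (mulr_gt0 (ltr0Sn R 1) del0) (mulr_gt0 (ltr0Sn R 1) s0).
have [m0 m00 DG] := de_giorgi H s01 HW M0 tau0 taulam psi_super del0.
pose C1 := L + 4 * lam; have C10 : 0 < C1 by rewrite addr_gt0// mulr_gt0.
pose B := 2 * C1 / (lam * del ^+ 2) + 1.
have ld0 : 0 < lam * del ^+ 2 by rewrite mulr_gt0// exprn_gt0.
have B0 : 0 < B by rewrite addr_gt0// divr_gt0// mulr_gt0.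
exists (1 + K, m0 / B) => /=; first by rewrite addr_gt0// divr_gt0.
move=> o r u Kr um pos; set rho := 1 + K in Kr *.
have [[meas_u u1] _ _] := um.
have mex l' : measurable_fun setT (excess o rho u l') by exact: (measurable_excess H M rho um).
pose U := [set x | th < u x] `&` mball dist o rho.
have mU : measurable U.
  by apply: measurableI; [exact: measurable_superlevel|exact: measurable_mball H _ _].
pose S := [set x | del < excess o rho u 0 x /\ u x <= th].
have mS : measurable S.
  rewrite (_ : S = [set x | del < excess o rho u 0 x] `&` [set x | u x <= th])//.
  by apply: measurableI; [exact: measurable_superlevel|exact: measurable_sublevel].
have exB : forall x, del < excess o rho u 0 x -> mball dist o rho x.
  by move=> x h; apply: (excess_ball um (lexx 0)); exact: lt_trans h.
have := excess_level_le H HW M0 tau0 taulam psi_super Kr um del0.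
have SE := @ball_measure_fin _ _ _ _ _ _ _ _ H o rho S mS (fun x h => exB x h.1).
have UE := @ball_measure_fin _ _ _ _ _ _ _ _ H o rho U mU (fun x h => h.2).
rewrite -/U -/S -/C1 => lev.
have {lev} : ((lam * del ^+ 2)%:E * mu S <= C1%:E * (2%:E * mu U))%E.
  apply: le_trans (_ : _ <= C1%:E * \int[mu]_(x in U) (psi M o rho x)%:E)%E _.
    apply: le_trans lev; rewrite leeDr// (kinetic_energy_ge0 s H)//.
    exact: measurable_mball H _ _.
  by rewrite lee_wpmul2l ?lee_fin ?(ltW C10)// integral_psi_le.
rewrite SE UE -!EFinM lee_fin => lev.
rewrite leNgt; apply/negP; rewrite -/U UE lte_fin => small.
have Sle : (mu [set x | (0 < excess o rho u del x)%R] <= m0%:E)%E.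
  have := superlevel_excess dist s M o rho u 0 (ltW del0); rewrite add0r => ->.
  apply: (@le_trans _ _ (mu (S `|` U))).
    apply: le_measure; rewrite ?inE//; [exact: measurable_superlevel|exact: measurableU|].
    move=> x /= h; have [uth|uth] := leP (u x) th; first by left.
    by right; split => //; exact: exB.
  apply: (@le_trans _ _ (mu S + mu U)%E); first exact: measureU2.
  rewrite SE UE -EFinD lee_fin.
  have : fine (mu S) <= 2 * C1 / (lam * del ^+ 2) * fine (mu U).
    by rewrite mulrAC ler_pdivlMr// [leLHS]mulrC; apply: (le_trans lev); rewrite mulrCA mulrA.
  move: small; rewrite ltr_pdivlMr// /B => /ltW small h.
  by apply: le_trans small; rewrite mulrDr mulr1 lerD2r mulrC.
have := DG _ _ _ _ Kr um Sle.
move=> null; move: pos; rewrite ltNge => /negP; apply.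
rewrite -null; apply: le_measure; rewrite ?inE.
- by apply: measurableI; [exact: measurable_mball H _ _|exact: measurable_superlevel].
- exact: measurable_superlevel.
move=> x [/= xo xth]; rewrite /excess lt_max; apply/orP; right.
have : psi M o rho x <= M * K `^ (- (2 * s)).
  by apply: psi_in_le => //; rewrite /rho; move: xo; rewrite /mball /=; lra.
move: HK; rewrite /del; lra.
Qed.

Variable K : R.
Hypotheses (K0 : 0 < K) (MK : M * K `^ (- (2 * s)) <= (1 + th) / 2).

(** Let [J] be the integral on the right. The set [{g > del}] is covered by [E] of measure [X], by
    [S] where the potential gains, and by the part [G] of the collar of width [K] where [u > th];
    the last two have measure at most [C4 * J]. Either [X < C4 * J], or [{g > del}] has measure at
    most [2 * X] and the isoperimetric inequality bounds [X^(1 - beta)]. Hence the minimum. *)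
Lemma single_scale_density : exists2 C, 0 < C &
  forall o r rho u, rho <= r -> minimizer_in u o r ->
  let X := fine (mu ([set x | th < u x] `&` mball dist o (rho - K))) in
  ((Num.min X (X `^ (1 - beta)))%:E <= C%:E *
    \int[mu]_(x in [set x | (th < u x)%R] `&` mball dist o rho) (psi M o rho x)%:E)%E.
Proof.
have /andP[s0 s1] := s01; have b0 : 0 < beta := beta_gt0 H s01.
have L0 := well_lip_gt0 HW; have lam0 := well_lam_gt0 HW.
have /andP[th0 th1] := well_th HW.
have [c c0 iso] := isoperimetric_kinetic H s01.
(* On [E] the excess is at least [th + 1 - (1 + th) / 2 = 2 * del], a gap of [del] above its values
   outside [E']. *)
pose del := (1 + th) / 4; have del0 : 0 < del by rewrite /del; lra.
pose C1 := L + 4 * lam; have C10 : 0 < C1 by rewrite addr_gt0// mulr_gt0.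
have ld0 : 0 < lam * del ^+ 2 by rewrite mulr_gt0// exprn_gt0.
(* A lower bound for [psi] on the collar, where the distance to the sphere is at most [K]. *)
pose c' := Num.min 2 (M * K `^ (- (2 * s))).
have c'0 : 0 < c' by rewrite lt_min ltr0n mulr_gt0// powR_gt0.
pose C4 := C1 / (lam * del ^+ 2) + c'^-1.
have C40 : 0 < C4 by rewrite addr_gt0 ?divr_gt0 ?invr_gt0.
pose C5 := C1 * 2 `^ beta / (c * del ^+ 2).
have cd0 : 0 < c * del ^+ 2 by rewrite mulr_gt0// exprn_gt0.
have C50 : 0 < C5 by rewrite divr_gt0// mulr_gt0// powR_gt0.
exists (C4 + C5); first exact: addr_gt0.
move=> o r rho u rr um.
have [[meas_u u1] _ _] := um.
have mg : measurable_fun setT (excess o rho u 0) by exact: (measurable_excess H M rho um).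
have mB := measurable_mball H o.
pose U := [set x | th < u x].
have mU : measurable U by exact: measurable_superlevel.
pose E := U `&` mball dist o (rho - K); have mE : measurable E by exact: measurableI.
pose F := U `&` mball dist o rho; have mF : measurable F by exact: measurableI.
pose S := [set x | del < excess o rho u 0 x /\ u x <= th].
have mS : measurable S.
  rewrite (_ : S = [set x | del < excess o rho u 0 x] `&` [set x | u x <= th])//.
  by apply: measurableI; [exact: measurable_superlevel|exact: measurable_sublevel].
pose E' := [set x | del < excess o rho u 0 x].
have mE' : measurable E' by exact: measurable_superlevel.
have exB : forall x, del < excess o rho u 0 x -> mball dist o rho x.
  by move=> x h; apply: (excess_ball um (lexx 0)); exact: lt_trans h.
have EB : E `<=` mball dist o rho.
  by move=> x [_ xE]; apply: lt_le_trans xE _; rewrite gerBl ltW.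
have BO : mball dist o rho `<=` mball dist o r by move=> x /= h; exact: lt_le_trans h rr.
have SE := @ball_measure_fin _ _ _ _ _ _ _ _ H o rho S mS (fun x h => exB x h.1).
have EE := @ball_measure_fin _ _ _ _ _ _ _ _ H o rho E mE EB.
have FE := @ball_measure_fin _ _ _ _ _ _ _ _ H o rho F mF (fun x h => h.2).
have mpsi := measurable_psi s H M o rho.
set I := (\int[mu]_(x in F) (psi M o rho x)%:E)%E.
have I0 : (0 <= I)%E by exact: integral_psi_ge0.
have IE : I = (fine I)%:E.
  rewrite fineK// ge0_fin_numE//; apply: le_lt_trans (integral_psi_le o rho mF) _.
  by rewrite FE -EFinM ltry.
set X := fine (mu E); set J := fine I.
have X0 : 0 <= X by exact: fine_ge0.
have J0 : 0 <= J by exact: fine_ge0.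
change ((Num.min X (X `^ (1 - beta)))%:E <= (C4 + C5)%:E * I)%E.
rewrite IE -/J -EFinM lee_fin.
have := excess_level_le H HW M0 tau0 taulam psi_super rr um del0.
rewrite -/S -/U -/F -/I -/C1 => lev.
have mO : measurable (mball dist o r) by [].
have kin0 := kinetic_energy_ge0 s H mO mg.
have levS : fine (mu S) <= C1 / (lam * del ^+ 2) * J.
  rewrite mulrAC ler_pdivlMr// mulrC -lee_fin !EFinM -SE -IE.
  by apply: le_trans lev; rewrite leeDr.
have levK : (kinetic_energy mu dist q s (mball dist o r) (excess o rho u 0) <= (C1 * J)%:E)%E.
  rewrite EFinM -IE; apply: le_trans lev; rewrite leeDl// mule_ge0// lee_fin ltW//.
pose G := F `\` E; have mG : measurable G by exact: measurableD.
have GE := @ball_measure_fin _ _ _ _ _ _ _ _ H o rho G mG (fun x h => h.1.2).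
have levG : fine (mu G) <= c'^-1 * J.
  rewrite mulrC ler_pdivlMr// mulrC -lee_fin EFinM -GE -IE.
  apply: (@le_trans _ _ (\int[mu]_(x in G) (psi M o rho x)%:E)%E).
    rewrite -integral_cst//; apply: ge0_le_integral => //.
    - by move=> x _; rewrite lee_fin ltW.
    - by apply: measurable_funTS; exact: measurableT_comp.
    move=> x [[Ux xr] nE]; rewrite lee_fin /psi ifT//.
    have xK : rho - dist o x <= K.
      by rewrite leNgt; apply/negP => h; apply: nE; split => //; rewrite /mball /=; lra.
    rewrite le_min /c' !ge_min lexx /=; apply/orP; right.
    rewrite ler_pM2l//; apply: powRN_le => //; first by rewrite mulr_ge0// ltW.
    by rewrite subr_gt0.
  apply: ge0_subset_integral => //.
  - by apply: measurable_funTS; exact: measurableT_comp.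
  - by move=> x _; rewrite lee_fin psi_ge0.
  - by move=> x [].
have E'le : (mu E' <= (X + C4 * J)%:E)%E.
  apply: (@le_trans _ _ (mu (E `|` (S `|` G)))).
    apply: le_measure; rewrite ?inE//.
      by apply: measurableU => //; exact: measurableU.
    move=> x /= h; have [uth|uth] := leP (u x) th; first by right; left.
    have [xE|xE] := pselect (E x); first by left.
    by right; right; split => //; split => //; exact: exB.
  apply: (@le_trans _ _ (mu E + (mu S + mu G))%E).
    apply: le_trans (leeD (lexx (mu E)) (measureU2 mu mS mG)).
    by apply: measureU2 => //; exact: measurableU.
  by rewrite SE EE GE -!EFinD lee_fin lerD2l /C4 mulrDl lerD.
have [JX|XJ] := leP (C4 * J) X; last first.
  rewrite ge_min; apply/orP; left; apply: (le_trans (ltW XJ)).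
  by rewrite ler_wpM2r// lerDl ltW.
have [X00|Xp] := eqVneq X 0; first by rewrite X00 ge_min mulr_ge0// addr_ge0 ?ltW.
have {}Xp : 0 < X by rewrite lt_neqAle eq_sym Xp.
have gap x y : E x -> ~ E' y -> del <= `|excess o rho u 0 x - excess o rho u 0 y|.
  move=> [xU xK] /negP; rewrite -leNgt => ey.
  have px : psi M o rho x <= M * K `^ (- (2 * s)).
    by apply: psi_in_le => //; rewrite ltW.
  have ex : 2 * del <= excess o rho u 0 x.
    rewrite /excess le_max; apply/orP; right; move: xU MK px; rewrite /U /= /del; lra.
  by apply: le_trans (ler_norm _); lra.
have E'2 : (mu E' <= (2 * X)%:E)%E by apply: (le_trans E'le); rewrite lee_fin; lra.
have := iso o r _ E E' del (2 * X) mg mE mE' (subset_trans EB BO) (ltW del0) gap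
  (mulr_gt0 (ltr0Sn R 1) Xp) E'2.
move=> /le_trans /(_ levK); rewrite EE -/X -EFinM lee_fin => main.
rewrite ge_min; apply/orP; right.
apply: (@le_trans _ _ (C5 * J)); last by rewrite ler_wpM2r// lerDr ltW.
have X2 : 0 < (2 * X) `^ beta by rewrite powR_gt0// mulr_gt0.
have -> : C5 * J = C1 * 2 `^ beta * J / (c * del ^+ 2) by rewrite /C5; ring.
rewrite ler_pdivlMr//.
rewrite powRB; last by rewrite (gt_eqF Xp) implybT.
rewrite powRr1//.
have XB : 0 < X `^ beta by rewrite powR_gt0.
have B2 : 0 < (2 : R) `^ beta by rewrite powR_gt0.
move: main; rewrite powRN powRM ?(ltW Xp)// => main.
have -> : X / X `^ beta * (c * del ^+ 2) =
    2 `^ beta * (c * del ^+ 2 * (2 `^ beta * X `^ beta)^-1 * X).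
  by field; rewrite !gt_eqF.
have -> : C1 * 2 `^ beta * J = 2 `^ beta * (C1 * J) by ring.
by rewrite ler_pM2l.
Qed.

End density.

(** * Growth of the density *)

(** Concavity of the power, obtained from Young's inequality for [t^e] and 1 with exponents [1/e]
    and [1/(1 - e)]. *)
Lemma powR_tangent {R : realType} (t e : R) : 0 <= t -> 0 < e < 1 ->
  t `^ e <= 1 - e * (1 - t).
Proof.
move=> t0 /andP[e0 e1].
have := @conjugate_powR R (t `^ e) 1 e^-1 (1 - e)^-1 (powR_ge0 _ _) ler01.
rewrite !invr_gt0 subr_gt0 !invrK => /(_ e0 e1 (subrKC _ _)).
rewrite -powRrM divff ?gt_eqF// powRr1// powR1 mulr1 mul1r; lra.
Qed.

(** The tangent to the power [1 - p] at [N + 1] bounds each term by an increment of the right side,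
    which telescopes. *)
Lemma sum_powRN_le {R : realType} (p : R) N : 0 < p < 1 ->
  \sum_(1 <= j < N.+1) j%:R `^ (- p) <= N%:R `^ (1 - p) / (1 - p).
Proof.
move=> /andP[p0 p1]; elim: N => [|N IH].
  by rewrite big_geq// divr_ge0 ?powR_ge0// subr_ge0 ltW.
rewrite big_nat_recr//=; set x : R := N.+1%:R.
have x0 : 0 < x by rewrite ltr0n.
have e0 : 0 < 1 - p by rewrite subr_gt0.
apply: le_trans (lerD IH (lexx _)) _.
rewrite ler_pdivlMr// mulrDl divfK ?gt_eqF//.
have NE : (N%:R : R) = x * (N%:R / x) by rewrite mulrCA divff ?mulr1// gt_eqF.
have Nx : 0 <= N%:R / x by rewrite divr_ge0// ltW.
rewrite {1}NE powRM ?(ltW x0)//.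
have e01 : 0 < 1 - p < 1 by rewrite e0/= gtrBl.
have := ler_wpM2l (powR_ge0 x (1 - p)) (powR_tangent Nx e01).
have -> : 1 - N%:R / x = x^-1 by rewrite /x -natr1; field; rewrite natr1 pnatr_eq0.
have -> : x `^ (- p) = x `^ (1 - p) * x^-1.
  rewrite -[in RHS](powR_inv1 (ltW x0)) -powRD; last by rewrite (gt_eqF x0) implybT.
  by congr (_ `^ _); ring.
move: (x `^ (1 - p)) => y h; apply: le_trans (lerD h (lexx _)) _.
by rewrite le_eqVlt; apply/orP; left; apply/eqP; ring.
Qed.

(** Used with [y = x^q], [z = x^(2s)], [Q = 4^q], [V] and [V'] the volumes at [x] and [4 x]. If
    [V <= V^(1 - be)], the size of [z] gives the factor [k Q]. Otherwise compare [V] with [b y]: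
    below it, [V^(-be) z >= c k Q] gives the same factor; above it, monotonicity of the power
    [1 - be] gives density [b] at the next scale. The choice of [b] makes both thresholds agree. *)
Lemma growth_dichotomy {R : realType} (c be V V' k Q b y z : R) :
  0 < c -> 0 < be <= 1 -> 0 <= V -> 1 <= k -> 0 < Q -> 0 < b -> 0 < y -> 0 < z ->
  b `^ (- be) = c * k * Q -> y `^ (- be) * z = 1 -> c * k * Q <= z ->
  z * Num.min V (V `^ (1 - be)) <= c * V' ->
  b * (Q * y) <= V' \/ k * Q * V <= V'.
Proof.
move=> c0 /andP[be0 be1] V0 k1 Q0 b0 y0 z0 bb yz zbig step.
have k0 : 0 < k by exact: lt_le_trans k1.
have powE t : 0 < t -> t `^ (1 - be) = t * t `^ (- be).
  by move=> t0; rewrite powRD ?powRr1 ?(ltW t0)// (gt_eqF t0) implybT.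
have byE : (b * y) `^ (- be) * z = c * k * Q.
  by rewrite (powRM _ (ltW b0) (ltW y0)) -mulrA yz mulr1.
have by0 : 0 < b * y by rewrite mulr_gt0.
have [VV|VV] := leP V (V `^ (1 - be)).
  right; rewrite -(ler_pM2l c0); apply: le_trans step; rewrite min_l//.
  have -> : c * (k * Q * V) = c * k * Q * V by ring.
  exact: ler_wpM2r.
move: step; rewrite min_r ?(ltW VV)// => step.
have Vp : 0 < V by apply: le_lt_trans VV; exact: powR_ge0.
have [Vb|Vb] := leP V (b * y).
  right; rewrite -(ler_pM2l c0); apply: le_trans step.
  have h : c * k * Q <= V `^ (- be) * z.
    by rewrite -byE ler_wpM2r ?(ltW z0)//; apply: powRN_le => //; exact: ltW.
  rewrite (powE _ Vp).
  have -> : c * (k * Q * V) = c * k * Q * V by ring.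
  have -> : z * (V * V `^ (- be)) = V `^ (- be) * z * V by ring.
  exact: ler_wpM2r.
left; rewrite -(ler_pM2l c0); apply: le_trans step.
have mono : (b * y) `^ (1 - be) <= V `^ (1 - be).
  by apply: ge0_ler_powR; rewrite ?subr_ge0 ?nnegrE ?(ltW Vp) ?(ltW by0) ?(ltW Vb).
apply: le_trans (ler_wpM2l (ltW z0) mono).
rewrite (powE _ by0).
have -> : z * (b * y * (b * y) `^ (- be)) = b * y * ((b * y) `^ (- be) * z) by ring.
rewrite byE.
have -> : c * (b * (Q * y)) = b * y * (c * 1 * Q) by ring.
apply: ler_wpM2l; first exact: ltW.
by apply: ler_wpM2r; [exact: ltW|rewrite ler_pM2l].
Qed.

(** Once density [b] is reached it persists, since [k * 4^q >= 4^q]. Until then [V(x) / x^q] gains a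
    factor [k] per scale, so [j0] scales suffice to pass [b]. *)
Lemma growth_iteration {R : realType} (k b q m r0 : R) : 1 < k -> 0 < b -> 0 < q ->
  0 < m -> 0 < r0 ->
  exists2 r1, 0 < r1 & forall (V : R -> R) r, r1 <= r ->
    {homo V : x y / x <= y} -> m <= V r0 ->
    (forall x, r0 <= x -> 4 * x <= r ->
       b * (4 * x) `^ q <= V (4 * x) \/ k * 4 `^ q * V x <= V (4 * x)) ->
    b * r `^ q <= V r.
Proof.
move=> k1 b0 q0 m0 r00.
have Q0 : 0 < (4 : R) `^ q by rewrite powR_gt0.
have Q1 : 1 <= (4 : R) `^ q by rewrite -[leLHS](powRr0 4) ler_powR ?ler1n// ltW.
have k0 : 0 < k by exact: lt_trans k1.
(* Bernoulli: [j (k - 1) <= k^j]. The radius [4 * r0] is the largest possible starting point. *)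
have [j0 Hj0] : exists j, b * (4 * r0) `^ q <= k ^+ j * m.
  have [j Hj] : exists j, b * (4 * r0) `^ q / m / (k - 1) <= j%:R.
    by exists (Num.truncn (b * (4 * r0) `^ q / m / (k - 1))).+1; rewrite ltW// truncnS_gt.
  exists j; rewrite -ler_pdivrMr//; apply: le_trans (_ : j%:R * (k - 1) <= _).
    by rewrite -ler_pdivrMr// subr_gt0.
  elim: j {Hj} => [|j IH]; first by rewrite mul0r expr0.
  have kj : 1 <= k ^+ j by rewrite exprn_ege1// ltW.
  rewrite exprS -natr1; nra.
exists (4 ^+ j0 * r0); first by rewrite mulr_gt0// exprn_gt0.
move=> V r rbig Vmono Vm step.
have r_gt0 : 0 < r by apply: lt_le_trans rbig; rewrite mulr_gt0// exprn_gt0.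
have iter x j : r0 <= x -> 4 ^+ j * x <= r ->
    b * (4 ^+ j * x) `^ q <= V (4 ^+ j * x) \/ (k * 4 `^ q) ^+ j * V x <= V (4 ^+ j * x).
  move=> xr; have x0 : 0 < x by exact: lt_le_trans xr.
  elim: j => [|j IH] jr; first by right; rewrite !expr0 !mul1r.
  have p4 : 1 <= (4 : R) ^+ j by rewrite exprn_ege1// ler1n.
  have y0 : 0 < 4 ^+ j * x by rewrite mulr_gt0// exprn_gt0.
  have E : 4 ^+ j.+1 * x = 4 * (4 ^+ j * x) by rewrite exprS mulrA.
  have xy : r0 <= 4 ^+ j * x by apply: (le_trans xr); rewrite ler_peMl// ltW.
  have jr' : 4 ^+ j * x <= r by apply: le_trans jr; rewrite E ler_peMl ?ler1n// ltW.
  rewrite E in jr *; have [h|h] := step _ xy jr; first by left.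
  have kQ : 0 <= k * 4 `^ q by rewrite mulr_ge0 ?ltW.
  case: (IH jr') => h'.
    left; apply: le_trans h; apply: le_trans (ler_wpM2l kQ h').
    have -> : (4 * (4 ^+ j * x)) `^ q = 4 `^ q * (4 ^+ j * x) `^ q.
      by rewrite powRM// ltW.
    move: (_ `^ q) Q0 (powR_ge0 (4 ^+ j * x) q) => Q Q0 z0.
    have -> : k * Q * (b * (4 ^+ j * x) `^ q) = k * (b * (Q * (4 ^+ j * x) `^ q)) by ring.
    by rewrite ler_peMl ?(ltW k1)// !mulr_ge0// ltW.
  right; apply: le_trans h; rewrite exprS -mulrA.
  exact: ler_wpM2l.
have [j [Hj1 Hj2 Hj3]] : exists j, [/\ (j0 <= j)%N, 4 ^+ j * r0 <= r & r < 4 ^+ j.+1 * r0].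
  have HE : exists j, r < 4 ^+ j * r0.
    exists (Num.truncn (r / r0)).+1; rewrite -ltr_pdivrMr//.
    apply: (lt_le_trans (truncnS_gt _)); rewrite -natrX ler_nat ltnW// ltn_expl//.
  case: (ex_minnP HE) => -[|j] rj Hmin.
    move: (le_lt_trans rbig rj); rewrite ltr_pM2r// expr0.
    by rewrite ltNge exprn_ege1// ler1n.
  exists j; split => //.
  - rewrite leqNgt; apply/negP => jj; move: (le_lt_trans rbig rj).
    by rewrite ltr_pM2r// ltNge ler_weXn2l// ler1n.
  - by rewrite leNgt; apply/negP => /Hmin; rewrite ltnn.
(* Starting from this [x] in [[r0, 4 r0]] instead of [r0], the iteration ends exactly at [r]. *)
pose x := r / 4 ^+ j.
have p4 : 0 < (4 : R) ^+ j by rewrite exprn_gt0.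
have xE : 4 ^+ j * x = r by rewrite /x mulrCA divff ?mulr1// gt_eqF.
have xr0 : r0 <= x by rewrite /x ler_pdivlMr// mulrC.
have xr1 : x <= 4 * r0 by rewrite /x ler_pdivrMr// mulrAC -exprS ltW.
have x0 : 0 < x by exact: lt_le_trans xr0.
have := iter x j xr0; rewrite xE => /(_ (lexx _))[//|]; apply: le_trans.
have mV : m <= V x by apply: (le_trans Vm); exact: Vmono.
rewrite -[in leLHS]xE powRM ?(ltW p4) ?(ltW x0)// powRX// exprMn.
rewrite mulrCA (mulrC (k ^+ j)) -mulrA ler_wpM2l ?exprn_ge0 ?(ltW Q0)//.
apply: (@le_trans _ _ (k ^+ j * m)); last by rewrite ler_wpM2l ?exprn_ge0 ?(ltW k0).
apply: (@le_trans _ _ (k ^+ j0 * m)); last first.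
  by rewrite ler_wpM2r ?(ltW m0)// ler_weXn2l ?(ltW k1).
apply: le_trans Hj0; rewrite ler_wpM2l ?(ltW b0)//.
apply: ge0_ler_powR; [exact: ltW| | |exact: xr1]; rewrite nnegrE; first exact: ltW.
by rewrite mulr_ge0// ltW.
Qed.

(** * Summation over unit layers *)

Section density_growth.
Context {R : realType} {d : measure_display} {T : measurableType d}.
Variables (mu : {sigma_finite_measure set T -> \bar R}) (dist : T -> T -> R).
Variables (q a A s : R).
Hypothesis H : ahlfors_regular mu dist q a A.
Hypothesis s01 : 0 < s < 2^-1.
Hypothesis q1 : 1 <= q.
Variables (W : R -> R) (L lam th : R).
Hypothesis HW : well_bounds W L lam th.
Local Notation fkernel := (fkernel dist q s).
Local Notation psi := (psi dist s).

Variables (M tau : R).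
Hypotheses (M0 : 0 < M) (tau0 : 0 <= tau) (taulam : tau <= lam).
Hypothesis psi_super : forall o rho x, psi M o rho x < 2 ->
  (\int[mu]_y (Num.max 0 (psi M o rho y - psi M o rho x) * fkernel x y)%:E <=
   (tau * psi M o rho x)%:E)%E.
Local Notation beta := (2 * s / q).
Local Notation minimizer_in u o r := (energy_minimizer mu dist q s W u (mball dist o r)).
Implicit Types (o : T) (u : T -> R) (r rho : R).

(** Balls missing [x] contribute 0, so the first radius can be raised until its ball contains [x].
    From then on the first term is at most 2 and the [j]-th later one at most [M j^(-2s)], since [x]
    has depth at least [j]. *)
Lemma sum_psi_le o rho x N :
  \sum_(0 <= i < N) psi M o (rho + i%:R) x * \1_(mball dist o (rho + i%:R)) x <=
  2 + M * \sum_(1 <= j < N) j%:R `^ (- (2 * s)).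
Proof.
have S0 k : 0 <= \sum_(1 <= j < k) (j%:R : R) `^ (- (2 * s)).
  by apply: sumr_ge0 => j _; rewrite powR_ge0.
elim: N rho => [|N IH] rho.
  by rewrite big_geq// addr_ge0// mulr_ge0// ltW.
rewrite big_ltn// addr0.
have [xr|xr] := ltP (dist o x) rho.
  apply: lerD.
    rewrite indicE; case: (_ \in _); rewrite ?mulr1 ?mulr0//; exact: psi_le2.
  rewrite mulr_sumr !big_nat; apply: ler_sum => i /andP[i1 iN].
  have i0 : 0 < i%:R :> R by rewrite ltr0n.
  apply: (@le_trans _ _ (psi M o (rho + i%:R) x)).
    by rewrite indicE; case: (_ \in _); rewrite ?mulr1 ?mulr0// psi_ge0.
  by apply: psi_in_le => //; lra.
have -> : \1_(mball dist o rho) x = 0 :> R.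
  rewrite indicE; case: (boolP (x \in _)) => // /set_mem; rewrite /mball /=.
  by rewrite ltNge xr.
rewrite mulr0 add0r big_add1/=.
have -> : \sum_(0 <= i < N) psi M o (rho + i.+1%:R) x * \1_(mball dist o (rho + i.+1%:R)) x =
    \sum_(0 <= i < N) psi M o (rho + 1 + i%:R) x * \1_(mball dist o (rho + 1 + i%:R)) x.
  by apply: eq_bigr => i _; rewrite -addrA -natr1 (addrC i%:R).
apply: (le_trans (IH (rho + 1))); rewrite lerD2l ler_pM2l//.
case: N {IH} => [|N]; first by rewrite big_geq// S0.
by rewrite [leRHS]big_nat_recr//= lerDl powR_ge0.
Qed.

Definition layer_const := 2 + M / (1 - 2 * s).

Lemma layer_const_gt0 : 0 < layer_const.
Proof.
by have /andP[s0 s1] := s01; rewrite addr_gt0// divr_gt0//; lra.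
Qed.

Lemma sum_psi_integral_le o rho N (S : set T) : (0 < N)%N -> measurable S ->
  (\sum_(0 <= i < N) \int[mu]_(x in S `&` mball dist o (rho + i%:R)%R)
      (psi M o (rho + i%:R)%R x)%:E <=
   (layer_const * N%:R `^ (1 - 2 * s))%:E * mu (S `&` mball dist o (rho + N%:R)%R))%E.
Proof.
move=> N0 mS; have /andP[s0 s1] := s01.
have mB := measurable_mball H o.
pose D := S `&` mball dist o (rho + N%:R); have mD : measurable D by exact: measurableI.
pose f i x := 1 * psi M o (rho + i%:R) x * \1_(S `&` mball dist o (rho + i%:R)) x.
have mSi i : measurable (S `&` mball dist o (rho + i%:R)) by exact: measurableI.
have mf i : measurable_fun D (fun x => (f i x)%:E).
  apply: measurable_funTS; apply: measurableT_comp => //; apply: measurable_funM.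
    by apply: measurable_funM => //; exact: (measurable_psi s H).
  exact: measurable_indic.
have f0 i x : 0 <= f i x by rewrite /f mul1r mulr_ge0 ?psi_ge0// indicE.
have -> : (\sum_(0 <= i < N) \int[mu]_(x in S `&` mball dist o (rho + i%:R)%R)
      (psi M o (rho + i%:R)%R x)%:E = \sum_(0 <= i < N) \int[mu]_(x in D) (f i x)%:E)%E.
  rewrite !big_nat; apply: eq_bigr => i /andP[_ iN].
  rewrite integral_scale_indic_in ?mul1e//; first by move=> x; exact: psi_ge0.
    exact: (measurable_psi s H).
  move=> x [xS xB]; split=> //; apply: lt_le_trans xB _.
  by rewrite lerD2l ler_nat ltnW.
rewrite -ge0_integral_sum//; last by move=> i x _; rewrite lee_fin.
rewrite -integral_cst//; apply: ge0_le_integral => //.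
- by move=> x _; apply: sume_ge0 => i _; rewrite lee_fin.
- by apply: emeasurable_sum => i; exact: mf.
move=> x [xS _]; rewrite sumEFin lee_fin.
have -> : \sum_(0 <= i < N) f i x =
    \sum_(0 <= i < N) psi M o (rho + i%:R) x * \1_(mball dist o (rho + i%:R)) x.
  by apply: eq_bigr => i _; rewrite /f mul1r !indicE in_setI (mem_set xS).
apply: (le_trans (sum_psi_le _ _ _ _)).
case: N N0 {D mD mf} => // N _.
have p01 : 0 < 2 * s < 1 by apply/andP; split; lra.
have e0 : 0 < 1 - 2 * s by lra.
rewrite /layer_const (mulrDl 2) lerD//.
  have h1 : (1 : R) `^ (1 - 2 * s) = 1 by rewrite powR1.
  rewrite -[leLHS]mulr1 ler_pM2l// -[leLHS]h1.
  by apply: ge0_ler_powR; rewrite ?nnegrE ?(ltW e0)// ler1n.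
rewrite -mulrA ler_pM2l// [leRHS]mulrC; apply: (le_trans (sum_powRN_le N p01)).
rewrite ler_pM2r ?invr_gt0//; apply: ge0_ler_powR; rewrite ?nnegrE ?(ltW e0)//.
by rewrite ler_nat.
Qed.

Variable K : R.
Hypotheses (K0 : 0 < K) (MK : M * K `^ (- (2 * s)) <= (1 + th) / 2).

Let p01 : 0 < 2 * s < 1.
Proof. by have /andP[s0 s1] := s01; apply/andP; split; lra. Qed.

(* Summing a scale-rho estimate over rho = x + K + i, i < N, with N ~ x. *)
Lemma layered_sum o (S : set T) x (I : R) (C : \bar R) : measurable S -> 1 <= x -> K <= x ->
  0 <= I -> (0 <= C)%E ->
  (forall rho, x + K <= rho <= 4 * x ->
    (I%:E <= C * \int[mu]_(y in S `&` mball dist o rho) (psi M o rho y)%:E)%E) ->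
  ((x `^ (2 * s) * I)%:E <=
     C * ((2 * layer_const)%:E * mu (S `&` mball dist o (4 * x)%R)))%E.
Proof.
move=> mS x1 Kx I0 C0 scale; have /andP[s0 s1] := p01; have lc := layer_const_gt0.
have x0 : 0 <= x by exact: le_trans x1.
pose N := Num.truncn x.
have /andP[Nx xN] : N%:R <= x < N.+1%:R by exact: truncn_itv.
have N0 : (0 < N)%N by rewrite /N truncn_gt0.
have N1 : 1 <= N%:R :> R by rewrite ler1n.
have x2N : x <= 2 * N%:R by move: xN; rewrite -natr1 => /ltW; lra.
have Np : 0 < N%:R :> R by rewrite ltr0n.
have mB := measurable_mball H o.
have step : ((N%:R * I)%:E <= C * ((layer_const * N%:R `^ (1 - 2 * s))%:E *
    mu (S `&` mball dist o (4 * x)%R)))%E.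
  apply: (@le_trans _ _ (\sum_(0 <= i < N) I%:E)%E).
    by rewrite sumEFin lee_fin sumr_const_nat subn0 mulr_natl.
  apply: (@le_trans _ _ (\sum_(0 <= i < N) C *
      \int[mu]_(y in S `&` mball dist o (x + K + i%:R)%R) (psi M o (x + K + i%:R)%R y)%:E)%E).
    rewrite !big_nat; apply: lee_sum => i /andP[_ iN]; apply: scale.
    have : i%:R <= N%:R :> R by rewrite ler_nat ltnW.
    by have : 0 <= i%:R :> R by []; move=> h1 h2; apply/andP; split; lra.
  rewrite -ge0_sume_distrr; last by move=> i _; exact: integral_psi_ge0.
  rewrite lee_wpmul2l//; apply: (le_trans (sum_psi_integral_le _ _ N0 mS)).
  rewrite lee_wpmul2l ?lee_fin ?mulr_ge0 ?powR_ge0 ?(ltW lc)//.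
  apply: le_measure; rewrite ?inE; [exact: measurableI|exact: measurableI|].
  by move=> y [yS yB]; split => //; apply: lt_le_trans yB _; lra.
(* [N] copies of the left side face only [N^(1 - 2s)] on the right; the quotient [N^(2s)] is
   comparable to [x^(2s)]. *)
have NE : N%:R = N%:R `^ (2 * s) * N%:R `^ (1 - 2 * s) :> R.
  rewrite -powRD; last by rewrite (gt_eqF Np) implybT.
  by rewrite addrC subrK powRr1.
have Ne0 : 0 < N%:R `^ (1 - 2 * s) :> R by rewrite powR_gt0.
have xN2 : x `^ (2 * s) <= 2 * N%:R `^ (2 * s).
  apply: (@le_trans _ _ ((2 * N%:R) `^ (2 * s))).
    apply: ge0_ler_powR; [exact: ltW|by rewrite nnegrE| |exact: x2N].
    by rewrite nnegrE mulr_ge0.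
  rewrite powRM// ler_wpM2r ?powR_ge0//.
  rewrite -[leRHS](powRr1 (ler0n _ 2)); apply: ler_powR; first by rewrite ler1n.
  exact: ltW.
have {}step : ((N%:R `^ (2 * s) * I)%:E <=
    C * (layer_const%:E * mu (S `&` mball dist o (4 * x)%R)))%E.
  rewrite -(@lee_pmul2l _ (N%:R `^ (1 - 2 * s))%:E) ?lte_fin//.
  rewrite muleCA -EFinM.
  have -> : N%:R `^ (1 - 2 * s) * (N%:R `^ (2 * s) * I) = N%:R * I.
    by rewrite {3}NE; ring.
  apply: (le_trans step).
  by rewrite [X in (_ <= _ * X)%E]muleA -EFinM (mulrC _ layer_const).
apply: (@le_trans _ _ (2%:E * (N%:R `^ (2 * s) * I)%:E)%E).
  by rewrite -EFinM lee_fin mulrA ler_wpM2r.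
apply: (le_trans (lee_wpmul2l _ step)); first by rewrite lee_fin.
by rewrite muleCA (muleA 2%:E) -EFinM.
Qed.

Definition level_volume o u t : R := fine (mu ([set y | th < u y] `&` mball dist o t)).

Lemma level_volumeE o r u : minimizer_in u o r -> forall t,
  mu ([set y | th < u y] `&` mball dist o t) = (level_volume o u t)%:E.
Proof.
move=> [[meas_u _] _ _] t.
apply: (@ball_measure_fin _ _ _ _ _ _ _ _ H o t); last by move=> ? [].
by apply: measurableI; [exact: measurable_superlevel|exact: measurable_mball H _ _].
Qed.

Lemma level_volume_mono o r u : minimizer_in u o r ->
  {homo level_volume o u : y z / y <= z}.
Proof.
move=> um y z yz; have [[meas_u _] _ _] := um.
rewrite -lee_fin -!(level_volumeE um); apply: le_measure; rewrite ?inE.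
- by apply: measurableI; [exact: measurable_superlevel|exact: measurable_mball H _ _].
- by apply: measurableI; [exact: measurable_superlevel|exact: measurable_mball H _ _].
- by move=> w [wU wB]; split => //; exact: lt_le_trans wB yz.
Qed.

Lemma level_volume_ge0 o u t : 0 <= level_volume o u t.
Proof. by rewrite fine_ge0. Qed.

(** For each [rho] in [[x + K, 4 x]] the volume at [rho - K] is at least that at [x], so the
    single-scale bound has a common left side. Monotonicity of the power uses [2 s <= q], a
    consequence of [1 <= q]. *)
Lemma density_growth : exists2 C, 0 < C & forall o r u x, 1 <= x -> K <= x ->
  4 * x <= r -> minimizer_in u o r ->
  x `^ (2 * s) * Num.min (level_volume o u x) (level_volume o u x `^ (1 - beta)) <=
  C * level_volume o u (4 * x).
Proof.
have [C C0 HC] := single_scale_density H s01 HW M0 tau0 taulam psi_super K0 MK.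
have lc := layer_const_gt0; have /andP[s0 s1] := p01.
exists (C * (2 * layer_const)); first by rewrite mulr_gt0// mulr_gt0.
move=> o r u x x1 Kx xr um; set V := level_volume o u.
have [[meas_u u1] _ _] := um.
have mU : measurable [set y | th < u y] by exact: measurable_superlevel.
have VE t : mu ([set y | th < u y] `&` mball dist o t) = (V t)%:E.
  exact: level_volumeE um t.
have Vmono : {homo V : y z / y <= z} by exact: level_volume_mono um.
have V0 t : 0 <= V t by exact: level_volume_ge0.
have be1 : 0 <= 1 - beta.
  rewrite subr_ge0 ler_pdivrMr; last exact: lt_le_trans q1.
  by rewrite mul1r (le_trans (ltW s1) q1).
rewrite -lee_fin (_ : (C * _ * V (4 * x))%:E = C%:E * ((2 * layer_const)%:E *
   mu ([set y | (th < u y)%R] `&` mball dist o (4 * x)%R)))%E; last first.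
  by rewrite VE -!EFinM; congr (_%:E); ring.
apply: layered_sum => //.
- by rewrite le_min V0 powR_ge0.
- by rewrite lee_fin ltW.
move=> rho /andP[r1 r2]; apply: le_trans (HC o r rho u (le_trans r2 xr) um).
rewrite lee_fin -/(V (rho - K)).
have VV : V x <= V (rho - K) by apply: Vmono; lra.
rewrite le_min !ge_min VV /=; apply/orP; right.
by apply: ge0_ler_powR; rewrite ?nnegrE ?V0 ?be1 ?VV.
Qed.

(** The layered sum is now taken over whole balls. The layer in the ball of radius [x] lies in each
    ball of radius [rho - K], and the right side is of order [x^q]. *)
Lemma transition_small : exists2 C, 0 < C & forall th2 w o r u x, 1 <= x -> K <= x ->
  4 * x <= r -> minimizer_in u o r -> 0 <= w -> (forall z, th <= z <= th2 -> w <= W z) ->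
  ((x `^ (2 * s) * w)%:E *
    mu ([set y | (th < u y)%R /\ (u y <= th2)%R] `&` mball dist o x) <= (C * x `^ q)%:E)%E.
Proof.
have [q0 a0 A0] := ahlfors_gt0 H.
have L0 := well_lip_gt0 HW; have lam0 := well_lam_gt0 HW; have /andP[th0 _] := well_th HW.
pose C1 := L + 4 * lam; have C10 : 0 < C1 by rewrite addr_gt0// mulr_gt0.
have lc := layer_const_gt0.
exists (C1 * (2 * layer_const * (A * 4 `^ q))).
  by rewrite !mulr_gt0// powR_gt0.
move=> th2 w o r u x x1 Kx xr um w0 wW.
have x0 : 0 < x by exact: lt_le_trans x1.
have [[meas_u u1] _ _] := um.
pose S := [set y | th < u y /\ u y <= th2] `&` mball dist o x.
have mB := measurable_mball H o.
have mS' : measurable [set y | th < u y /\ u y <= th2].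
  rewrite (_ : mkset _ = [set y | th < u y] `&` [set y | u y <= th2])//.
  by apply: measurableI; [exact: measurable_superlevel|exact: measurable_sublevel].
have mS : measurable S by exact: measurableI.
have SE := @ball_measure_fin _ _ _ _ _ _ _ _ H o x S mS (fun y h => h.2).
have scale rho : x + K <= rho <= 4 * x -> ((w * fine (mu S))%:E <=
    C1%:E * \int[mu]_(y in setT `&` mball dist o rho) (psi M o rho y)%:E)%E.
  move=> /andP[r1 r2]; rewrite setTI EFinM -SE.
  have MK' : M * K `^ (- (2 * s)) <= 1 + th by apply: (le_trans MK); lra.
  apply: le_trans (transition_layer_le H s01 HW M0 tau0 taulam psi_super
    (le_trans r2 xr) um w0 K0 MK' wW).
  rewrite lee_wpmul2l ?lee_fin//; apply: le_measure; rewrite ?inE//.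
    rewrite (_ : mkset _ = [set y | th < u y /\ u y <= th2] `&` mball dist o (rho - K)).
      exact: measurableI.
    by apply/seteqP; split => y /= [] => [? ? ?|[]].
  by move=> y [[h1 h2] yx]; split => //; apply: lt_le_trans yx _; lra.
have := @layered_sum o setT x (w * fine (mu S)) C1%:E measurableT x1 Kx.
rewrite setTI => /(_ _ _ scale).
rewrite mulr_ge0 ?fine_ge0// lee_fin (ltW C10) => /(_ isT isT).
rewrite (mulrA (x `^ (2 * s)) w) (EFinM _ (fine (mu S))) -SE => /le_trans; apply.
have -> : (C1 * (2 * layer_const * (A * 4 `^ q)) * x `^ q)%:E =
    (C1%:E * ((2 * layer_const)%:E * (A * (4 * x) `^ q)%:E))%E.
  by rewrite -!EFinM (powRM _ _ (ltW x0))//; congr (_%:E); ring.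
rewrite lee_wpmul2l ?lee_fin ?(ltW C10)// lee_wpmul2l//.
  by rewrite lee_fin mulr_ge0// ltW.
by apply: (ahlfors_le H); rewrite mulr_gt0.
Qed.

End density_growth.

Lemma powR_large {R : realType} (t p : R) : 0 < t -> 0 < p ->
  exists2 x0, 0 < x0 & forall x, x0 <= x -> t <= x `^ p.
Proof.
move=> t0 p0; exists (t `^ p^-1); first by rewrite powR_gt0.
move=> x tx; rewrite -[leLHS](powRr1 (ltW t0)) -(mulVf (lt0r_neq0 p0)) powRrM.
have x0 : 0 <= x by apply: le_trans tx; exact: powR_ge0.
by apply: ge0_ler_powR; rewrite ?nnegrE ?powR_ge0 ?(ltW p0).
Qed.

Theorem ahlfors_density {R : realType} {d : measure_display} {T : measurableType d}
    (mu : {sigma_finite_measure set T -> \bar R}) (dist : T -> T -> R)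
    (q a A s : R) (W : R -> R) (L lam th : R) :
  ahlfors_regular mu dist q a A -> 0 < s < 2^-1 -> 1 <= q ->
  well_bounds W L lam th ->
  exists2 c, 0 < c & forall th1 th2, -1 < th1 -> -1 < th2 < 1 ->
  exists2 r0, 0 < r0 & forall o r u, r0 <= r ->
    energy_minimizer mu dist q s W u (mball dist o r) ->
    (0 < mu (mball dist o 1%R `&` [set x | (th1 < u x)%R]))%E ->
    ((c * r `^ q)%:E <= mu ([set x | (th2 < u x)%R] `&` mball dist o r))%E.
Proof.
move=> H s01 q1 HW; have [q0 _ _] := ahlfors_gt0 H.
have lam0 := well_lam_gt0 HW; have /andP[thm _] := well_th HW.
have be0 : 0 < 2 * s / q := beta_gt0 H s01.
have s20 : 0 < 2 * s by have /andP[s0 _] := s01; rewrite mulr_gt0.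
have be1 : 2 * s / q <= 1.
  rewrite ler_pdivrMr// mul1r; apply: le_trans q1.
  by have /andP[_ s1] := s01; rewrite ltW// mulrC -ltr_pdivlMr// div1r.
have [C0 C00 super] := psi_supersolution H s01.
(* The supersolution factor [C0 / M] becomes exactly [lam]. *)
pose M := C0 / lam; have M0 : 0 < M by rewrite divr_gt0.
have psi_super o rho x : psi dist s M o rho x < 2 ->
    (\int[mu]_y (Num.max 0 (psi dist s M o rho y - psi dist s M o rho x) *
      fkernel dist q s x y)%:E <= (lam * psi dist s M o rho x)%:E)%E.
  move=> /(super _ M0); rewrite (_ : C0 / M = lam)//.
  by rewrite /M invf_div mulrCA divff ?mulr1// gt_eqF.
have th20 : 0 < (1 + th) / 2 by lra.
have [K K0 MK] := powRN_small M0 th20 s20.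
have [Cg Cg0 growth] := density_growth H s01 q1 HW M0 (ltW lam0) (lexx lam) psi_super K0 MK.
have [Ct Ct0 trans] := transition_small H s01 HW M0 (ltW lam0) (lexx lam) psi_super K0 MK.
pose k := (2 : R) `^ (2 * s / q); pose Q := (4 : R) `^ q.
have k1 : 1 < k.
  have := @gt0_ltr_powR R (2 * s / q) be0 1 2; rewrite powR1; apply; rewrite ?nnegrE//.
  by rewrite ltr1n.
have k0 : 0 < k by exact: lt_trans k1.
have Q0 : 0 < Q by rewrite powR_gt0.
have ckQ : 0 < Cg * k * Q by rewrite mulr_gt0// mulr_gt0.
(* The threshold density of the dichotomy, fixed before [th1] and [th2] are introduced. *)
pose b := (Cg * k * Q) `^ (- (2 * s / q)^-1).
have b0 : 0 < b by rewrite powR_gt0.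
have bb : b `^ (- (2 * s / q)) = Cg * k * Q.
  by rewrite /b -powRrM mulrNN mulVf ?gt_eqF// powRr1// ltW.
have [x1 x10 big1] := powR_large ckQ s20.
(* Half of [b] is given up to the transition layer, and [Q = 4^q] accounts for working at radius
   [r / 4], since [transition_small] at [x] uses barriers up to radius [4 * x]. *)
exists (b / 2 / Q); first by rewrite divr_gt0// divr_gt0.
move=> th1 th2 th1m th2b.
have [[rho m] /= [rho0 m0] init] :=
  initial_density H s01 HW M0 (ltW lam0) (lexx lam) psi_super th1m.
have [w w0 Ww] := well_pos HW th2b.
pose r1 := Num.max (Num.max 1 K) (Num.max x1 rho).
have r1P x : r1 <= x -> [/\ 1 <= x, K <= x, x1 <= x & rho <= x].
  by rewrite !ge_max => /andP[/andP[? ?] /andP[? ?]].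
have [r11 r1K r1x r1rho] := r1P _ (lexx r1).
have r10 : 0 < r1 by exact: lt_le_trans r11.
have [r2 r20 iter] := growth_iteration k1 b0 q0 m0 r10.
(* Once [x^(2s)] exceeds this number, the transition layer has volume at most [b / 2 * x^q]. *)
have t0 : 0 < 2 * Ct / (b * w) by rewrite divr_gt0// mulr_gt0.
have [x2 x20 big2] := powR_large t0 s20.
pose r3 := Num.max r1 (Num.max r2 x2).
exists (4 * r3); first by rewrite mulr_gt0// lt_max r10.
move=> o r u rbig um pos.
pose x := r / 4; have rE : r = 4 * x by rewrite /x mulrC divfK.
have : r3 <= x by rewrite /x ler_pdivlMr// mulrC.
rewrite /r3 ge_max => /andP[xr1]; rewrite ge_max => /andP[xr2 xx2].
have [x1' xK xx1 xrho] := r1P _ xr1.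
have x0 : 0 < x by exact: lt_le_trans x1'.
have rx : x <= r by rewrite rE; lra.
have [[meas_u u1] _ _] := um.
have VE := level_volumeE H th um; have Vmono := level_volume_mono H th um.
set V := level_volume mu dist th o u in VE Vmono.
have Vx : b * x `^ q <= V x.
  apply: (iter V x xr2 Vmono).
    have := init o r u (le_trans xrho rx) um pos; rewrite VE lee_fin => h.
    exact: le_trans h (Vmono _ _ r1rho).
  move=> y yr1 yx; have [y1 yK yx1 _] := r1P _ yr1.
  have y0 : 0 < y by exact: lt_le_trans y1.
  rewrite (powRM _ _ (ltW y0))//.
  apply: (@growth_dichotomy _ Cg (2 * s / q) _ _ k Q b _ (y `^ (2 * s))) => //.
  - by rewrite be0.
  - exact: level_volume_ge0.
  - exact: ltW.
  - by rewrite powR_gt0.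
  - by rewrite powR_gt0.
  - rewrite -powRrM (_ : q * - (2 * s / q) = - (2 * s)); last by field; rewrite gt_eqF.
    by rewrite powRN mulVf// gt_eqF// powR_gt0.
  - exact: big1.
  - by apply: (growth o r) => //; apply: le_trans rx.
pose Y := fine (mu ([set y | th < u y /\ u y <= th2] `&` mball dist o x)).
have mB := measurable_mball H o.
have mS : measurable [set y | th < u y /\ u y <= th2].
  rewrite (_ : mkset _ = [set y | th < u y] `&` [set y | u y <= th2])//.
  by apply: measurableI; [exact: measurable_superlevel|exact: measurable_sublevel].
have mSx := measurableI _ _ mS (mB x).
have YE := @ball_measure_fin _ _ _ _ _ _ _ _ H o x _ mSx (fun y h => h.2).
have Yle : Y <= b / 2 * x `^ q.
  have := trans th2 w o r u x x1' xK _ um (ltW w0) Ww.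
  rewrite -rE => /(_ (lexx _)); rewrite YE -/Y -EFinM lee_fin => h.
  have Y0 : 0 <= Y by rewrite fine_ge0.
  have : 2 * Ct / (b * w) * w * Y <= Ct * x `^ q.
    by apply: le_trans h; rewrite ler_wpM2r// ler_wpM2r ?(ltW w0)//; exact: big2.
  have -> : 2 * Ct / (b * w) * w * Y = Ct * (2 / b * Y) by field; rewrite !gt_eqF.
  rewrite ler_pM2l// => h'.
  have -> : Y = b / 2 * (2 / b * Y) by field; rewrite gt_eqF.
  by rewrite ler_wpM2l// divr_ge0// ltW.
have mU2 : measurable [set y | th2 < u y] by exact: measurable_superlevel.
have mU2x := measurableI _ _ mU2 (mB x).
have UE := @ball_measure_fin _ _ _ _ _ _ _ _ H o x _ mU2x (fun y h => h.2).
apply: (@le_trans _ _ (mu ([set y | (th2 < u y)%R] `&` mball dist o x))); last first.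
  apply: le_measure; rewrite ?inE; [exact: mU2x|exact: measurableI|].
  by move=> y [yu yB]; split => //; exact: lt_le_trans yB rx.
have : ((V x)%:E <= Y%:E + mu ([set y | (th2 < u y)%R] `&` mball dist o x))%E.
  rewrite -VE /Y -YE; apply: le_trans (measureU2 mu mSx mU2x).
  apply: le_measure; rewrite ?inE.
  - by apply: measurableI => //; exact: measurable_superlevel.
  - exact: measurableU.
  - move=> y [yth yB]; have [yu|yu] := leP (u y) th2; first by left.
    by right.
rewrite UE -EFinD !lee_fin => Vle.
have -> : b / 2 / Q * r `^ q = b / 2 * x `^ q.
  by rewrite rE (powRM _ _ (ltW x0))// -/Q; field; rewrite gt_eqF.
have e : b * x `^ q = b / 2 * x `^ q + b / 2 * x `^ q by field.
lra.
Qed.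

(** * Double-well potentials of class C^2 *)

Section derivative_on.
Context {R : realType}.
Implicit Types (f g : R -> R) (a b x : R).

Lemma has_derivative_on_continuous (D : set R) f g :
  has_derivative_on D f g -> {within D, continuous f}.
Proof.
move=> df; apply/subspace_continuousP => x Dx.
have Hx : f y @[y --> within D x^'] --> f x.
  have c1 : (f y - f x) / (y - x) * (y - x) @[y --> within D x^'] --> g x * 0.
    apply: cvgM; first exact: df.
    have : y - x @[y --> x] --> x - x by apply: cvgB; [exact: cvg_id|exact: cvg_cst].
    rewrite subrr => c0; apply: cvg_trans c0; apply: cvg_app.
    by move=> P nP; rewrite /within/=; apply: filterS nP.
  have c2 : (f y - f x) / (y - x) * (y - x) + f x @[y --> within D x^'] --> g x * 0 + f x.
    by apply: cvgD => //; exact: cvg_cst.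
  rewrite mulr0 add0r in c2; apply: cvg_trans c2.
  have eqf : \forall y \near within D x^', (f y - f x) / (y - x) * (y - x) + f x = f y.
    have ne : \forall y \near within D x^', y != x.
      exact: (@cvg_within _ x^' _ D _ (nbhs_dnbhs_neq x)).
    by apply: filterS ne => y yx; rewrite divfK ?subrK// subr_eq0.
  exact: near_eq_cvg eqf.
move=> P nP; have h : nbhs x (fun y => y != x -> D y -> P (f y)) := Hx P nP.
change (nbhs x (fun y => D y -> P (f y))).
apply: filterS h => y Hy Dy; have [->|yx] := eqVneq y x; first exact: nbhs_singleton.
exact: Hy.
Qed.

Lemma has_derivative_on_interior a b f g x : has_derivative_on `[a, b] f g ->
  x \in `]a, b[ -> is_derive x 1 f (g x).
Proof.
rewrite in_itv/= => df /andP[ax xb].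
have xab : `[a, b]%classic x by rewrite /= in_itv/= !ltW.
have nab : nbhs x `]a, b[%classic.
  by apply: near_in_itv; rewrite in_itv/= ax xb.
have c1 : (f y - f x) / (y - x) @[y --> x^'] --> g x.
  move=> P nP.
  have h : nbhs x (fun y => y != x -> `[a, b]%classic y -> P ((f y - f x) / (y - x))) :=
    df x xab P nP.
  change (nbhs x (fun y => y != x -> P ((f y - f x) / (y - x)))).
  apply: filterS2 h nab => y h yab yx; apply: h => //.
  by move: yab; rewrite /= !in_itv/= => /andP[? ?]; rewrite !ltW.
(* Change of variable from [y] to the increment [h = y - x], in which the library states
   derivatives. *)
have c2 : h + x @[h --> (0 : R)^'] --> x^'.
  move=> P nP; change (nbhs (0 : R) (fun h => h != 0 -> P (h + x))).
  have c0 : h + x @[h --> (0 : R)] --> 0 + x by apply: cvgD; [exact: cvg_id|exact: cvg_cst].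
  rewrite add0r in c0.
  have h1 : nbhs (0 : R) (fun h => h + x != x -> P (h + x)) := c0 _ nP.
  apply: filterS h1 => h hP h0.
  by apply: hP; rewrite -subr_eq0 addrK.
have c3 : h^-1 *: (f (h *: 1 + x) - f x) @[h --> (0 : R)^'] --> g x.
  have -> : (fun h : R => h^-1 *: (f (h *: (1 : R) + x) - f x)) =
      (fun y => (f y - f x) / (y - x)) \o (fun h => h + x).
    by apply/funext => h /=; rewrite addrK [LHS]mulrC /GRing.scale/= mulr1.
  exact: cvg_comp c2 c1.
apply: DeriveDef; first by apply/cvg_ex; exists (g x).
exact: cvg_lim c3.
Qed.

Lemma has_derivative_on_mvt a b f g x y : has_derivative_on `[a, b] f g ->
  a <= x -> x < y -> y <= b ->
  exists2 c, x < c < y & f y - f x = g c * (y - x).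
Proof.
move=> df ax xy yb.
have xyab : `[x, y] `<=` `[a, b].
  move=> z /=; rewrite !in_itv/= => /andP[xz zy].
  by rewrite (le_trans ax xz) (le_trans zy yb).
have dfz z : z \in `]x, y[ -> is_derive z 1 f (g z).
  rewrite in_itv/= => /andP[xz zy]; apply: has_derivative_on_interior df _.
  by rewrite in_itv/= (le_lt_trans ax xz) (lt_le_trans zy yb).
have [] := MVT xy dfz; last by move=> c; rewrite in_itv/=; exists c.
by apply: continuous_subspaceW xyab _; exact: has_derivative_on_continuous df.
Qed.

End derivative_on.

(** Continuity of [W''] gives [W'' > 4 lam] near [-1]. Two applications of the mean value theorem
    yield [W'(t) >= 4 lam (1 + t)] and then a lower bound for the increments of [W]. The extreme
    values of [W'] give [L], and compactness gives the positive minimum of [W] on [[th, t]]. *)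
Lemma C2_well_bounds {R : realType} (W W' W'' : R -> R) :
  C2_on `[-1, 1] W W' W'' ->
  (forall t : R, -1 <= t <= 1 -> 0 <= W t) -> W (-1) = 0 ->
  (forall t : R, -1 < t < 1 -> 0 < W t) -> W' (-1) = 0 -> 0 < W'' (-1) ->
  exists L lam th, well_bounds W L lam th.
Proof.
move=> [dW dW' cW''] W0 Wm1 Wpos W'm1 W''m1.
have m1 : (-1 : R) <= 1 by lra.
have cW := has_derivative_on_continuous dW.
have cW' := has_derivative_on_continuous dW'.
have [c1 _ max1] := EVT_max m1 cW'.
have [c2 _ min1] := EVT_min m1 cW'.
pose L := 1 + `|W' c1| + `|W' c2|.
have L0 : 0 < L by rewrite /L -addrA ltr_wpDr// addr_ge0.
pose lam := W'' (-1) / 8.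
have lam0 : 0 < lam by rewrite divr_gt0.
have [e e0 He] : exists2 e : R, 0 < e & forall t, -1 <= t <= 1 -> t < -1 + e -> 4 * lam < W'' t.
  have am1 : `[-1, 1]%classic (-1 : R) by rewrite /= in_itv/= lexx.
  have /subspace_continuousP/(_ _ am1) cvg := cW''.
  have lt4 : 4 * lam < W'' (-1) by rewrite /lam; lra.
  have h : nbhs (-1 : R) (fun t => `[-1, 1]%classic t -> 4 * lam < W'' t) :=
    cvgr_gt (FF := within_filter _ (nbhs_filter _)) _ cvg _ lt4.
  have [e /= e0 He] := (nbhs_ballP (-1 : R) _).1 h.
  exists e => // t t1 te; apply: (He t) => //.
  by rewrite /ball/= ler0_norm; lra.
pose th := Num.min 0 (-1 + e / 2).
have th1 : -1 < th by rewrite lt_min; apply/andP; split; lra.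
have th0 : th <= 0 by rewrite ge_min lexx.
have the : th <= -1 + e / 2 by rewrite ge_min lexx orbT.
have W'ge t : -1 <= t -> t <= th -> 4 * lam * (1 + t) <= W' t.
  move=> ta tb; have [<-|tn] := eqVneq (-1) t; first by rewrite W'm1 subrr mulr0.
  have ta' : -1 < t by rewrite lt_neqAle tn.
  have [|c /andP[ca cb] E] := has_derivative_on_mvt dW' (lexx _) ta'; first by lra.
  rewrite -[leRHS]subr0 -[in leRHS]W'm1 E (_ : t - -1 = 1 + t); last by ring.
  rewrite ler_wpM2r; [by []|lra|].
  by apply/ltW/He; [apply/andP; split|]; lra.
have Wge x y : -1 <= x -> x <= y -> y <= th -> 4 * lam * (1 + x) * (y - x) <= W y - W x.
  move=> xa; rewrite le_eqVlt => /predU1P[->|xy] yth; first by rewrite !subrr mulr0.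
  have [|c /andP[ca cb] ->] := has_derivative_on_mvt dW xa xy; first by lra.
  rewrite ler_wpM2r//; first by lra.
  apply: le_trans (W'ge c _ _); [|lra|lra].
  by rewrite ler_wpM2l//; lra.
exists L, lam, th; split => //.
- exact: subspace_continuous_measurable_fun.
- move=> x y /andP[xa xb] /andP[ya yb].
  have LB c : -1 <= c <= 1 -> `|W' c| <= L.
    move=> cab; have cI : c \in `[-1, 1] by rewrite in_itv.
    have := max1 c cI; have := min1 c cI.
    have := ler_norm (W' c1); have := ler_norm (- W' c2); rewrite normrN; have := normr_ge0 (W' c1).
    have := normr_ge0 (W' c2); rewrite /L ler_norml => *; apply/andP; split; lra.
  have [xy|yx|->] := ltgtP x y; last by rewrite !subrr normr0 mulr0.
    have [|c /andP[ca cb] ->] := has_derivative_on_mvt dW xa xy; first by [].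
    apply: le_trans (ler_norm _) _; rewrite normrM ler_wpM2r//.
    by apply: LB; apply/andP; split; lra.
  have [|c /andP[ca cb] E] := has_derivative_on_mvt dW ya yx; first by [].
  have -> : W y - W x = - (W x - W y) by ring.
  rewrite E; apply: le_trans (ler_norm _) _; rewrite normrN normrM distrC ler_wpM2r//.
  by apply: LB; apply/andP; split; lra.
- by rewrite th1 /=; lra.
- move=> x y xa xy yth.
  (* [Wge] on [[x, y]] alone has no quadratic term. Applied to both halves, it gains one from the
     difference between [1 + m] and [1 + x]. *)
  pose m := (x + y) / 2.
  have h1 : 4 * lam * (1 + x) * (m - x) <= W m - W x by apply: Wge; rewrite /m; lra.
  have h2 : 4 * lam * (1 + m) * (y - m) <= W y - W m by apply: Wge; rewrite /m; lra.
  have g0 : 0 <= lam * ((1 + x) * (y - x)).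
    by rewrite mulr_ge0 ?(ltW lam0)// mulr_ge0; lra.
  have -> : W y - W x = (W m - W x) + (W y - W m) by ring.
  apply: le_trans (lerD h1 h2).
  have -> : 4 * lam * (1 + x) * (m - x) + 4 * lam * (1 + m) * (y - m) =
    lam * (2 * (1 + x) * (y - x) + (y - x) ^+ 2) + 2 * (lam * ((1 + x) * (y - x))).
    by rewrite /m; field.
  by rewrite lerDl mulr_ge0.
- move=> t /andP[ta tb]; have [tth|tth] := ltP t th.
    (* For [t < th] no [z] lies between [th] and [t], so any positive value serves. *)
    by exists 1 => // z /andP[h1 h2]; exfalso; lra.
  have sub : `[th, t] `<=` `[-1, 1].
    by move=> z /=; rewrite !in_itv/= => /andP[h1 h2]; apply/andP; split; lra.
  have [c cI Hc] := EVT_min tth (continuous_subspaceW sub cW).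
  move: cI; rewrite in_itv/= => /andP[ca cb].
  exists (W c); first by apply: Wpos; apply/andP; split; lra.
  by move=> z zI; apply: Hc; rewrite in_itv.
Qed.

Unset Implicit Arguments.
Set Strict Implicit.
Set Printing Implicit Defensive.

(** * The Euclidean case *)

Definition edist {R : realType} {n : nat} (x y : euclidean R n) : R := enorm (x - y).

(** A ball of radius [r] lies in the cube of half-side [r] and contains the one of half-side
    [r / (2 n)], of measure [(r / n)^n]. Half-side [r / n] would only give [enorm <= r], while the
    balls are open. *)
Lemma ahlfors_regular_lebesgue (R : realType) n : (0 < n)%N ->
  ahlfors_regular (lebesgue R n) (@edist R n) n%:R (n%:R^-1 ^+ n) (2 ^+ n).
Proof.
move=> n0; have n0' : 0 < n%:R :> R by rewrite ltr0n.
split.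
- exact: measurable_enormB2.
- by move=> x y; exact: enorm_ge0.
- by move=> x y; exact: enormC.
- move=> x y z; rewrite /edist; have -> : x - z = (x - y) + (y - z) by rewrite addrA subrK.
  exact: enormD.
- by split => //; rewrite exprn_gt0// invr_gt0.
- move=> x r r0; rewrite powR_mulrn ?(ltW r0)// -exprMn.
  exact: lebesgue_ball_le _ _ (ltW r0).
- move=> x r r0; rewrite powR_mulrn ?(ltW r0)// -exprMn.
  have e0 : 0 <= r / (2 * n%:R) by rewrite divr_ge0 ?mulr_ge0// ltW.
  have -> : n%:R^-1 * r = 2 * (r / (2 * n%:R)) by field; rewrite gt_eqF.
  rewrite -(lebesgue_cube x _ e0); apply: le_measure.
  + by apply/mem_set; exact: measurable_cube.
  + by apply/mem_set; exact: (measurable_enorm_ball x r).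
  + move=> y /(cube_enorm x _ y n0 e0); rewrite /mball /edist /= => /le_lt_trans; apply.
    have -> : n%:R * (r / (2 * n%:R)) = r / 2 by field; rewrite gt_eqF.
    by rewrite ltr_pdivrMr// ltr_pMr// ltr1n.
Qed.

Lemma eball_mball (R : realType) n r : eball R n r = mball (@edist R n) (0%R : 'rV[R]_n) r.
Proof. by apply/seteqP; split => x; rewrite /eball /mball /edist /= sub0r enormN. Qed.

(** Turns the value at the origin into the measure condition used by the density estimate:
    [ucont > th] on a small ball of positive measure, and [u = ucont] there up to a null set. *)
Lemma superlevel_gt0 (R : realType) n (r th : R) (u ucont : 'rV[R]_n -> R) :
  (0 < n)%N -> 0 < r ->
  measurable_fun [set: euclidean R n] u ->
  {within eball R n r, continuous ucont} ->
  {ae lebesgue R n, forall x, eball R n r x -> ucont x = u x} ->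
  th < ucont 0 ->
  (0 < lebesgue R n (mball (@edist R n) (0%R : 'rV[R]_n) 1%R `&` [set x | (th < u x)%R]))%E.
Proof.
move=> n0 r0 meas_u /subspace_continuousP cu [N [mN N0 HN]] th0.
have H := ahlfors_regular_lebesgue R n n0.
have B0 : eball R n r 0 by rewrite /eball /= enorm0.
have near0 : nbhs (0 : 'rV[R]_n) (fun x => eball R n r x -> th < ucont x) :=
  cvgr_gt (FF := within_filter _ (nbhs_filter _)) _ (cu _ B0) _ th0.
have [e /= e0 He] := (nbhs_ballP (0 : 'rV[R]_n) _).1 near0.
pose eta := Num.min e (Num.min 1 r).
have eta0 : 0 < eta by rewrite !lt_min e0 ltr01 r0.
have [etae eta1 etar] : [/\ eta <= e, eta <= 1 & eta <= r].
  by rewrite /eta !ge_min !lexx !orbT.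
pose B := mball (@edist R n) (0%R : 'rV[R]_n) eta.
have mB : measurable B by exact: (measurable_mball H).
have muB : (0 < lebesgue R n B)%E.
  apply: lt_le_trans (ahlfors_ge H 0 eta0).
  by rewrite lte_fin mulr_gt0 ?powR_gt0// exprn_gt0// invr_gt0 ltr0n.
have mS : measurable (mball (@edist R n) (0%R : 'rV[R]_n) 1%R `&` [set x | th < u x]).
  by apply: measurableI; [exact: (measurable_mball H)|exact: measurable_superlevel].
have Bsub : B `<=` (mball (@edist R n) (0%R : 'rV[R]_n) 1%R `&` [set x | th < u x]) `|` N.
  move=> x xB.
  have xe : enorm x < eta by move: xB; rewrite /B -eball_mball.
  have xr : eball R n r x by exact: lt_le_trans xe etar.
  have [ux|ux] := eqVneq (ucont x) (u x); last first.
    by right; apply: HN => /= /(_ xr) E; rewrite E eqxx in ux.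
  left; split; first exact: lt_le_trans xB eta1.
  rewrite /= -ux; apply: He => //.
  (* The neighbourhood is a ball for the sup norm, and each coordinate is bounded by [enorm x]. *)
  split=> // i j; rewrite /ball /= ord1 mxE sub0r normrN.
  by apply: le_lt_trans (coord_le_enorm x j) _; exact: lt_le_trans xe etae.
apply: lt_le_trans muB _; apply: (@le_trans _ _ (lebesgue R n
   ((mball (@edist R n) (0%R : 'rV[R]_n) 1%R `&` [set x | (th < u x)%R]) `|` N))).
  by apply: le_measure; rewrite ?inE//; exact: measurableU.
apply: le_trans (measureU2 (lebesgue R n) mS mN) _.
by move: N0 => /= ->; rewrite adde0.
Qed.

Theorem theorem1 (R : realType) (n : nat) (s : R) (W W' W'' : R -> R)
    (hn : (2 <= n)%N) (hs : 0 < s < 2^-1)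
    (hWC2 : C2_on `[-1, 1] W W' W'')
    (hWge0 : forall t : R, -1 <= t <= 1 -> 0 <= W t)
    (hW : W (-1) = 0 /\ W 1 = 0)
    (hWgt0 : forall t : R, -1 < t < 1 -> 0 < W t)
    (hW' : W' (-1) = 0 /\ W' 1 = 0)
    (hW'' : 0 < W'' (-1) /\ 0 < W'' 1) :
  exists2 c : R, 0 < c &
    forall theta1 theta2 : R, -1 < theta1 < 1 -> -1 < theta2 < 1 ->
      exists2 Rbar : R, 0 < Rbar &
        forall (r : R) (u ucont : 'rV[R]_n -> R),
          Rbar <= r ->
          minimizer s W u (eball R n r) ->
          {within eball R n r, continuous ucont} ->
          {ae lebesgue R n, forall x, eball R n r x -> ucont x = u x} ->
          theta1 < ucont 0 ->
          ((c * r ^+ n)%:E <=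
             lebesgue R n ([set x | (theta2 < u x)%R] `&` eball R n r))%E.
Proof.
have n0 : (0 < n)%N by exact: ltnW.
have n1 : 1 <= n%:R :> R by rewrite ler1n.
have [L [lam [th well]]] :=
  C2_well_bounds hWC2 hWge0 (proj1 hW) hWgt0 (proj1 hW') (proj1 hW'').
have [c c0 density] := ahlfors_density (ahlfors_regular_lebesgue R n n0) hs n1 well.
exists c => // th1 th2 /andP[th1m _] th2b.
have [r0 r00 {}density] := density th1 th2 th1m th2b.
exists r0 => // r u ucont r0r umin cu ae_u th1u.
have rp : 0 < r by exact: lt_le_trans r0r.
have [[meas_u u1] ufin uleast] := umin.
have pos := superlevel_gt0 R n r th1 u ucont n0 rp meas_u cu ae_u th1u.
rewrite -(powR_mulrn n (ltW rp)) eball_mball.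
apply: density => //; rewrite -eball_mball.
by split.
Qed.
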